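(* Let $(M,g,\mathcal F)$ be a compact connected foliated Riemannian manifold (without boundary) and let $(M',g',\mathcal F')$ be a foliated Riemannian manifold. Assume that ${\rm Ric}^Q\ge\lambda\,{\rm id}$ and $K^{Q'}\le\mu$ for positive constants $\lambda$ and $\mu$. Let $\phi:(M,\mathcal F)\to(M',\mathcal F')$ be a transversally harmonic map with $\max_M\{rank_T(\phi)\}\le C$, where $C\ge2$ is a constant and $rank_T(\phi)$ denotes the rank of $d_T\phi$. If $|d_T\phi|^2\le\frac{\lambda C}{\mu(C-1)}$ on $M$, then $\phi$ is transversally constant or $\phi$ is transversally totally geodesic. In particular, if $|d_T\phi|^2\le\frac{\lambda}{\mu}$ on $M$, then $\phi$ is transversally constant.
   Context: A foliated Riemannian manifold $(M,g,\mathcal F)$ is a smooth manifold with a foliation $\mathcal F$ of dimension $p$ and codimension $q$ and a bundle-like metric $g$ (so $\mathcal F$ is a Riemannian foliation). $L\subset TM$ is the tangent bundle of $\mathcal F$, $Q=TM/L$ the normal bundle, $\pi:TM\to Q$ the projection, and $\sigma:Q\to L^\perp$ the bundle map with $\pi\circ\sigma=\mathrm{id}$; $Q$ is identified with $L^\perp$ via $\sigma$, with metric $g_Q(s,t)=g(\sigma(s),\sigma(t))$. The transverse Levi-Civita connection $\nabla$ on $Q$ is given by $\nabla_Xs=\pi([X,\sigma(s)])$ for $X\in\Gamma L$ and $\nabla_Xs=\pi(\nabla^M_X\sigma(s))$ for $X\in\Gamma L^\perp$, where $\nabla^M$ is the Levi-Civita connection of $g$. Its curvature is $R^Q(X,Y)=[\nabla_X,\nabla_Y]-\nabla_{[X,Y]}$;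 the transversal sectional curvature $K^Q$ and the transversal Ricci operator ${\rm Ric}^Q(s)=\sum_aR^Q(s,E_a)E_a$ are formed from $R^Q$ and $g_Q$ in the usual way. Corresponding objects on $M'$ carry a prime. A local orthonormal basic frame $\{E_a\}_{a=1}^q$ of $Q$ is a local orthonormal frame whose elements are projections $\pi(Y)$ of local vector fields $Y$ with $[Y,Z]\in\Gamma L$ for all $Z\in\Gamma L$. A smooth map $\phi:M\to M'$ is foliated if $d\phi(L)\subset L'$. Then $d_T\phi:=\pi'\circ d\phi\circ\sigma:Q\to Q'$ is a section of $Q^*\otimes\phi^{-1}Q'$, and $|d_T\phi|^2=\sum_ag_{Q'}(d_T\phi(E_a),d_T\phi(E_a))$. Let $\nabla^\phi$ be the pull-back to $\phi^{-1}Q'$ of the transverse Levi-Civita connection of $Q'$, and $\tilde\nabla$ the induced connection on $Q^*\otimes\phi^{-1}Q'$. The map $\phi$ is transversally totally geodesic if $(\tilde\nabla_Xd_T\phi)(Y)=0$ for all $X,Y\in\Gamma Q$; it is transversally constant if $d\phi(TM)\subset L'$ (i.e. $d_T\phi=0$). The transversal tension field is $\tau_b(\phi)=\sum_{a=1}^q(\tilde\nabla_{E_a}d_T\phi)(E_a)$, and a smooth foliated map $\phi$ is transversally harmonic if $\tau_b(\phi)=0$. *)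

(* Defs.v *)
(* Foliated Riemannian manifolds over MathComp-Analysis, described through an
   atlas of foliated charts.  In such a chart R^(p+q) splits as R^p x R^q, the
   first p coordinates running along the leaves. *)
From mathcomp Require Import all_boot all_order all_algebra.
From mathcomp Require Import all_classical all_reals all_analysis.
Import Order.TTheory GRing.Theory Num.Theory.
Import numFieldNormedType.Exports.

Set Implicit Arguments.
Unset Strict Implicit.
Unset Printing Implicit Defensive.

Local Open Scope classical_set_scope.
Local Open Scope ring_scope.

(** * Smooth maps between open subsets of normed spaces *)

Fixpoint Ck_on (R : realType) (V W : normedModType R) (k : nat) (U : set V)
    (f : V -> W) : Prop :=
  if k is k'.+1 then
    (forall u, U u -> differentiable f u) /\
    (forall v, Ck_on k' U (fun u => 'D_v f u))
  else forall u, U u -> {for u, continuous f}.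

Definition smooth_on (R : realType) (V W : normedModType R) (U : set V)
    (f : V -> W) : Prop :=
  forall k, Ck_on k U f.

(** * Foliated charts and atlases *)

(* cinv is total but only meaningful on the image of the chart. *)
Record chart (R : realType) (M : topologicalType) (n : nat) := Chart {
  cdom : set M;
  cmap : M -> 'rV[R]_n;
  cinv : 'rV[R]_n -> M;
  cdom_open : open cdom;
  cimg_open : open (cmap @` cdom);
  cmapK : forall x, cdom x -> cinv (cmap x) = x;
  cmap_continuous : forall x, cdom x -> {for x, continuous cmap};
  cinv_continuous :
    forall u, (cmap @` cdom) u -> {for u, continuous cinv} }.

Definition cimg (R : realType) (M : topologicalType) (n : nat)
    (c : chart R M n) : set 'rV[R]_n :=
  cmap c @` cdom c.

(* f : M -> M' read in the charts c and d. *)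
Definition rep (R : realType) (M M' : topologicalType) (n n' : nat)
    (c : chart R M n) (d : chart R M' n') (f : M -> M') :
    'rV[R]_n -> 'rV[R]_n' :=
  fun u => cmap d (f (cinv c u)).

Definition rep_dom (R : realType) (M M' : topologicalType) (n n' : nat)
    (c : chart R M n) (d : chart R M' n') (f : M -> M') : set 'rV[R]_n :=
  [set u | cimg c u /\ cdom d (f (cinv c u))].

(* The fibre of Q = TM/L is identified with R^q by the last q coordinates, so
   that pi : TM -> Q reads rsubmx and L is its kernel. *)
Definition tangL (R : realType) (p q : nat) (v : 'rV[R]_(p + q)) : Prop :=
  rsubmx v = 0.

Definition foliated_on (R : realType) (p q p' q' : nat)
    (U : set 'rV[R]_(p + q)) (f : 'rV[R]_(p + q) -> 'rV[R]_(p' + q')) : Prop :=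
  smooth_on U f /\ (forall u v, U u -> tangL v -> tangL ('d f u v)).

Record foliatedManifold (R : realType) (p q : nat) (M : topologicalType) :=
  FoliatedManifold {
  fol_hausdorff : hausdorff_space M;
  fol_countable : @second_countable M;
  atlas : set (chart R M (p + q));
  atlas_cover : forall x, exists2 c, atlas c & cdom c x;
  atlas_compat : forall c d, atlas c -> atlas d ->
    foliated_on (rep_dom c d id) (rep c d id) }.

(** * Local Riemannian geometry of a foliated chart

    G : 'rV_(p + q) -> 'M_(p + q) is the Gram matrix of the metric; vector
    fields are maps 'rV_(p + q) -> 'rV_(p + q) and sections of Q are maps
    'rV_(p + q) -> 'rV_q. *)

Section LocalGeometry.
Variables (R : realType) (p q : nat).
Notation vec := ('rV[R]_(p + q)).
Notation gram := (vec -> 'M[R]_(p + q)).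
Implicit Types (G : gram) (V : set vec) (u v w : vec) (X Y Z : vec -> vec).
Implicit Types (s t : vec -> 'rV[R]_q).

Definition inner G u v w : R := (v *m G u *m w^T) 0 0.

(* sigma (s) = (- s G_QL G_LL^-1, s) for the blocks G_LL, G_QL of G; see
   rsubmx_sigma and sigma_orthogonal below. *)
Definition sigma G u (a : 'rV[R]_q) : vec :=
  row_mx (- (a *m dlsubmx (G u) *m invmx (ulsubmx (G u)))) a.

Definition gQ G u (a b : 'rV[R]_q) : R := inner G u (sigma G u a) (sigma G u b).

Definition bracket X Y : vec -> vec :=
  fun u => 'D_(X u) Y u - 'D_(Y u) X u.

(* Koszul's formula for vectors v, w with constant coordinates:
   2 g(christoffel v w, z) = v g(w, z) + w g(v, z) - z g(v, w). *)
Definition christoffel G u v w : vec :=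
  2^-1 *: ((w *m 'D_v G u + v *m 'D_w G u
            - \row_i inner ('D_(delta_mx 0 i) G) u v w) *m invmx (G u)).

Definition nablaM G X Y : vec -> vec :=
  fun u => 'D_(X u) Y u + christoffel G u (X u) (Y u).

Definition perp_part G X : vec -> vec := fun u => sigma G u (rsubmx (X u)).
Definition leaf_part G X : vec -> vec := fun u => X u - perp_part G X u.
Definition sigma_sec G s : vec -> vec := fun u => sigma G u (s u).

(* pi [X_L, sigma s] + pi (nablaM_(X_perp) (sigma s)) for X = X_L + X_perp. *)
Definition nablaQ G X s : vec -> 'rV[R]_q := fun u =>
  rsubmx (bracket (leaf_part G X) (sigma_sec G s) u) +
  rsubmx (nablaM G (perp_part G X) (sigma_sec G s) u).

Definition curvQ G X Y s : vec -> 'rV[R]_q := fun u =>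
  nablaQ G X (nablaQ G Y s) u - nablaQ G Y (nablaQ G X s) u
  - nablaQ G (bracket X Y) s u.

Definition RicQ G (E : 'I_q -> vec -> 'rV[R]_q) s : vec -> 'rV[R]_q := fun u =>
  \sum_(a < q) curvQ G (sigma_sec G s) (sigma_sec G (E a)) (E a) u.

Definition sectionalQ G s t u : R :=
  gQ G u (curvQ G (sigma_sec G s) (sigma_sec G t) t u) (s u) /
  (gQ G u (s u) (s u) * gQ G u (t u) (t u) - gQ G u (s u) (t u) ^+ 2).

Definition basic_field V Y : Prop :=
  smooth_on V Y /\
  (forall Z, smooth_on V Z -> (forall u, V u -> tangL (Z u)) ->
     forall u, V u -> tangL (bracket Y Z u)).

Definition orthonormalQ G u (e : 'I_q -> 'rV[R]_q) : Prop :=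
  forall a b, gQ G u (e a) (e b) = (a == b)%:R.

Definition basic_frame G V (E : 'I_q -> vec -> 'rV[R]_q) : Prop :=
  (forall u, V u -> orthonormalQ G u (fun a => E a u)) /\
  (forall a, exists2 Y, basic_field V Y & forall u, V u -> E a u = rsubmx (Y u)).

Definition riemannian_on V G : Prop :=
  [/\ smooth_on V G,
      forall u, V u -> (G u)^T = G u &
      forall u v, V u -> v != 0 -> 0 < inner G u v v].

(* X g(Y, Z) = 0 for X tangent to L and Y, Z basic and orthogonal to L. *)
Definition bundle_like_on (U : set vec) G : Prop :=
  forall V, open V -> V `<=` U ->
  forall Y Z, basic_field V Y -> basic_field V Z ->
    (forall u l, V u -> tangL l -> inner G u (Y u) l = 0) ->
    (forall u l, V u -> tangL l -> inner G u (Z u) l = 0) ->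
  forall u l, V u -> tangL l -> 'D_l (fun u => inner G u (Y u) (Z u)) u = 0.

Lemma rsubmx_sigma G u (a : 'rV[R]_q) : rsubmx (sigma G u a) = a.
Proof. by rewrite /sigma row_mxKr. Qed.

Lemma sigma_orthogonal G u (a : 'rV[R]_q) (l : vec) :
  ulsubmx (G u) \in unitmx -> tangL l -> inner G u (sigma G u a) l = 0.
Proof.
move=> Gu Ll; rewrite /inner /sigma -[G u]submxK -[l]hsubmxK Ll.
rewrite tr_row_mx mul_row_block mul_row_col trmx0 mulmx0 addr0.
by rewrite !block_mxKul !block_mxKdl mulNmx mulmxKV // addNr mul0mx mxE.
Qed.

End LocalGeometry.

(** * Foliated Riemannian manifolds *)

(* The value of metric on a chart outside the atlas is irrelevant. *)
Record foliatedRiemannian (R : realType) (p q : nat) (M : topologicalType) :=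
  FoliatedRiemannian {
  fol :> foliatedManifold R p q M;
  metric : chart R M (p + q) -> 'rV[R]_(p + q) -> 'M[R]_(p + q);
  metric_riemannian : forall c, atlas fol c -> riemannian_on (cimg c) (metric c);
  metric_compat : forall c d, atlas fol c -> atlas fol d ->
    forall u, rep_dom c d id u -> forall v w,
      inner (metric c) u v w =
      inner (metric d) (rep c d id u)
        ('d (rep c d id) u v) ('d (rep c d id) u w);
  metric_bundle_like :
    forall c, atlas fol c -> bundle_like_on (cimg c) (metric c) }.

Section Curvature.
Variables (R : realType) (p q : nat) (M : topologicalType).
Variable F : foliatedRiemannian R p q M.

Definition RicQ_ge (lambda : R) : Prop :=
  forall c, atlas F c -> forall V, open V -> V `<=` cimg c ->
  forall E s, basic_frame (metric F c) V E -> smooth_on V s ->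
  forall u, V u ->
    lambda * gQ (metric F c) u (s u) (s u) <=
    gQ (metric F c) u (RicQ (metric F c) E s u) (s u).

Definition sectionalQ_le (mu : R) : Prop :=
  forall c, atlas F c -> forall V, open V -> V `<=` cimg c ->
  forall s t, smooth_on V s -> smooth_on V t ->
  forall u, V u -> row_free (col_mx (s u) (t u)) ->
    sectionalQ (metric F c) s t u <= mu.

End Curvature.

(** * Foliated maps *)

(* f is the coordinate expression of a foliated map, G and G' are the Gram
   matrices at the source and at the target. *)
Section LocalMaps.
Variables (R : realType) (p q p' q' : nat).
Variables (G : 'rV[R]_(p + q) -> 'M[R]_(p + q)).
Variables (G' : 'rV[R]_(p' + q') -> 'M[R]_(p' + q')).
Variable f : 'rV[R]_(p + q) -> 'rV[R]_(p' + q').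
Implicit Types (u : 'rV[R]_(p + q)) (s t : 'rV[R]_(p + q) -> 'rV[R]_q).

Definition dT u (a : 'rV[R]_q) : 'rV[R]_q' := rsubmx ('d f u (sigma G u a)).

Definition rankT u : nat := \rank (lin1_mx (dT u)).

Definition dT_norm2 u (e : 'I_q -> 'rV[R]_q) : R :=
  \sum_(a < q) gQ G' (f u) (dT u (e a)) (dT u (e a)).

(* The pull-back connection is determined by the Leibniz rule and
   nabla^phi_X (r o f) = nabla'_(df X) r; it is expanded here along the
   coordinate frame of Q', nablaQ being tensorial in its direction. *)
Definition nabla_phi (X : 'rV[R]_(p + q) -> 'rV[R]_(p + q))
    (W : 'rV[R]_(p + q) -> 'rV[R]_q') : 'rV[R]_(p + q) -> 'rV[R]_q' :=
  fun u => 'D_(X u) W u + nablaQ G' (cst ('d f u (X u))) (cst (W u)) (f u).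

Definition nabla_dT s t : 'rV[R]_(p + q) -> 'rV[R]_q' := fun u =>
  nabla_phi (sigma_sec G s) (fun u => dT u (t u)) u
  - dT u (nablaQ G (sigma_sec G s) t u).

Definition tension (E : 'I_q -> 'rV[R]_(p + q) -> 'rV[R]_q) :
    'rV[R]_(p + q) -> 'rV[R]_q' :=
  fun u => \sum_(a < q) nabla_dT (E a) (E a) u.

End LocalMaps.

Section FoliatedMaps.
Variables (R : realType) (p q p' q' : nat) (M M' : topologicalType).
Variables (F : foliatedRiemannian R p q M) (F' : foliatedRiemannian R p' q' M').
Variable phi : M -> M'.

Definition foliated_map : Prop :=
  continuous phi /\
  (forall c d, atlas F c -> atlas F' d ->
     foliated_on (rep_dom c d phi) (rep c d phi)).

Definition transversally_harmonic : Prop :=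
  foliated_map /\
  forall c d, atlas F c -> atlas F' d ->
  forall V, open V -> V `<=` rep_dom c d phi ->
  forall E, basic_frame (metric F c) V E ->
  forall u, V u -> tension (metric F c) (metric F' d) (rep c d phi) E u = 0.

Definition rankT_le (C : R) : Prop :=
  forall c d, atlas F c -> atlas F' d ->
  forall u, rep_dom c d phi u ->
    (rankT (metric F c) (rep c d phi) u)%:R <= C.

Definition dT_norm2_le (B : R) : Prop :=
  forall c d, atlas F c -> atlas F' d ->
  forall u, rep_dom c d phi u ->
  forall e, orthonormalQ (metric F c) u e ->
    dT_norm2 (metric F c) (metric F' d) (rep c d phi) u e <= B.

Definition transversally_constant : Prop :=
  forall c d, atlas F c -> atlas F' d ->
  forall u v, rep_dom c d phi u -> tangL ('d (rep c d phi) u v).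

Definition transversally_totally_geodesic : Prop :=
  forall c d, atlas F c -> atlas F' d ->
  forall V, open V -> V `<=` rep_dom c d phi ->
  forall s t, smooth_on V s -> smooth_on V t ->
  forall u, V u ->
    nabla_dT (metric F c) (metric F' d) (rep c d phi) s t u = 0.

End FoliatedMaps.

(* Main.v *)
(* Let e = |d_T phi|^2, a function constant along the leaves, and let L be the
   transverse Laplacian, the trace of the transverse Hessian over a basic
   frame. When tau_b(phi) = 0 the Bochner formula reads
     (1/2) L e = |nabla d_T phi|^2 + sum_a <d_T phi (Ric E_a), d_T phi E_a>
                 - sum_(a, b) <R'(phi_a, phi_b) phi_b, phi_a>,
   with phi_a = d_T phi E_a. The Gram matrix S of the phi_a has rank at most C,
   so tr(S^2) >= (tr S)^2 / C and the curvature terms are bounded below by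
   lambda e - mu (1 - 1/C) e^2. If e <= lambda C / (mu (C - 1)) this makes e
   L-subharmonic. Since e is basic, the leafwise coordinate Laplacian can be
   added to L in each chart, giving an elliptic operator; the strong maximum
   principle then makes e constant, whence nabla d_T phi = 0. No integration is
   involved, so the mean curvature of the leaves never enters. If
   e <= lambda / mu, the inequality at a maximum of e already forces e = 0. *)
Require Import Defs.
From mathcomp Require Import all_boot all_order all_algebra.
From mathcomp Require Import all_classical all_reals all_analysis.
From mathcomp Require Import ring lra.
Import Order.TTheory GRing.Theory Num.Theory.
Import numFieldNormedType.Exports.
Set Implicit Arguments.
Unset Strict Implicit.
Unset Printing Implicit Defensive.
Local Open Scope classical_set_scope.
Local Open Scope ring_scope.

(** * Smooth calculus for matrix-valued functions *)

(** In a foliated chart the transverse metric, its Christoffel matrices and the Jacobian of the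
    transverse part of [phi] all have zero derivative along the leaves. Hence [nablaQ], defined by
    brackets along L and by the ambient connection across it, acts as the Levi-Civita connection of
    a metric on R^q, and the Bochner formula becomes a matrix identity in the coordinate frame,
    contracted with the inverse metric. Orthonormal frames remain only because the tension and Ricci
    conditions are stated with them. Such frames must be basic, which is why the Cholesky factor is
    built so that its derivative vanishes wherever that of the metric does. No global Laplacian is
    constructed: the leafwise part added to the operator is the flat one of each chart and changes
    with the chart. This is harmless, because both maximum arguments are local and connectedness
    spreads the set of maximum points. Only the energy itself has to be shown independent of the
    charts. *)

Section DerivativeRules.
Variables (R : realType) (V : normedModType R).
Implicit Types (u v : V).

Lemma is_derive_add (W : normedModType R) (f g : V -> W) (df dg : W) u v :
  is_derive u v f df -> is_derive u v g dg ->
  is_derive u v (fun x => f x + g x) (df + dg).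
Proof. by move=> Df Dg; exact: (@is_deriveD _ _ _ f g). Qed.

Lemma is_derive_opp (W : normedModType R) (f : V -> W) (df : W) u v :
  is_derive u v f df -> is_derive u v (fun x => - f x) (- df).
Proof. by move=> Df; exact: (@is_deriveN _ _ _ f). Qed.

Lemma is_derive_sub (W : normedModType R) (f g : V -> W) (df dg : W) u v :
  is_derive u v f df -> is_derive u v g dg ->
  is_derive u v (fun x => f x - g x) (df - dg).
Proof. by move=> Df Dg; exact: (@is_deriveB _ _ _ f g). Qed.

Lemma is_derive_scal (W : normedModType R) (k : R) (f : V -> W) (df : W) u v :
  is_derive u v f df -> is_derive u v (fun x => k *: f x) (k *: df).
Proof. by move=> Df; exact: (@is_deriveZ _ _ _ f). Qed.

Lemma is_derive_const (W : normedModType R) (k : W) u v :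
  is_derive u v (fun=> k) 0.
Proof. exact: is_derive_cst. Qed.

Lemma is_derive_bigsum (W : normedModType R) n (f : 'I_n -> V -> W)
    (df : 'I_n -> W) u v :
  (forall i, is_derive u v (f i) (df i)) ->
  is_derive u v (fun x => \sum_i f i x) (\sum_i df i).
Proof.
move=> Df; rewrite (_ : (fun x => _) = \sum_i f i); first exact: is_derive_sum.
by apply/funext => x; rewrite fct_sumE.
Qed.

Lemma is_derive_prod (f g : V -> R) (df dg : R) u v :
  is_derive u v f df -> is_derive u v g dg ->
  is_derive u v (fun x => f x * g x) (df * g u + f u * dg).
Proof.
move=> Df Dg; apply: (@is_derive_eq _ _ _ (f * g)); rewrite addrC.
by congr (_ + _); rewrite /GRing.scale/= mulrC.
Qed.

Lemma is_derive_mx m n (f : V -> 'M[R]_(m, n)) (df : 'M[R]_(m, n)) u v :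
  (forall i j, is_derive u v (fun x => f x i j) (df i j)) -> is_derive u v f df.
Proof.
move=> Df; have df_f : derivable f u v.
  by apply/derivable_mxP => i j; have [] := Df i j.
apply: DeriveDef => //; rewrite derive_mx//; apply/matrixP => i j.
by rewrite mxE; have [_ ->] := Df i j.
Qed.

Lemma is_derive_entry m n (f : V -> 'M[R]_(m, n)) (df : 'M[R]_(m, n)) u v i j :
  is_derive u v f df -> is_derive u v (fun x => f x i j) (df i j).
Proof.
move=> [df_f <-]; apply: DeriveDef; first by move/derivable_mxP: df_f; exact.
by rewrite derive_mx// mxE.
Qed.

(** Each entry of [L M] is a fixed finite combination of the entries of [M], so entrywise
    differentiation suffices and no continuity of [L] is invoked. *)
Lemma is_derive_linear_mx m n k l (L : {linear 'M[R]_(m, n) -> 'M[R]_(k, l)})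
    (f : V -> 'M[R]_(m, n)) (df : 'M[R]_(m, n)) u v :
  is_derive u v f df -> is_derive u v (fun x => L (f x)) (L df).
Proof.
move=> Df; apply: is_derive_mx => a b.
have LE M : L M a b = \sum_i \sum_j L (delta_mx i j) a b * M i j.
  rewrite {1}[M]matrix_sum_delta linear_sum summxE; apply: eq_bigr => i _.
  rewrite linear_sum summxE; apply: eq_bigr => j _.
  by rewrite linearZ mxE mulrC.
rewrite (_ : (fun x => _) = fun x => \sum_i \sum_j L (delta_mx i j) a b * f x i j);
  last first.
  by apply/funext => x; rewrite LE.
rewrite LE; apply: is_derive_bigsum => i; apply: is_derive_bigsum => j.
exact: (is_derive_scal _ (is_derive_entry i j Df)).
Qed.

Lemma is_derive_mulmx m n k (f : V -> 'M[R]_(m, n)) (g : V -> 'M[R]_(n, k))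
    (df : 'M[R]_(m, n)) (dg : 'M[R]_(n, k)) u v :
  is_derive u v f df -> is_derive u v g dg ->
  is_derive u v (fun x => f x *m g x) (df *m g u + f u *m dg).
Proof.
move=> Df Dg; apply: is_derive_mx => i j.
rewrite (_ : (fun x => _) = fun x => \sum_l f x i l * g x l j); last first.
  by apply/funext => x; rewrite mxE.
rewrite !mxE -big_split/=; apply: is_derive_bigsum => l.
by apply: is_derive_prod; exact: is_derive_entry.
Qed.

Lemma is_derive_scalemx m n (c : V -> R) (f : V -> 'M[R]_(m, n)) (dc : R)
    (df : 'M[R]_(m, n)) u v :
  is_derive u v c dc -> is_derive u v f df ->
  is_derive u v (fun x => c x *: f x) (dc *: f u + c u *: df).
Proof.
move=> Dc Df; apply: is_derive_mx => i j; rewrite !mxE.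
rewrite (_ : (fun x => _) = fun x => c x * f x i j); last first.
  by apply/funext => x; rewrite mxE.
by apply: is_derive_prod => //; exact: is_derive_entry.
Qed.

Lemma is_derive_trace n (f : V -> 'M[R]_n) (df : 'M[R]_n) u v :
  is_derive u v f df -> is_derive u v (fun x => \tr (f x)) (\tr df).
Proof. by move=> Df; apply: is_derive_bigsum => i; exact: is_derive_entry. Qed.

Lemma is_derive_diff (W : normedModType R) (f : V -> W) u v :
  differentiable f u -> is_derive u v f ('D_v f u).
Proof. by move=> df; apply: DeriveDef => //; exact: diff_derivable. Qed.

Lemma derive_comp (W X : normedModType R) (f : V -> W) (g : W -> X) u v :
  differentiable f u -> differentiable g (f u) ->
  is_derive u v (fun x => g (f x)) ('D_('d f u v) g (f u)).
Proof.
move=> df dg; apply: DeriveDef; first exact/diff_derivable/differentiable_comp.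
rewrite (deriveE _ (differentiable_comp df dg)) diff_comp//=.
by rewrite -deriveE.
Qed.

Lemma deriveD_dir (W : normedModType R) (f : V -> W) u v w :
  differentiable f u -> 'D_(v + w) f u = 'D_v f u + 'D_w f u.
Proof. by move=> df; rewrite !deriveE// linearD. Qed.

Lemma deriveZ_dir (W : normedModType R) (f : V -> W) u (k : R) v :
  differentiable f u -> 'D_(k *: v) f u = k *: 'D_v f u.
Proof. by move=> df; rewrite !deriveE// linearZ. Qed.

Lemma deriveB_dir (W : normedModType R) (f : V -> W) u v w :
  differentiable f u -> 'D_(v - w) f u = 'D_v f u - 'D_w f u.
Proof. by move=> df; rewrite !deriveE// linearB. Qed.

Lemma derive_sum_dir (W : normedModType R) (f : V -> W) u n (k : 'I_n -> R)
    (v : 'I_n -> V) :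
  differentiable f u -> 'D_(\sum_i k i *: v i) f u = \sum_i k i *: 'D_(v i) f u.
Proof.
move=> df; rewrite deriveE// linear_sum; apply: eq_bigr => i _.
by rewrite linearZ -deriveE.
Qed.

Lemma derive_near (W : normedModType R) (U : set V) (f g : V -> W) u v :
  open U -> U u -> (forall x, U x -> f x = g x) -> 'D_v f u = 'D_v g u.
Proof.
move=> oU Uu fg; apply: near_eq_derive.
by apply: filterS (open_nbhs_nbhs (conj oU Uu)) => x /fg.
Qed.

(** Differentiability depends only on the germ. This is what allows closed formulas valid only on a
    chart domain to be differentiated as if they were global. *)
Lemma near_eq_differentiable (W : normedModType R) (U : set V) (f g : V -> W) u :
  open U -> U u -> (forall x, U x -> f x = g x) ->
  differentiable g u -> differentiable f u.
Proof.
move=> oU Uu fg /diff_locallyP[cg dg].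
(* The expansion of [g] at [u] is also one of [f], with linear part ['d g u]; [diff_unique] then
   identifies the two differentials. *)
have df : f \o shift u = cst (f u) + 'd g u +o_ (0 : V) id.
  apply/eqaddoP => e e0; move/eqaddoP : dg => /(_ _ e0).
  have : \forall x \near (0 : V), f (x + u) = g (x + u).
    have := open_nbhs_nbhs (conj oU Uu).
    move=> /(filterS fg); rewrite [X in X -> _](near_shift 0 u) subr0.
    by apply: filterS => x.
  apply: filterS2 => x fgx.
  by rewrite -[(f \o shift u)]/(fun x => f (x + u)) /= !fctE /= fgx fg.
by apply/diff_locallyP; rewrite (diff_unique cg df).
Qed.

End DerivativeRules.

(** * Closure properties of C^k maps *)

Section SmoothMaps.
Variables (R : realType) (V : normedModType R).
Implicit Types (U : set V) (u v : V).

Lemma continuous_mx m n (f : V -> 'M[R]_(m, n)) u :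
  (forall i j, {for u, continuous (fun x => f x i j)}) -> {for u, continuous f}.
Proof.
move=> cf; apply/cvgrPdist_le => /= e e0; near=> x.
rewrite /Num.Def.normr/= mx_normrE (bigmax_le _ (ltW e0))//= => i _.
rewrite !mxE; move: i; near: x; apply: filter_forall => /= i.
exact: (cvgrPdist_le _ _).1 (cf i.1 i.2) _ e0.
Unshelve. all: by end_near. Qed.

Lemma differentiable_bigsum (W : normedModType R) n (f : 'I_n -> V -> W) u :
  (forall i, differentiable (f i) u) -> differentiable (fun x => \sum_i f i x) u.
Proof.
move=> df; rewrite (_ : (fun x => _) = \sum_i f i); first exact: differentiable_sum.
by apply/funext => x; rewrite fct_sumE.
Qed.

Lemma differentiable_mx m n (f : V -> 'M[R]_(m, n)) u :
  (forall i j, differentiable (fun x => f x i j) u) -> differentiable f u.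
Proof.
move=> df; rewrite (_ : f = fun x => \sum_i \sum_j f x i j *: delta_mx i j).
  apply: differentiable_bigsum => i; apply: differentiable_bigsum => j.
  exact: differentiableZl.
by apply/funext => x; rewrite -matrix_sum_delta.
Qed.

Lemma differentiable_entry m n (f : V -> 'M[R]_(m, n)) i j u :
  differentiable f u -> differentiable (fun x => f x i j) u.
Proof.
move=> df; apply: (@differentiable_comp _ _ _ _ f (fun N : 'M[R]_(m, n) => N i j)) => //.
exact: differentiable_coord.
Qed.

Lemma Ck_on_eq (W : normedModType R) k U (f g : V -> W) :
  open U -> (forall u, U u -> f u = g u) -> Ck_on k U g -> Ck_on k U f.
Proof.
move=> oU; elim: k f g => [|k IHk] f g fg /=.
  move=> cg u Uu; rewrite /prop_for /continuous_at (fg _ Uu).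
  apply: cvg_trans (cg u Uu); apply: near_eq_cvg.
  by apply: filterS (open_nbhs_nbhs (conj oU Uu)) => x /fg.
move=> [dg Dg]; split=> [u Uu|v].
  exact: near_eq_differentiable fg (dg u Uu).
by apply: IHk (Dg v) => u Uu; exact: derive_near fg.
Qed.

Lemma Ck_on_sub (W : normedModType R) k U U' (f : V -> W) :
  U' `<=` U -> Ck_on k U f -> Ck_on k U' f.
Proof.
move=> sU; elim: k f => [|k IHk] f /=; first by move=> cf u /sU/cf.
by move=> [df Df]; split=> [u /sU/df//|v]; exact: IHk.
Qed.

Lemma Ck_on_continuous (W : normedModType R) k U (f : V -> W) :
  Ck_on k U f -> forall u, U u -> {for u, continuous f}.
Proof.
by case: k => [//|k] /= [df _] u Uu; exact/differentiable_continuous/df.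
Qed.

Lemma Ck_onW (W : normedModType R) k U (f : V -> W) : Ck_on k.+1 U f -> Ck_on k U f.
Proof.
elim: k f => [|k IHk] f; first by move=> cf; exact: Ck_on_continuous cf.
by move=> [df Df]; split=> // v; exact/IHk/Df.
Qed.

Lemma Ck_on_cst (W : normedModType R) k U (w : W) : Ck_on k U (fun _ : V => w).
Proof.
elim: k w => [|k IHk] w /=; first by move=> u _; exact: cst_continuous.
split=> [u _|v]; first exact: differentiable_cst.
have -> : (fun u : V => 'D_v (fun=> w) u) = fun=> 0; last exact: IHk.
by apply/funext => u; rewrite derive_cst.
Qed.

Lemma Ck_onD (W : normedModType R) k U (f g : V -> W) : open U ->
  Ck_on k U f -> Ck_on k U g -> Ck_on k U (fun u => f u + g u).
Proof.
move=> oU; elim: k f g => [|k IHk] f g /=.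
  by move=> cf cg u Uu; apply: continuousD; [exact: cf|exact: cg].
move=> [df Df] [dg Dg]; split=> [u Uu|v].
  by apply: differentiableD; [exact: df|exact: dg].
apply: Ck_on_eq (IHk _ _ (Df v) (Dg v)) => // u Uu.
by have [] := is_derive_add (is_derive_diff v (df u Uu)) (is_derive_diff v (dg u Uu)).
Qed.

Lemma Ck_on_bigsum (W : normedModType R) k U (I : Type) (r : seq I) (f : I -> V -> W) :
  open U -> (forall i, Ck_on k U (f i)) -> Ck_on k U (fun u => \sum_(i <- r) f i u).
Proof.
move=> oU Cf; elim: r => [|i r IHr].
  by under eq_fun do rewrite big_nil; exact: Ck_on_cst.
by under eq_fun do rewrite big_cons; exact: Ck_onD.
Qed.

Lemma Ck_onM k U (f g : V -> R) : open U ->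
  Ck_on k U f -> Ck_on k U g -> Ck_on k U (fun u => f u * g u).
Proof.
move=> oU; elim: k f g => [|k IHk] f g.
  by move=> cf cg u Uu; apply: continuousM; [exact: cf|exact: cg].
move=> Cf Cg; have [[df Df] [dg Dg]] := (Cf, Cg); split=> [u Uu|v].
  by apply: differentiableM; [exact: df|exact: dg].
apply: Ck_on_eq (Ck_onD oU (IHk _ _ (Df v) (Ck_onW Cg)) (IHk _ _ (Ck_onW Cf) (Dg v))) => //.
move=> u Uu.
by have [] := is_derive_prod (is_derive_diff v (df u Uu)) (is_derive_diff v (dg u Uu)).
Qed.

Lemma Ck_on_mxP m n k U (f : V -> 'M[R]_(m, n)) : open U ->
  Ck_on k U f <-> forall i j, Ck_on k U (fun u => f u i j).
Proof.
move=> oU; elim: k f => [|k IHk] f.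
  split=> [cf i j u Uu|cf u Uu]; last by apply: continuous_mx => i j; exact: cf.
  apply: (@continuous_comp _ _ _ f (fun N : 'M[R]_(m, n) => N i j)); first exact: cf.
  exact: coord_continuous.
split=> [[df Df] i j|Cf].
  split=> [u Uu|v]; first exact/differentiable_entry/df.
  apply: Ck_on_eq ((IHk _).1 (Df v) i j) => // u Uu.
  by have [] := is_derive_entry i j (is_derive_diff v (df u Uu)).
have df u : U u -> differentiable f u.
  by move=> Uu; apply: differentiable_mx => i j; have [] := Cf i j; move=> + _; apply.
split=> // v; apply/IHk => i j; have [_ /(_ v) Dfij] := Cf i j.
apply: Ck_on_eq Dfij => // u Uu.
by have [_ ->] := is_derive_entry i j (is_derive_diff v (df u Uu)).
Qed.

Lemma Ck_on_mulmx m n l k U (f : V -> 'M[R]_(m, n)) (g : V -> 'M[R]_(n, l)) :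
  open U -> Ck_on k U f -> Ck_on k U g -> Ck_on k U (fun u => f u *m g u).
Proof.
move=> oU /Ck_on_mxP Cf /Ck_on_mxP Cg; apply/Ck_on_mxP => // i j.
apply: (@Ck_on_eq _ _ _ _ (fun u => \sum_l f u i l * g u l j)) => //.
  by move=> u _; rewrite mxE.
by apply: Ck_on_bigsum => // a; apply: Ck_onM => //; [exact: Cf|exact: Cg].
Qed.

Lemma Ck_onZ k U (W : normedModType R) (c : R) (f : V -> W) : open U ->
  Ck_on k U f -> Ck_on k U (fun u => c *: f u).
Proof.
move=> oU; elim: k f => [|k IHk] f.
  move=> cf u Uu; rewrite /prop_for /continuous_at; apply: cvgZ;
    [exact: cvg_cst|exact: (cf u Uu)].
move=> [df Df]; split=> [u Uu|v]; first exact/differentiableZ/df.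
apply: Ck_on_eq (IHk _ (Df v)) => // u Uu.
by have [] := is_derive_scal c (is_derive_diff v (df u Uu)).
Qed.

Lemma differentiable_sqrt_comp (f : V -> R) u : 0 < f u -> differentiable f u ->
  differentiable (fun x => Num.sqrt (f x)) u.
Proof.
move=> f0 df; apply: (@differentiable_comp _ _ _ _ f Num.sqrt) => //.
by apply/derivable1_diffP; have [] := is_derive1_sqrt f0.
Qed.

Lemma is_derive_invsqrt (f : V -> R) u v : 0 < f u -> differentiable f u ->
  is_derive u v (fun x => (Num.sqrt (f x))^-1)
    (- 2^-1 * ((Num.sqrt (f u))^-1 ^+ 3 * 'D_v f u)).
Proof.
move=> f0 df; have s0 : Num.sqrt (f u) != 0 by rewrite gt_eqF// sqrtr_gt0.
have ds : is_derive u v (fun x => Num.sqrt (f x)) ((2 * Num.sqrt (f u))^-1 * 'D_v f u).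
  have dsq : differentiable (Num.sqrt : R -> R) (f u).
    by apply/derivable1_diffP; have [] := is_derive1_sqrt f0.
  have := derive_comp v df dsq; congr is_derive.
  rewrite -[X in 'D_X _ _]mulr1 -[_ * 1]/(_ *: _) deriveZ_dir//.
  have [_ ->] := is_derive1_sqrt f0; rewrite (deriveE _ df).
  exact: mulrC.
apply: DeriveDef; first by apply: derivableV => //; have [] := ds.
rewrite (@deriveV _ _ (fun x => Num.sqrt (f x)) u v s0); last by have [] := ds.
have [_ ->] := ds; rewrite /GRing.scale/= !exprS expr0 mulr1 !invfM.
by rewrite mulNr mulNr; congr (- _); ring.
Qed.

Lemma differentiable_invsqrt (f : V -> R) u : 0 < f u -> differentiable f u ->
  differentiable (fun x => (Num.sqrt (f x))^-1) u.
Proof.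
move=> f0 df; apply: differentiableV; first exact: differentiable_sqrt_comp.
by rewrite gt_eqF// sqrtr_gt0.
Qed.

(** The derivative of f^(-1/2) is -1/2 (f^(-1/2))^3 Df, a polynomial in the function itself and Df,
    so the induction on [k] closes. *)
Lemma Ck_on_invsqrt k U (f : V -> R) : open U -> (forall u, U u -> 0 < f u) ->
  Ck_on k U f -> Ck_on k U (fun u => (Num.sqrt (f u))^-1).
Proof.
move=> oU f0; elim: k f f0 => [|k IHk] f f0.
  move=> cf u Uu; apply: continuousV; first by rewrite gt_eqF// sqrtr_gt0 f0.
  by apply: continuous_comp; [exact: cf|exact: sqrt_continuous].
move=> Cf; have [df Df] := Cf; split=> [u Uu|v].
  by apply: differentiable_invsqrt; [exact: f0|exact: df].
have Cr := IHk _ f0 (Ck_onW Cf).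
apply: (@Ck_on_eq _ _ _ _ (fun u => - 2^-1 *: ((Num.sqrt (f u))^-1 *
  ((Num.sqrt (f u))^-1 * (Num.sqrt (f u))^-1) * 'D_v f u))) => //.
  move=> u Uu; have [_ ->] := is_derive_invsqrt v (f0 u Uu) (df u Uu).
  by rewrite !exprS expr0 mulr1.
apply: Ck_onZ => //; apply: Ck_onM (Df v) => //.
by apply: Ck_onM => //; exact: Ck_onM.
Qed.

End SmoothMaps.

(** * Symmetry of second derivatives *)

Section Schwarz.
Variables (R : realType) (V : normedModType R).
Implicit Types (U : set V) (u v w : V).

Lemma is_derive_line (W : normedModType R) (f : V -> W) u v (s : R) :
  differentiable f (u + s *: v) ->
  is_derive s 1 (fun t => f (u + t *: v)) ('D_v f (u + s *: v)).
Proof.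
move=> df; have dv : is_diff s (fun t : R => t *: v) (fun t : R => t *: v) by exact:
  is_diff_scalel.
have dl : differentiable (fun t : R => u + t *: v) s.
  by apply: differentiableD; [exact: differentiable_cst|exact: ex_diff].
have := derive_comp (1 : R) dl df; congr is_derive; congr ('D__ _ _).
rewrite -deriveE//; have Dv : is_derive s 1 (fun t : R => t *: v) v.
  apply: DeriveDef; first exact: diff_derivable.
  by rewrite deriveE// (@diff_val _ _ _ _ _ _ _ dv) scale1r.
by have [_ ->] := is_derive_add (is_derive_const u s 1) Dv; rewrite add0r.
Qed.

Lemma MVT_line (f : V -> R) u v (t : R) : 0 < t ->
  (forall s, 0 <= s <= t -> differentiable f (u + s *: v)) ->
  exists2 s, 0 < s < t & f (u + t *: v) - f u = t * 'D_v f (u + s *: v).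
Proof.
move=> t0 df.
have [||s] := @MVT R (fun s => f (u + s *: v)) (fun s => 'D_v f (u + s *: v)) 0 t t0.
- move=> s; rewrite in_itv/= => /andP[s0 st].
  by apply: is_derive_line; apply: df; rewrite !ltW.
- apply: derivable_within_continuous => s; rewrite in_itv/= => s0t.
  by have [] := is_derive_line (df s s0t).
- rewrite in_itv/= => s01; rewrite scale0r addr0 subr0 mulrC => fE.
  by exists s.
Qed.

(** The mean value theorem is applied along [v] to the increment x |-> f (x + t w) - f x, then along
    [w] to D_v f. The left-hand side is symmetric in [v] and [w], which is what yields Schwarz's
    theorem. *)
Lemma second_difference (f : V -> R) u v w (t : R) : 0 < t ->
  (forall a b, 0 <= a <= t -> 0 <= b <= t ->
    differentiable f (u + a *: v + b *: w) /\
    differentiable (fun x => 'D_v f x) (u + a *: v + b *: w)) ->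
  exists a b, [/\ 0 < a < t, 0 < b < t &
    f (u + t *: v + t *: w) - f (u + t *: v) - f (u + t *: w) + f u =
    t * (t * 'D_w (fun x => 'D_v f x) (u + a *: v + b *: w))].
Proof.
move=> t0 df; pose g x := f (x + t *: w) - f x.
have tt : 0 <= t <= t by rewrite lexx ltW.
have z0 : (0 : R) <= 0 <= t by rewrite lexx ltW.
have dg a : 0 <= a <= t -> differentiable (fun x => f (x + t *: w)) (u + a *: v) /\
    'D_v (fun x => f (x + t *: w)) (u + a *: v) = 'D_v f (u + a *: v + t *: w).
  move=> at'; have [dfa _] := df _ _ at' tt.
  have ds : differentiable (fun x => x + t *: w) (u + a *: v).
    by apply: differentiableD; [|exact: differentiable_cst].
  split; first by apply: (@differentiable_comp _ _ _ _ (fun x => x + t *: w) f).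
  have [_ ->] := derive_comp v ds dfa; rewrite -deriveE//.
  have [_ ->] := is_derive_add (is_derive_id (u + a *: v) v) (is_derive_const (t *: w) (u
    + a *: v) v).
  by rewrite addr0.
have dfa a : 0 <= a <= t -> differentiable f (u + a *: v).
  by move=> at'; have [+ _] := df _ _ at' z0; rewrite scale0r addr0.
have [a|a a0t gE] := @MVT_line g u v t t0.
  by move=> at'; apply: differentiableB; [exact: (dg _ at').1|exact: dfa].
have at' : 0 <= a <= t by case/andP: a0t => /ltW-> /ltW->.
have [b bt|b b0t hE] := @MVT_line (fun x => 'D_v f x) (u + a *: v) w t t0.
  by have [] := df _ _ at' bt.
exists a, b; split => //; rewrite -hE.
have gd : 'D_v g (u + a *: v) = 'D_v f (u + a *: v + t *: w) - 'D_v f (u + a *: v).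
  have [dg1 dg2] := dg _ at'.
  by have [_ ->] := is_derive_sub (is_derive_diff v dg1) (is_derive_diff v (dfa _ at'));
    rewrite dg2.
by rewrite -gd -gE /g addrAC opprD opprK addrA addrAC.
Qed.

Lemma derive_comm_real (f : V -> R) U u v w : open U -> U u -> Ck_on 2 U f ->
  'D_w (fun x => 'D_v f x) u = 'D_v (fun x => 'D_w f x) u.
Proof.
move=> oU Uu [df Df].
have cvw x y : {for u, continuous (fun z => 'D_x (fun z' => 'D_y f z') z)}.
  by have [_ /(_ x) cxy] := Df y; exact: cxy.
apply/eqP; rewrite eq_sym -subr_eq0 -normr_le0; apply/ler_addgt0Pl => e e0; rewrite addr0.
have e20 : 0 < e / 2 by rewrite divr_gt0.
have /cvgrPdist_le/(_ _ e20) n1 := cvw v w.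
have /cvgrPdist_le/(_ _ e20) n2 := cvw w v.
have n3 : \forall x \near u, U x by exact: open_nbhs_nbhs.
have [r /= r0 rU] : nbhs_ball u [set x | U x /\
    `|'D_v (fun z => 'D_w f z) u - 'D_v (fun z => 'D_w f z) x| <= e / 2 /\
    `|'D_w (fun z => 'D_v f z) u - 'D_w (fun z => 'D_v f z) x| <= e / 2].
  by apply/nbhs_ballP; exact: filterI n3 (filterI n1 n2).
(* With sides at most [t] the parallelogram based at [u] stays in the ball of radius [r]; the
   summand 1 keeps the denominator positive when v = w = 0. *)
pose t := r / (2 * (`|v| + `|w| + 1)).
have k0 : 0 < 2 * (`|v| + `|w| + 1) by rewrite mulr_gt0// ltr_wpDl// addr_ge0.
have t0 : 0 < t by rewrite divr_gt0.
have inb a b : 0 <= a <= t -> 0 <= b <= t -> ball u r (u + a *: v + b *: w).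
  move=> /andP[a0 at'] /andP[b0 bt]; rewrite -ball_normE /ball_/= -addrA opprD addNKr
    normrN.
  rewrite (le_lt_trans (ler_normD _ _))// !normrZ !ger0_norm//.
  have : a * `|v| + b * `|w| <= t * (`|v| + `|w| + 1).
    by rewrite !mulrDr mulr1 -addrA lerD ?ler_wpM2r// -[leLHS]addr0 lerD ?ler_wpM2r// ltW.
  move/le_lt_trans; apply; rewrite /t invfM mulrA mulfVK;
    last by rewrite gt_eqF// ltr_wpDl// addr_ge0.
  by rewrite ltr_pdivrMr// ltr_pMr// ltr1n.
have [a b at' bt|a [b [a0 b0 E1]]] := @second_difference f u v w t t0.
  have [Ux _] := rU _ (inb _ _ at' bt); split; first exact: df.
  by have [+ _] := Df v; apply.
have [a' b' at' bt|a' [b' [a'0 b'0 E2]]] := @second_difference f u w v t t0.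
  have [Ux _] := rU _ (inb _ _ bt at'); rewrite addrAC; split; first exact: df.
  by have [+ _] := Df w; apply.
have W x : 0 < x < t -> 0 <= x <= t by case/andP => /ltW-> /ltW->.
(* Both mixed derivatives, taken at two different points of the ball, equal the same second
   difference divided by t^2. *)
have E : 'D_w (fun x => 'D_v f x) (u + a *: v + b *: w) = 'D_v (fun x => 'D_w f x) (u +
  b' *: v + a' *: w).
  apply: (mulfI (lt0r_neq0 t0)); apply: (mulfI (lt0r_neq0 t0)).
  have p1 : u + b' *: v + a' *: w = u + a' *: w + b' *: v := addrAC _ _ _.
  have p2 : u + t *: w + t *: v = u + t *: v + t *: w := addrAC _ _ _.
  apply: etrans (esym E1) _; rewrite p1; apply: etrans _ E2; rewrite p2.
  by congr (_ + _); exact: addrAC.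
have [_ [_ n2']] := rU _ (inb _ _ (W _ a0) (W _ b0)).
have [_ [n1' _]] := rU _ (inb _ _ (W _ b'0) (W _ a'0)).
move: n2'; rewrite /= E => n2'.
rewrite -(subrKA ('D_v (fun x => 'D_w f x) (u + b' *: v + a' *: w))) [leRHS]splitr.
apply: le_trans (ler_normD _ _) _; apply: lerD; [exact: n1'|by rewrite distrC; exact: n2'].
Qed.

Lemma derive_comm m n (f : V -> 'M[R]_(m, n)) U u v w : open U -> U u -> Ck_on 2 U f ->
  'D_w (fun x => 'D_v f x) u = 'D_v (fun x => 'D_w f x) u.
Proof.
move=> oU Uu Cf; have [df Df] := Cf; apply/matrixP => i j.
have E a b : 'D_a (fun x => 'D_b f x) u i j = 'D_a (fun x => 'D_b (fun y => f y i j) x) u.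
  have [dDf _] := Df b.
  have [_ <-] := is_derive_entry i j (is_derive_diff a (dDf u Uu)).
  apply: (derive_near _ oU Uu) => x Ux.
  by have [_ ->] := is_derive_entry i j (is_derive_diff b (df x Ux)).
have Cij : Ck_on 2 U (fun y => f y i j) by exact: ((Ck_on_mxP 2 f oU).1 Cf i j).
apply: etrans (E w v) _; apply: etrans _ (esym (E v w)).
exact: (@derive_comm_real (fun y => f y i j) U u v w oU Uu Cij).
Qed.

End Schwarz.

(** * Positive definite matrices and trace inequalities *)

Section PosDef.
Variable R : realType.

Definition posdef n (A : 'M[R]_n) : Prop :=
  A^T = A /\ forall x : 'rV[R]_n, x != 0 -> 0 < (x *m A *m x^T) 0 0.

Lemma trmx11 (A : 'M[R]_1) : A^T = A.
Proof. by apply/matrixP => i j; rewrite mxE !ord1. Qed.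

Lemma sym_form n (A : 'M[R]_n) (x y : 'rV[R]_n) : A^T = A ->
  (x *m A *m y^T) 0 0 = (y *m A *m x^T) 0 0.
Proof.
by move=> sA; rewrite -[x *m A *m y^T]trmx11 !trmx_mul trmxK sA mulmxA.
Qed.

Lemma sqnormE n (x : 'rV[R]_n) : (x *m x^T) 0 0 = \sum_i x 0 i ^+ 2.
Proof. by rewrite mxE; apply: eq_bigr => i _; rewrite mxE expr2. Qed.

Lemma sqnorm_ge0 n (x : 'rV[R]_n) : 0 <= (x *m x^T) 0 0.
Proof. by rewrite sqnormE sumr_ge0// => i _; rewrite sqr_ge0. Qed.

Lemma sqnorm_eq0 n (x : 'rV[R]_n) : (x *m x^T) 0 0 = 0 -> x = 0.
Proof.
rewrite sqnormE => /eqP; rewrite psumr_eq0; last by move=> i _; exact: sqr_ge0.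
move=> /allP x0; apply/rowP => i; have /= := x0 i (mem_index_enum _).
by rewrite sqrf_eq0 => /eqP->; rewrite mxE.
Qed.

Lemma posdef_ge0 n (A : 'M[R]_n) (x : 'rV[R]_n) : posdef A -> 0 <= (x *m A *m x^T) 0 0.
Proof.
by move=> [_ pA]; have [->|/pA/ltW//] := eqVneq x 0; rewrite mul0mx mul0mx mxE.
Qed.

Lemma posdef_eq0 n (A : 'M[R]_n) (x : 'rV[R]_n) : posdef A ->
  (x *m A *m x^T) 0 0 = 0 -> x = 0.
Proof. by move=> [_ pA] xAx; apply: contra_eq xAx => /pA/lt0r_neq0. Qed.

Lemma posdef_cauchy_schwarz n (A : 'M[R]_n) (x y : 'rV[R]_n) : posdef A ->
  row_free (col_mx x y) ->
  0 < (x *m A *m x^T) 0 0 * (y *m A *m y^T) 0 0 - (x *m A *m y^T) 0 0 ^+ 2.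
Proof.
move=> [sA pA] fxy; set a := (x *m A *m x^T) 0 0; set b := (y *m A *m y^T) 0 0.
set c := (x *m A *m y^T) 0 0.
have lin (s t : R) : s *: x + t *: y = 0 -> s = 0 /\ t = 0.
  move=> st0; have : row_mx s%:M t%:M *m col_mx x y = 0 :> 'rV_n.
    by rewrite mul_row_col !mul_scalar_mx.
  rewrite -[RHS](mul0mx _ (col_mx x y)) => /(row_free_inj fxy)/eqP.
  rewrite -row_mx0 => /eqP/eq_row_mx[/matrixP/(_ 0 0) + /matrixP/(_ 0 0)].
  by rewrite !mxE !mulr1n.
have y0 : y != 0.
  apply/eqP => y0; have [|_ /eqP] := lin 0 1; last by rewrite oner_eq0.
  by rewrite scale0r y0 scaler0 addr0.
have b0 : 0 < b by exact: pA.
(* The test vector of Cauchy-Schwarz: its value under the form is b (a b - c^2), and independence of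
   [x] and [y] makes it nonzero, hence the strict inequality. *)
have z0 : b *: x - c *: y != 0.
  apply/eqP => z0; have [|b00 _] := lin b (- c); first by rewrite scaleNr.
  by rewrite b00 ltxx in b0.
have := pA _ z0; rewrite (_ : (b *: x - c *: y)^T = b *: x^T - c *: y^T); last first.
  by apply/matrixP => i j; rewrite !mxE.
rewrite !mulmxBl !mulmxBr -!scalemxAl -!scalemxAr.
have E2 (M N : 'M[R]_1) : (M - N) 0 0 = M 0 0 - N 0 0 by rewrite !mxE.
have E3 (e : R) (M : 'M[R]_1) : (e *: M) 0 0 = e * M 0 0 by rewrite mxE.
rewrite !(E2, E3).
rewrite (sym_form y x sA) -/c -/b -/a => h.
have : 0 < b * (a * b - c ^+ 2) by apply: lt_le_trans h _; lra.
by rewrite pmulr_rgt0.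
Qed.

Lemma frobenius_ge0 m n (A : 'M[R]_(m, n)) : 0 <= \tr (A *m A^T).
Proof.
by apply: sumr_ge0 => i _; rewrite mxE sumr_ge0// => j _; rewrite mxE -expr2 sqr_ge0.
Qed.

Lemma frobenius_eq0 m n (A : 'M[R]_(m, n)) : \tr (A *m A^T) = 0 -> A = 0.
Proof.
rewrite /mxtrace => /eqP; rewrite psumr_eq0; last first.
  by move=> i _; rewrite mxE sumr_ge0// => j _; rewrite mxE -expr2 sqr_ge0.
move=> /allP A0; apply/matrixP => i j; have := A0 i (mem_index_enum _).
rewrite mxE psumr_eq0; last by move=> l _; rewrite mxE -expr2 sqr_ge0.
by move=> /allP/(_ j (mem_index_enum _)); rewrite !mxE -expr2 sqrf_eq0 => /eqP.
Qed.

Lemma frobenius_cauchy_schwarz m n (A B : 'M[R]_(m, n)) :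
  \tr (A *m B^T) ^+ 2 <= \tr (A *m A^T) * \tr (B *m B^T).
Proof.
set a := \tr (A *m A^T); set b := \tr (B *m B^T); set c := \tr (A *m B^T).
have cE : \tr (B *m A^T) = c by rewrite -mxtrace_tr trmx_mul trmxK.
have [b0|b0] := eqVneq b 0.
  by rewrite /c (frobenius_eq0 b0) trmx0 mulmx0 mxtrace0 expr0n/= b0 mulr0.
have b_gt0 : 0 < b by rewrite lt_neqAle eq_sym b0 frobenius_ge0.
have := frobenius_ge0 (b *: A - c *: B).
rewrite (_ : (b *: A - c *: B)^T = b *: A^T - c *: B^T); last first.
  by apply/matrixP => i j; rewrite !mxE.
rewrite !mulmxBl !mulmxBr -!scalemxAl -!scalemxAr !raddfB/= !mxtraceZ -/a -/b -/c cE => h.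
have : 0 <= b * (a * b - c ^+ 2) by apply: le_trans h _; lra.
by rewrite pmulr_rge0// subr_ge0.
Qed.

(** * Smooth Cholesky factors *)

Section Cholesky.
Variables (V : normedModType R) (U : set V).
Hypothesis oU : open U.

Lemma is_derive_block m1 m2 n1 n2 (a : V -> 'M[R]_(m1, n1)) (b : V -> 'M[R]_(m1, n2))
    (c : V -> 'M[R]_(m2, n1)) (d : V -> 'M[R]_(m2, n2)) da db dc dd u v :
  is_derive u v a da -> is_derive u v b db -> is_derive u v c dc ->
  is_derive u v d dd ->
  is_derive u v (fun x => block_mx (a x) (b x) (c x) (d x)) (block_mx da db dc dd).
Proof.
move=> Da Db Dc Dd; apply: is_derive_mx => i j.
case: (split_ordP i) => i' ->; case: (split_ordP j) => j' ->.
- rewrite block_mxEul; under eq_fun do rewrite block_mxEul; exact: is_derive_entry.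
- rewrite block_mxEur; under eq_fun do rewrite block_mxEur; exact: is_derive_entry.
- rewrite block_mxEdl; under eq_fun do rewrite block_mxEdl; exact: is_derive_entry.
- rewrite block_mxEdr; under eq_fun do rewrite block_mxEdr; exact: is_derive_entry.
Qed.

Lemma Ck_on_block k m1 m2 n1 n2 (a : V -> 'M[R]_(m1, n1)) (b : V -> 'M[R]_(m1, n2))
    (c : V -> 'M[R]_(m2, n1)) (d : V -> 'M[R]_(m2, n2)) :
  Ck_on k U a -> Ck_on k U b -> Ck_on k U c -> Ck_on k U d ->
  Ck_on k U (fun x => block_mx (a x) (b x) (c x) (d x)).
Proof.
move=> Ca Cb Cc Cd; apply/Ck_on_mxP => // i j.
case: (split_ordP i) => i' ->; case: (split_ordP j) => j' ->.
- by under eq_fun do rewrite block_mxEul; exact: (Ck_on_mxP _ _ oU).1.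
- by under eq_fun do rewrite block_mxEur; exact: (Ck_on_mxP _ _ oU).1.
- by under eq_fun do rewrite block_mxEdl; exact: (Ck_on_mxP _ _ oU).1.
- by under eq_fun do rewrite block_mxEdr; exact: (Ck_on_mxP _ _ oU).1.
Qed.

(** Symmetric elimination by induction on [n]: the pivots are positive, so [E] is obtained from the
    entries of [A] by ring operations and inverse square roots only. This gives smoothness, and also
    the last clause, through which the rows of [E] form a basic frame when [A] is a basic metric. *)
Lemma cholesky n (A : V -> 'M[R]_n) :
  smooth_on U A -> (forall u, U u -> posdef (A u)) ->
  exists E : V -> 'M[R]_n, [/\ smooth_on U E,
    forall u, U u -> E u *m A u *m (E u)^T = 1%:M &
    forall u v, U u -> 'D_v A u = 0 -> 'D_v E u = 0].
Proof.
elim: n A => [|n IHn] A sA pA.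
  exists (fun=> 0); split=> [k|u _|u v _ _]; first exact: Ck_on_cst.
    by apply/matrixP; case.
  exact: derive_cst.
pose B : V -> 'M[R]_(1 + n) := A.
pose a u := B u 0 0; pose b u : 'rV[R]_n := ursubmx (B u).
pose d u : 'M[R]_n := drsubmx (B u).
have sB u : U u -> (B u)^T = B u by case/pA.
have BE u : U u -> B u = block_mx (a u)%:M (b u) (b u)^T (d u).
  move=> Uu; rewrite -[LHS]submxK; congr block_mx.
    by rewrite [LHS]mx11_scalar !mxE; congr (B u _ _)%:M; apply/val_inj.
  by rewrite /b trmx_ursub sB.
have a0 u : U u -> 0 < a u.
  move=> Uu; have /(_ (delta_mx 0 0)) := (pA u Uu).2.
  rewrite -rowE trmx_delta -colE !mxE; apply.
  by apply/eqP => /matrixP/(_ 0 0); rewrite !mxE/= => /eqP; rewrite oner_eq0.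
pose r u := (Num.sqrt (a u))^-1.
have rE u : U u -> r u * r u * a u = 1.
  move=> Uu; rewrite /r -{3}(sqr_sqrtr (ltW (a0 u Uu))) expr2.
  by rewrite -invfM mulVf// mulf_neq0// gt_eqF// sqrtr_gt0 a0.
(* The Schur complement of the pivot [a u], since r^2 = 1 / a. *)
pose d' u := d u - (r u * r u) *: ((b u)^T *m b u).
have Ca k : Ck_on k U a by apply: (Ck_on_mxP _ _ oU).1; exact: sA.
have Cr k : Ck_on k U r by exact: Ck_on_invsqrt.
have Cb k : Ck_on k U b.
  apply/Ck_on_mxP => // i j; under eq_fun do rewrite !mxE; exact: (Ck_on_mxP k A oU).1.
have Cd k : Ck_on k U d.
  apply/Ck_on_mxP => // i j; under eq_fun do rewrite !mxE; exact: (Ck_on_mxP k A oU).1.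
have Cb' k : Ck_on k U (fun u => (b u)^T).
  apply/Ck_on_mxP => // i j; under eq_fun do rewrite !mxE; exact: (Ck_on_mxP k A oU).1.
have Crr k : Ck_on k U (fun u => r u * r u) by exact: Ck_onM.
have scal k m l (c : V -> R) (f : V -> 'M[R]_(m, l)) : Ck_on k U c -> Ck_on k U f ->
    Ck_on k U (fun u => c u *: f u).
  move=> Cc /Ck_on_mxP Cf; apply/Ck_on_mxP => // i j.
  by under eq_fun do rewrite mxE; apply: Ck_onM => //; exact: Cf.
have opp k m l (f : V -> 'M[R]_(m, l)) : Ck_on k U f -> Ck_on k U (fun u => - f u).
  by move=> Cf; under eq_fun do rewrite -scaleN1r; exact: Ck_onZ.
have Cd' k : Ck_on k U d'.
  by apply: Ck_onD => //; apply: opp; apply: scal => //; exact: Ck_on_mulmx.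
(* Prefixing [X] with this column clears the first block against [B u]. It serves twice: to show
   that the Schur complement is positive definite, and to orthonormalise the lower rows of the
   factor. *)
have elim_row u m (X : 'M[R]_(m, n)) : U u ->
    row_mx (- ((r u * r u) *: (X *m (b u)^T))) X *m B u = row_mx 0 (X *m d' u).
  move=> Uu; rewrite (BE u Uu) mul_row_block mul_mx_scalar scalerN scalerA.
  rewrite (mulrC (a u)) rE// scale1r addNr; congr row_mx.
  by rewrite /d' mulmxBr mulNmx addrC -scalemxAl -scalemxAr mulmxA.
have pd' u : U u -> posdef (d' u).
  move=> Uu; split.
    rewrite /d' linearB linearZ/= trmx_mul trmxK; congr (_ - _).
    by rewrite /d trmx_drsub sB.
  have pB : forall z : 'rV[R]_(1 + n), z != 0 -> 0 < (z *m B u *m z^T) 0 0 := (pA u Uu).2.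
  move=> x x0; have := pB (row_mx (- ((r u * r u) *: (x *m (b u)^T))) x).
  rewrite elim_row// tr_row_mx mul_row_col mul0mx add0r; apply.
  by apply: contra x0 => /eqP; rewrite -row_mx0 => /eq_row_mx[_ ->].
have [E' [sE' E'1 DE']] := IHn d' Cd' pd'.
pose e21 u := - ((r u * r u) *: (E' u *m (b u)^T)).
exists (fun u => block_mx (r u)%:M 0 (e21 u) (E' u) : 'M[R]_(1 + n));
  split=> [k|u Uu|u v Uu DA].
- apply: (@Ck_on_block k 1 n 1 n).
  + apply/Ck_on_mxP => // i j; rewrite !ord1; apply: Ck_on_eq (Cr k) => // u _.
    by rewrite mxE eqxx mulr1n.
  + exact: Ck_on_cst.
  + by apply: opp; apply: scal => //; apply: Ck_on_mulmx => //; exact: sE'.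
  + exact: sE'.
- change (block_mx (r u)%:M 0 (e21 u) (E' u) *m B u *m
    (block_mx (r u)%:M 0 (e21 u) (E' u))^T = (1%:M : 'M[R]_(1 + n))).
  rewrite {1}block_mxEv mul_col_mx elim_row// {1}(BE u Uu) mul_row_block !mul0mx !addr0.
  rewrite -block_mxEv tr_block_mx mulmx_block !trmx0 !mulmx0 !addr0 !mul0mx !add0r E'1//.
  rewrite tr_scalar_mx (_ : 1%:M = block_mx 1%:M 0 0 1%:M) ?scalar_mx_block//;
    congr block_mx.
    by rewrite -!scalar_mxM -(rE u Uu); congr _%:M; ring.
  rewrite -scalar_mxM !mul_scalar_mx /e21.
  rewrite (_ : (- _)^T = - ((r u * r u) *: (b u *m (E' u)^T))); last first.
    by rewrite linearN linearZ/= trmx_mul trmxK.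
  rewrite scalerN scalerA -scalemxAl (_ : r u * a u * _ = r u); first by rewrite addNr.
  by rewrite -[RHS]mul1r -(rE u Uu); ring.
- have dA : differentiable A u by have [+ _] := sA 1%N; exact.
  have D0 : is_derive u v A 0 by rewrite -DA; exact: is_derive_diff.
  have Da : is_derive u v a 0 by have := is_derive_entry 0 0 D0; rewrite mxE.
  have dr : is_derive u v r 0.
    have da : differentiable a u by have [+ _] := Ca 1%N; exact.
    have := is_derive_invsqrt v (a0 u Uu) da; have [_ ->] := Da; by rewrite !mulr0.
  have Dij i j : is_derive u v (fun x => A x i j) 0 by have := is_derive_entry i j D0;
    rewrite mxE.
  have Db : is_derive u v b 0.
    by apply: is_derive_mx => i j; rewrite mxE; under eq_fun do rewrite !mxE.
  have Dd : is_derive u v d 0.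
    by apply: is_derive_mx => i j; rewrite mxE; under eq_fun do rewrite !mxE.
  have Db' : is_derive u v (fun u => (b u)^T) 0.
    by apply: is_derive_mx => i j; rewrite mxE; under eq_fun do rewrite !mxE.
  have Drr : is_derive u v (fun u => r u * r u) 0.
    by have := is_derive_prod dr dr; rewrite mulr0 mul0r addr0.
  have Dd' : 'D_v d' u = 0.
    have [_ ->] := is_derive_sub Dd (is_derive_scalemx Drr (is_derive_mulmx Db' Db)).
    by rewrite mul0mx mulmx0 addr0 scaler0 scale0r addr0 subr0.
  have dE' : differentiable E' u by have [+ _] := sE' 1%N; exact.
  have DE : is_derive u v E' 0 by rewrite -(DE' u v Uu Dd'); exact: is_derive_diff.
  have De : is_derive u v e21 0.
    have := is_derive_opp (is_derive_scalemx Drr (is_derive_mulmx DE Db')).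
    by rewrite mul0mx mulmx0 addr0 scaler0 scale0r addr0 oppr0.
  have Dr1 : is_derive u v (fun u => (r u)%:M : 'M[R]_1) 0.
    apply: is_derive_mx => i j; rewrite !ord1 mxE; move: dr; congr is_derive.
    by apply/funext => x; rewrite mxE eqxx mulr1n.
  have [_ ->] := is_derive_block Dr1 (is_derive_const 0 u v) De DE.
  by rewrite block_mx0.
Qed.

End Cholesky.

Lemma cholesky_pt n (A : 'M[R]_n) : posdef A ->
  exists E : 'M[R]_n, E *m A *m E^T = 1%:M.
Proof.
move=> pA; have [||E [_ E1 _]] := @cholesky R^o setT openT n (fun=> A).
- by move=> k; exact: Ck_on_cst.
- by [].
- by exists (E 0); exact: E1.
Qed.

Lemma frame_inv n (A E : 'M[R]_n) : A^T = A -> E *m A *m E^T = 1%:M ->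
  (E^T *m E) *m A = 1%:M /\ A *m (E^T *m E) = 1%:M.
Proof.
rewrite -mulmxA => sA /mulmx1C E1; have E2 : A *m (E^T *m E) = 1%:M by rewrite mulmxA.
by split=> //; exact: mulmx1C.
Qed.

(** Let the rows of [N] be an orthonormal basis of the row space of [S]. The projector P = N^T N
    satisfies S P = S and tr (P P^T) = rank S, so Cauchy-Schwarz applied to tr S = tr (S P) gives
    the bound. *)
Lemma trace_sq_le_rank n (S : 'M[R]_n) (r : R) : S^T = S -> (\rank S)%:R <= r ->
  \tr S ^+ 2 <= r * \tr (S *m S^T).
Proof.
move=> sS rS.
have {rS}[m [A [rS fA eA]]] : exists m (A : 'M[R]_(m, n)),
    [/\ m%:R <= r, row_free A & (A :=: S)%MS].
  by exists (\rank S), (row_base S); split; [|exact: row_base_free|exact: eq_row_base].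
have pA : posdef (A *m A^T).
  split=> [|x x0]; first by rewrite trmx_mul trmxK.
  rewrite !mulmxA -mulmxA -trmx_mul lt_neqAle sqnorm_ge0 andbT eq_sym.
  apply: contra x0 => /eqP/sqnorm_eq0; rewrite -[RHS](mul0mx _ A).
  by move/(row_free_inj fA) ->.
have [E E1] := cholesky_pt pA; pose N := E *m A.
have NN : N *m N^T = 1%:M by rewrite /N trmx_mul !mulmxA -(mulmxA E).
have [X SE] : exists X, S = X *m N.
  have /submxP[Y YE] : (S <= A)%MS by rewrite eA.
  have [_ AE] := frame_inv pA.1 E1.
  exists (Y *m (A *m A^T *m E^T)).
  by rewrite {1}YE -[Y in LHS]mulmx1 -AE /N !mulmxA.
have SN : S *m N^T *m N = S by rewrite {1}SE -2!mulmxA (mulmxA N) NN mul1mx -SE.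
have NT : (N^T *m N)^T = N^T *m N by rewrite trmx_mul trmxK.
have N2 : N^T *m N *m (N^T *m N) = N^T *m N by rewrite mulmxA -(mulmxA N^T) NN mulmx1.
have := frobenius_cauchy_schwarz S (N^T *m N).
rewrite NT N2 mulmxA SN [\tr (N^T *m N)]mxtrace_mulC NN mxtrace1 => h.
by rewrite (le_trans h)// mulrC ler_wpM2r// frobenius_ge0.
Qed.

End PosDef.

(** * Pointwise lower bound for the curvature terms *)

Section CurvatureEstimate.
Variable R : realType.

(** If [M i j] is the curvature endomorphism of the i-th and j-th coordinate vectors, this is R(x,
    y), acting on rows from the right. *)
Definition bil2 n m (M : 'I_n -> 'I_n -> 'M[R]_m) (x y : 'rV[R]_n) : 'M[R]_m :=
  \sum_i \sum_j (x 0 i * y 0 j) *: M i j.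

Lemma bil2_anti n m (M : 'I_n -> 'I_n -> 'M[R]_m) x y :
  (forall i j, M i j = - M j i) -> bil2 M x y = - bil2 M y x.
Proof.
move=> aM; rewrite /bil2 exchange_big -sumrN/=; apply: eq_bigr => i _.
by rewrite -sumrN; apply: eq_bigr => j _; rewrite aM scalerN mulrC.
Qed.

Lemma bil2_mull n l m (M : 'I_n -> 'I_n -> 'M[R]_m) (x : 'rV[R]_l) (A : 'M[R]_(l, n)) y :
  bil2 M (x *m A) y = \sum_a x 0 a *: bil2 M (row a A) y.
Proof.
rewrite /bil2; under [RHS]eq_bigr do rewrite scaler_sumr; rewrite [RHS]exchange_big/=.
apply: eq_bigr => i _; under [RHS]eq_bigr do rewrite scaler_sumr;
  rewrite [RHS]exchange_big/=.
apply: eq_bigr => j _; rewrite mxE !mulr_suml scaler_suml.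
by apply: eq_bigr => a _; rewrite scalerA mxE mulrA.
Qed.

Lemma bil2_mulr n l m (M : 'I_n -> 'I_n -> 'M[R]_m) x (y : 'rV[R]_l) (A : 'M[R]_(l, n)) :
  bil2 M x (y *m A) = \sum_a y 0 a *: bil2 M x (row a A).
Proof.
rewrite /bil2; under [RHS]eq_bigr do rewrite scaler_sumr; rewrite [RHS]exchange_big/=.
apply: eq_bigr => i _; under [RHS]eq_bigr do rewrite scaler_sumr;
  rewrite [RHS]exchange_big/=.
apply: eq_bigr => j _; rewrite mxE !mulr_sumr scaler_suml.
by apply: eq_bigr => a _; rewrite scalerA mxE mulrCA.
Qed.

Lemma mx11_row_mul m n (A : 'M[R]_(m, n)) (B : 'M[R]_(n, m)) a b :
  (A *m B) a b = (row a A *m (row b B^T)^T) 0 0.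
Proof. by rewrite !mxE; apply: eq_bigr => i _; rewrite !mxE. Qed.

(** Trades contraction with the inverse metric [E^T *m E], natural in the Bochner formula, for a sum
    over the frame of rows of [E], natural in the curvature hypotheses. *)
Lemma frame_sum q (E : 'M[R]_q) (X : 'I_q -> 'I_q -> 'M[R]_q) :
  \sum_j \sum_m (E^T *m E *m X j m *m (E^T *m E)) j m =
  \sum_a \sum_b (E *m (\sum_j \sum_m (E a j * E b m) *: X j m) *m E^T) a b.
Proof.
transitivity (\sum_j \sum_m \sum_a \sum_b E a j * E b m * (E *m X j m *m E^T) a b).
  apply: eq_bigr => j _; apply: eq_bigr => m _.
  rewrite -!mulmxA mxE; apply: eq_bigr => a _.
  rewrite !mulmxA [X in _ * X]mxE mulr_sumr; apply: eq_bigr => b _.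
  by rewrite [E^T _ _]mxE; ring.
under eq_bigr do rewrite exchange_big/=.
rewrite exchange_big/=; apply: eq_bigr => a _.
under eq_bigr do rewrite exchange_big/=.
rewrite exchange_big/=; apply: eq_bigr => b _.
rewrite mulmx_sumr mulmx_suml summxE; apply: eq_bigr => j _.
rewrite mulmx_sumr mulmx_suml summxE; apply: eq_bigr => m _.
by rewrite -scalemxAr -scalemxAl [RHS]mxE.
Qed.

Variables (q q' : nat) (h E : 'M[R]_q) (k : 'M[R]_q') (J : 'M[R]_(q, q')).
Variables (R2 : 'I_q -> 'I_q -> 'M[R]_q) (R2' : 'I_q' -> 'I_q' -> 'M[R]_q').
Variables (lambda mu C : R).
Hypotheses (h_sym : h^T = h) (E_orth : E *m h *m E^T = 1%:M) (k_pos : posdef k).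
Hypotheses (R2_anti : forall i j, R2 i j = - R2 j i).
Hypotheses (R2'_anti : forall i j, R2' i j = - R2' j i).
Hypotheses (mu_gt0 : 0 < mu) (C_gt0 : 0 < C) (rank_J : (\rank J)%:R <= C).

Definition frame_ricci (x : 'rV[R]_q) : 'rV[R]_q := \sum_a row a E *m bil2 R2 x (row a E).

Hypothesis ric_ge : forall x,
  lambda * (x *m h *m x^T) 0 0 <= (frame_ricci x *m h *m x^T) 0 0.
Hypothesis sec_le : forall x y, (y *m bil2 R2' x y *m k *m x^T) 0 0 <=
  mu * ((x *m k *m x^T) 0 0 * (y *m k *m y^T) 0 0 - (x *m k *m y^T) 0 0 ^+ 2).

Variables (Phi : 'M[R]_(q, q')) (S : 'M[R]_q).
Hypotheses (PhiE : Phi = E *m J) (defS : S = Phi *m k *m Phi^T).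

Lemma ric_mul l (x : 'rV[R]_l) (A : 'M[R]_(l,
  q)) : frame_ricci (x *m A) = \sum_a x 0 a *: frame_ricci (row a A).
Proof.
rewrite /frame_ricci; under [RHS]eq_bigr do rewrite scaler_sumr;
  rewrite [RHS]exchange_big/=.
apply: eq_bigr => a _; rewrite bil2_mull mulmx_sumr; apply: eq_bigr => b _.
by rewrite scalemxAr.
Qed.

(** The Ricci bound concerns vectors of Q, whereas this term is a trace of forms on Q'. Factoring k
    = G G^T splits it as a sum of <Ric x_r, x_r> over vectors x_r of Q with sum of |x_r|^2 equal to
    [\tr S]. *)
Lemma ricci_term_ge :
  lambda * \tr S <= - \sum_a \sum_b (E *m (bil2 R2 (row a E) (row b E) *m J) *m k *m
    Phi^T) a b.
Proof.
have [G kG] : exists G : 'M[R]_q', k = G *m G^T.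
  have [D D1] := cholesky_pt k_pos; have [_ kD] := frame_inv k_pos.1 D1.
  exists (k *m D^T).
  by rewrite trmx_mul trmxK k_pos.1 !mulmxA -(mulmxA k) kD mul1mx.
have [Psi PsiE] : exists Psi, Psi = Phi *m G by exists (Phi *m G).
(* The adjoint of d_T phi applied to the r-th vector of the orthonormal basis of Q' defined by
   [G]. *)
pose x r : 'rV[R]_q := (col r Psi)^T *m E.
have [Hh hH] := frame_inv h_sym E_orth.
have -> : \tr S = \sum_r (x r *m h *m (x r)^T) 0 0.
  have -> : S = Psi *m Psi^T by rewrite defS kG PsiE trmx_mul !mulmxA.
  rewrite mxtrace_mulC; apply: eq_bigr => r _.
  have -> : x r *m h *m (x r)^T = (col r Psi)^T *m (E *m h *m E^T) *m col r Psi.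
    by rewrite /x trmx_mul trmxK !mulmxA.
  by rewrite E_orth mulmx1 !mxE; apply: eq_bigr => i _; rewrite !mxE.
suff -> : - \sum_a \sum_b (E *m (bil2 R2 (row a E) (row b E) *m J) *m k *m Phi^T) a b =
    \sum_r (frame_ricci (x r) *m h *m (x r)^T) 0 0.
  by rewrite mulr_sumr; apply: ler_sum => r _; exact: ric_ge.
transitivity (\sum_b (frame_ricci (row b E) *m J *m k *m (row b Phi)^T) 0 0).
  rewrite exchange_big/= -sumrN; apply: eq_bigr => b _; rewrite -sumrN.
  rewrite /frame_ricci !mulmx_suml summxE; apply: eq_bigr => a _.
  rewrite (bil2_anti (row b E) _ R2_anti) mulmxN !mulNmx [RHS]mxE; congr (- _).
  by rewrite mx11_row_mul trmxK !row_mul !mulmxA.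
transitivity (\sum_b \sum_r Psi b r * (frame_ricci (row b E) *m h *m (x r)^T) 0 0).
  apply: eq_bigr => b _.
  have -> : frame_ricci (row b E) *m J *m k *m (row b Phi)^T =
     (frame_ricci (row b E) *m h *m E^T *m Psi) *m (row b Psi)^T.
    have RJ : frame_ricci (row b E) *m J = frame_ricci (row b E) *m h *m E^T *m Phi.
      by rewrite PhiE -!mulmxA (mulmxA E^T) (mulmxA h) hH mul1mx.
    by rewrite RJ PsiE kG row_mul trmx_mul !mulmxA.
  rewrite mxE; apply: eq_bigr => r _; rewrite [in X in _ * X]mxE [in X in _ * X]mxE mulrC.
  by congr (_ * _); rewrite /x trmx_mul trmxK !mulmxA [LHS]mxE [RHS]mxE;
    apply: eq_bigr => i _; rewrite [col _ _ _ _]mxE.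
rewrite exchange_big/=; apply: eq_bigr => r _.
rewrite {2}/x ric_mul !mulmx_suml summxE; apply: eq_bigr => b _.
by rewrite -!scalemxAl !mxE.
Qed.

(** The sectional bound for each pair of frame images sums to -mu ((tr S)^2 - tr (S S^T)). As [S]
    factors through [J], its rank is at most [C], and [trace_sq_le_rank] bounds tr (S S^T) from
    below. *)
Lemma sectional_term_ge :
  - (mu * (1 - C^-1) * \tr S ^+ 2) <=
  \sum_a \sum_b (E *m (J *m bil2 R2' (row a E *m J) (row b E *m J)) *m k *m Phi^T) a b.
Proof.
have SE a b : (row a Phi *m k *m (row b Phi)^T) 0 0 = S a b.
  by rewrite defS [RHS]mx11_row_mul trmxK row_mul.
have S_sym : S^T = S by rewrite defS !trmx_mul trmxK k_pos.1 mulmxA.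
have rS : (\rank S)%:R <= C.
  apply: le_trans rank_J; rewrite ler_nat defS PhiE -!mulmxA.
  by apply: leq_trans (mxrankM_maxr _ _) _; exact: mxrankM_maxl.
have trS := trace_sq_le_rank S_sym rS.
apply: (@le_trans _ _ (\sum_a \sum_b - (mu * (S b b * S a a - S b a ^+ 2)))).
  have -> : \sum_a \sum_b - (mu * (S b b * S a a - S b a ^+ 2)) = - (mu * (\tr S ^+ 2 -
    \tr (S *m S^T))).
    under eq_bigr do rewrite sumrN -mulr_sumr sumrB.
    rewrite sumrN -mulr_sumr sumrB; congr (- (_ * (_ - _))).
      by rewrite expr2 /mxtrace mulr_sumr; apply: eq_bigr => a _; rewrite mulr_suml.
    rewrite exchange_big/=; apply: eq_bigr => b _; rewrite mxE; apply: eq_bigr => a _.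
    by rewrite mxE expr2.
  have trC : C^-1 * \tr S ^+ 2 <= \tr (S *m S^T) by rewrite mulrC ler_pdivrMr// mulrC.
  rewrite lerN2 -subr_ge0 [X in _ <= X](_ : _ = mu * (\tr (S *m S^T) - C^-1 * \tr S ^+ 2)).
    by rewrite mulr_ge0 ?subr_ge0// ltW.
  by ring.
apply: ler_sum => a _; apply: ler_sum => b _.
have := sec_le (row b Phi) (row a Phi); rewrite !SE => sl.
rewrite lerNl; apply: le_trans sl; rewrite (bil2_anti (row b Phi) _ R2'_anti) mulmxN
  !mulNmx.
by rewrite [X in _ <= X]mxE lerN2 mx11_row_mul trmxK PhiE !row_mul !mulmxA.
Qed.

End CurvatureEstimate.
(* The factor 1 - 1/C is the Cauchy-Schwarz gain for the Gram matrix of the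
   images of the frame, whose rank is at most C. *)
Lemma curvature_estimate (R : realType) q q' (h E : 'M[R]_q) (k : 'M[R]_q')
    (J : 'M[R]_(q, q')) (R2 : 'I_q -> 'I_q -> 'M[R]_q)
    (R2' : 'I_q' -> 'I_q' -> 'M[R]_q') (lambda mu C : R) :
  h^T = h -> E *m h *m E^T = 1%:M -> posdef k ->
  (forall i j, R2 i j = - R2 j i) -> (forall i j, R2' i j = - R2' j i) ->
  0 < mu -> 0 < C -> (\rank J)%:R <= C ->
  (forall x, lambda * (x *m h *m x^T) 0 0 <= (frame_ricci E R2 x *m h *m x^T) 0 0) ->
  (forall x y, (y *m bil2 R2' x y *m k *m x^T) 0 0 <=
    mu * ((x *m k *m x^T) 0 0 * (y *m k *m y^T) 0 0 - (x *m k *m y^T) 0 0 ^+ 2)) ->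
  forall H e, H = E^T *m E -> e = \tr (H *m J *m k *m J^T) ->
  lambda * e - mu * (1 - C^-1) * e ^+ 2 <=
  \sum_j \sum_m (H *m (J *m bil2 R2' (row j J) (row m J) - R2 j m *m J) *m k
    *m J^T *m H) j m.
Proof.
move=> h_sym E_orth k_pos R2_anti R2'_anti mu_gt0 C_gt0 rank_J ric_ge sec_le H e defH ->.
set Phi := E *m J; set S := Phi *m k *m Phi^T.
have -> : \tr (H *m J *m k *m J^T) = \tr S.
  by rewrite defH /S /Phi trmx_mul -!mulmxA mxtrace_mulC !mulmxA.
rewrite addrC; set rhs := \sum_j _.
have -> : rhs = \sum_a \sum_b (E *m (J *m bil2 R2' (row a E *m J) (row b E *m J)) *m k *m
  Phi^T) a b
    - \sum_a \sum_b (E *m (bil2 R2 (row a E) (row b E) *m J) *m k *m Phi^T) a b.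
  transitivity (\sum_j \sum_m (H *m ((J *m bil2 R2' (row j J) (row m J) - R2 j m *m J) *m
    k *m J^T) *m H) j m).
    by apply: eq_bigr => j _; apply: eq_bigr => m _; rewrite !mulmxA.
  rewrite defH frame_sum -sumrB; apply: eq_bigr => a _; rewrite -sumrB;
    apply: eq_bigr => b _.
  have -> : \sum_j \sum_m (E a j * E b m) *: ((J *m bil2 R2' (row j J) (row m J) - R2 j m
    *m J) *m k *m J^T)
      = J *m bil2 R2' (row a E *m J) (row b E *m J) *m k *m J^T
      - bil2 R2 (row a E) (row b E) *m J *m k *m J^T.
    rewrite bil2_mull mulmx_sumr !mulmx_suml /bil2 -sumrB; apply: eq_bigr => j _.
    rewrite -/(bil2 R2' _ _) bil2_mulr -scalemxAr -!scalemxAl.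
    rewrite mulmx_sumr !mulmx_suml scaler_sumr -sumrB; apply: eq_bigr => m _.
    by rewrite -scalemxAr -!scalemxAl scalerA !mxE !mulmxBl scalerBr.
  by rewrite mulmxBr mulmxBl [LHS]mxE [X in _ + X]mxE /Phi trmx_mul !mulmxA.
apply: lerD; first exact: (sectional_term_ge k_pos R2'_anti mu_gt0 C_gt0 rank_J sec_le).
exact: (ricci_term_ge h_sym E_orth k_pos R2_anti ric_ge).
Qed.

(** * Leibniz and commutator identities for connection matrices *)

Section MatrixIdentities.
Variables (R : comRingType) (q q' : nat).


(** The derivatives substituted for [H] and [k] say that both metrics are parallel. The connection
    terms they contribute are exactly those that turn [dX] and [dY] into covariant derivatives, up
    to one cyclic permutation under the trace. *)
Lemma trace_leibniz (H G : 'M[R]_q) (X dX Y dY : 'M[R]_(q, q')) (k G' : 'M[R]_q') :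
  \tr ((((- (H *m G + G^T *m H)) *m X + H *m dX) *m k
         + H *m X *m (G' *m k + k *m G'^T)) *m Y^T + H *m X *m k *m dY^T) =
  \tr (H *m (dX + X *m G' - G *m X) *m k *m Y^T) +
  \tr (H *m X *m k *m (dY + Y *m G' - G *m Y)^T).
Proof.
have -> : (dY + Y *m G' - G *m Y)^T = dY^T + G'^T *m Y^T - Y^T *m G^T.
  by rewrite linearB/= linearD/= !trmx_mul.
have cyc : \tr (G^T *m H *m X *m k *m Y^T) = \tr (H *m X *m k *m Y^T *m G^T).
  by rewrite -!mulmxA mxtrace_mulC !mulmxA.
rewrite !(mulmxDl, mulmxDr, mulNmx, mulmxN, opprD) !mulmxA.
rewrite !(mxtraceD, opprD, raddfN)/= cyc.
ring.
Qed.

(** The algebra of the Ricci identity: the second derivative [ddJ], common to both orders of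
    differentiation, and all mixed first-order terms cancel, leaving the two curvatures. *)
Lemma commutator_leibniz (J dJi dJj ddJ : 'M[R]_(q, q')) (Gi Gj dGi dGj : 'M[R]_q)
    (Gi' Gj' dGi' dGj' : 'M[R]_q') :
  (ddJ + (dJj *m Gi' + J *m dGi') - (dGi *m J + Gi *m dJj))
    + (dJi + J *m Gi' - Gi *m J) *m Gj' - Gj *m (dJi + J *m Gi' - Gi *m J)
  - ((ddJ + (dJi *m Gj' + J *m dGj') - (dGj *m J + Gj *m dJi))
    + (dJj + J *m Gj' - Gj *m J) *m Gi' - Gi *m (dJj + J *m Gj' - Gj *m J)) =
  J *m (dGi' - dGj' + Gi' *m Gj' - Gj' *m Gi')
  - (dGi - dGj + Gi *m Gj - Gj *m Gi) *m J.
Proof.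
rewrite !(mulmxDl, mulmxDr, mulNmx, mulmxN, opprD) !mulmxA.
move: (dJj *m Gi') (J *m dGi') (dGi *m J) (Gi *m dJj) (dJi *m Gj') (Gj *m dJi) => a1 a2
  a3 a4 a5 a6.
move: (J *m dGj') (dGj *m J) (J *m Gi' *m Gj') (J *m Gj' *m Gi') => a7 a8 a9 b1.
move: (Gi *m J *m Gj') (Gj *m J *m Gi') (Gi *m Gj *m J) (Gj *m Gi *m J) => b2 b3 b4 b5.
by apply/matrixP => a b; rewrite !mxE; ring.
Qed.

End MatrixIdentities.

(** * The Bochner formula in a coordinate frame *)

Section Bochner.
Variables (R : realType) (V : normedModType R) (U : set V) (q q' : nat).
Variables (eps : 'I_q -> V) (H : V -> 'M[R]_q) (k : V -> 'M[R]_q').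
Variables (G : 'I_q -> V -> 'M[R]_q) (G' : 'I_q -> V -> 'M[R]_q').
Implicit Types (X Y : V -> 'M[R]_(q, q')).
Hypothesis oU : open U.
Hypothesis H_sym : forall u, U u -> (H u)^T = H u.
Hypothesis k_sym : forall u, U u -> (k u)^T = k u.
Hypothesis H_der : forall u i, U u ->
  is_derive u (eps i) H (- (H u *m G i u + (G i u)^T *m H u)).
Hypothesis k_der : forall u i, U u ->
  is_derive u (eps i) k (G' i u *m k u + k u *m (G' i u)^T).

(* Vectors are rows and endomorphisms act on the right: G i and G' i are the
   connection matrices of Q and of the pull-back bundle in the direction eps i,
   and nab i is the induced connection on sections of their Hom bundle. *)
Definition nab i X u : 'M[R]_(q, q') :=
  'D_(eps i) X u + X u *m G' i u - G i u *m X u.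

(** With [H] the inverse metric of Q and [k] the metric of the pull-back of Q', this is the induced
    inner product on Hom (Q, Q'). The hypotheses [H_der] and [k_der] state that the two metrics are
    parallel. *)
Definition inner_section X Y u : R := \tr (H u *m X u *m k u *m (Y u)^T).

Lemma is_derive_inner_section X Y u i : U u ->
  derivable X u (eps i) -> derivable Y u (eps i) ->
  is_derive u (eps i) (inner_section X Y)
    (inner_section (nab i X) Y u + inner_section X (nab i Y) u).
Proof.
move=> Uu /derivableP DX /derivableP DY.
have DYT : is_derive u (eps i) (fun x => (Y x)^T) ('D_(eps i) Y u)^T.
  apply: is_derive_mx => a b; rewrite mxE; under eq_fun do rewrite mxE.
  exact: is_derive_entry.
have := is_derive_trace (is_derive_mulmx (is_derive_mulmx (is_derive_mulmx (H_der i Uu)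
  DX) (k_der i Uu)) DYT).
congr is_derive; exact: trace_leibniz.
Qed.

Variable J : V -> 'M[R]_(q, q').
Definition nablaJ i := nab i J.
Definition energy := inner_section J J.

Hypothesis J_der : forall u i, U u -> derivable J u (eps i).
Hypothesis DJ_der : forall u i j, U u -> derivable (fun x => 'D_(eps i) J x) u (eps j).
Hypothesis G_der : forall u i j, U u -> derivable (G i) u (eps j).
Hypothesis G'_der : forall u i j, U u -> derivable (G' i) u (eps j).
Hypothesis DJ_comm : forall u i j, U u ->
  'D_(eps i) (fun x => 'D_(eps j) J x) u = 'D_(eps j) (fun x => 'D_(eps i) J x) u.
Hypothesis G_sym : forall u i j, U u -> row j (G i u) = row i (G j u).
Hypothesis nablaJ_sym : forall u i j, U u -> row j (nablaJ i u) = row i (nablaJ j u).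
Hypothesis tension0 : forall u, U u -> \sum_i row i (H u *m nablaJ i u) = 0.

Lemma is_derive_nablaJ u i j : U u ->
  is_derive u (eps j) (nablaJ i) ('D_(eps j) (fun x => 'D_(eps i) J x) u
   + ('D_(eps j) J u *m G' i u + J u *m 'D_(eps j) (G' i) u)
   - ('D_(eps j) (G i) u *m J u + G i u *m 'D_(eps j) J u)).
Proof.
move=> Uu; have /derivableP DJ : derivable J u (eps j) := J_der Uu.
have /derivableP DDJ : derivable (fun x => 'D_(eps i) J x) u (eps j) := DJ_der Uu.
have /derivableP DG : derivable (G i) u (eps j) := G_der Uu.
have /derivableP DG' : derivable (G' i) u (eps j) := G'_der Uu.
exact: (is_derive_sub (is_derive_add DDJ (is_derive_mulmx DJ DG')) (is_derive_mulmx DG DJ)).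
Qed.

Lemma is_derive_energy u i : U u ->
  is_derive u (eps i) energy (2 * inner_section (nablaJ i) J u).
Proof.
move=> Uu; have := @is_derive_inner_section J J u i Uu (J_der Uu) (J_der Uu).
congr is_derive; rewrite mulr2n mulrDl mul1r; congr (_ + _).
rewrite /inner_section -mxtrace_tr !trmx_mul trmxK H_sym// k_sym//.
by rewrite !mulmxA mxtrace_mulC !mulmxA.
Qed.

Lemma is_derive_inner_nablaJ u i j : U u ->
  is_derive u (eps j) (inner_section (nablaJ i) J)
    (inner_section (nab j (nablaJ i)) J u + inner_section (nablaJ i) (nablaJ j) u).
Proof.
move=> Uu; apply: is_derive_inner_section => //; last exact: J_der.
by have [] := is_derive_nablaJ i j Uu.
Qed.

Definition curv_src u j i : 'M[R]_q :=
  'D_(eps j) (G i) u - 'D_(eps i) (G j) u + G i u *m G j u - G j u *m G i u.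
Definition curv_tgt u j i : 'M[R]_q' :=
  'D_(eps j) (G' i) u - 'D_(eps i) (G' j) u + G' i u *m G' j u - G' j u *m G' i u.

Lemma nab_comm u i j : U u ->
  nab j (nablaJ i) u - nab i (nablaJ j) u = J u *m curv_tgt u j i - curv_src u j i *m J u.
Proof.
move=> Uu; rewrite /nab.
have [_ ->] := is_derive_nablaJ i j Uu; have [_ ->] := is_derive_nablaJ j i Uu.
rewrite (DJ_comm i j Uu); exact: commutator_leibniz.
Qed.

(* The second covariant derivative of J, the direction index i being corrected
   by the connection; hessJ_comm is the Ricci identity. *)
Definition hessJ u j i : 'M[R]_(q, q') :=
  nab j (nablaJ i) u - \sum_l G j u i l *: nablaJ l u.

(** Covariant differentiation preserves the symmetry [nablaJ_sym]: the [G] correction of the row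
    index and that of the direction index are exchanged. *)
Lemma hessJ_sym u i j m : U u -> row m (hessJ u j i) = row i (hessJ u j m).
Proof.
move=> Uu; have Bsum a b : row a (G j u) *m nablaJ b u = \sum_l G j u a l *: row b
  (nablaJ l u).
  rewrite mulmx_sum_row; apply: eq_bigr => l _.
  by rewrite mxE (nablaJ_sym b l Uu).
have rowE a b : row a (hessJ u j b) = 'D_(eps j) (fun x => row a (nablaJ b x)) u
    + row a (nablaJ b u) *m G' j u - row a (G j u) *m nablaJ b u
    - \sum_l G j u b l *: row a (nablaJ l u).
  have [/derivableP DB _] := is_derive_nablaJ b j Uu.
  have [_ ->] := is_derive_linear_mx (@row R q q' a) DB.
  have -> : \sum_l G j u b l *: row a (nablaJ l u) = row a (\sum_l G j u b l *: nablaJ l u).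
    by rewrite linear_sum; apply: eq_bigr => l _; rewrite linearZ.
  rewrite /hessJ /nab; move: (nablaJ b u) ('D_(eps j) (nablaJ b) u) (\sum_l _) => M D S.
  by rewrite !linearB/= linearD/= !row_mul.
rewrite !rowE !Bsum nablaJ_sym// (derive_near _ oU Uu (fun x Ux => nablaJ_sym i m Ux)).
rewrite -!addrA; congr (_ + (_ + _)).
by rewrite [LHS]addrC; congr (- _ - _); apply: eq_bigr => l _; rewrite (nablaJ_sym l).
Qed.

Lemma hessJ_comm u i j : U u ->
  hessJ u j i = hessJ u i j + (J u *m curv_tgt u j i - curv_src u j i *m J u).
Proof.
move=> Uu; rewrite -nab_comm// /hessJ.
(* Absence of torsion, [G_sym], makes the direction corrections equal, so they drop out of the
   commutator. *)
rewrite (_ : \sum_l G j u i l *: nablaJ l u = \sum_l G i u j l *: nablaJ l u); last first.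
  apply: eq_bigr => l _; congr (_ *: _).
  by have /rowP/(_ l) := G_sym j i Uu; rewrite !mxE.
by rewrite [RHS]addrC subrKA.
Qed.

(** This is the covariant derivative of the tension equation, which may be differentiated because it
    holds on all of [U]; as [H] is parallel, the trace commutes with the derivative. *)
Lemma hessJ_trace u m : U u -> \sum_j row j (H u *m hessJ u m j) = 0.
Proof.
move=> Uu; have D0 : \sum_j row j (- (H u *m G m u + (G m u)^T *m H u) *m nablaJ j u
    + H u *m 'D_(eps m) (nablaJ j) u) = 0.
  have D j : is_derive u (eps m) (fun x => row j (H x *m nablaJ j x))
      (row j (- (H u *m G m u + (G m u)^T *m H u) *m nablaJ j u + H u *m 'D_(eps m)
        (nablaJ j) u)).
    have [/derivableP DB _] := is_derive_nablaJ j m Uu.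
    exact: (is_derive_linear_mx (@row R q q' j) (is_derive_mulmx (H_der m Uu) DB)).
  have [_ <-] := is_derive_bigsum D.
  by rewrite (derive_near _ oU Uu tension0) derive_cst.
(* Three groups of terms: the derivative of the tension, the tension times [G'], and a difference
   that cancels only after summation over [j]. *)
have E j : row j (H u *m hessJ u m j) =
    row j (- (H u *m G m u + (G m u)^T *m H u) *m nablaJ j u + H u *m 'D_(eps m) (nablaJ
      j) u)
    + row j (H u *m nablaJ j u) *m G' m u
    + (row j ((G m u)^T *m H u *m nablaJ j u) - \sum_l G m u j l *: row j (H u *m nablaJ
      l u)).
  have -> : \sum_l G m u j l *: row j (H u *m nablaJ l u) = row j (H u *m \sum_l G m u j
    l *: nablaJ l u).
    rewrite mulmx_sumr linear_sum; apply: eq_bigr => l _.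
    by rewrite -scalemxAr linearZ.
  rewrite /hessJ /nab; move: (nablaJ j u) ('D_(eps m) (nablaJ j) u) (\sum_l _) => M D S.
  rewrite -row_mul -!linearD -linearB -linearD/=; congr (row j _).
  rewrite !(mulmxDl, mulmxDr, mulNmx, mulmxN, opprD) !mulmxA.
  move: (H u *m D) (H u *m M *m _) (H u *m G m u *m M) ((G m u)^T *m _ *m M) => a1 a2 a3 a4.
  by apply/matrixP => a b; rewrite !mxE; ring.
under eq_bigr do rewrite E.
rewrite !big_split/= D0 -mulmx_suml tension0// mul0mx !add0r.
apply/eqP; rewrite sumrN subr_eq0; apply/eqP.
under eq_bigr do rewrite -mulmxA row_mul mulmx_sum_row.
rewrite exchange_big/=; apply: eq_bigr => j _; apply: eq_bigr => l _.
by rewrite !mxE.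
Qed.

(** Differentiating the energy twice leaves |nabla J|^2 plus the traced Hessian of [J] paired with
    [J]. The trace falls on two derivative indices, where the tension says nothing; symmetry of the
    Hessian and then the Ricci identity move it to a derivative of the tension, at the price of the
    curvature terms. *)
Theorem bochner u : U u ->
  \sum_i \sum_j H u i j * ('D_(eps j) (fun x => 'D_(eps i) energy x) u -
     \sum_l G j u i l * 'D_(eps l) energy u) =
  2 * (\sum_j \sum_m (H u *m (J u *m curv_tgt u j m - curv_src u j m *m J u) *m k u
                    *m (J u)^T *m H u) j m
     + \sum_i \sum_j H u i j * inner_section (nablaJ i) (nablaJ j) u).
Proof.
move=> Uu.
have DE l : 'D_(eps l) energy u = 2 * inner_section (nablaJ l) J u.
  by have [_ ->] := is_derive_energy l Uu.
have DDE i j : 'D_(eps j) (fun x => 'D_(eps i) energy x) u =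
    2 * (inner_section (nab j (nablaJ i)) J u + inner_section (nablaJ i) (nablaJ j) u).
  rewrite (derive_near _ oU Uu (g := fun x => 2 * inner_section (nablaJ i) J x));
    last first.
    by move=> x Ux; have [_ ->] := is_derive_energy i Ux.
  by have [_ ->] := is_derive_scal 2 (is_derive_inner_nablaJ i j Uu).
pose N := k u *m (J u)^T *m H u.
have inE (X : V -> 'M[R]_(q, q')) : inner_section X J u = \sum_m (row m (X u) *m N) 0 m.
  rewrite /inner_section -!mulmxA mxtrace_mulC /mxtrace; apply: eq_bigr => m _.
  by rewrite -row_mul [RHS]mxE /N !mulmxA.
transitivity (2 * (\sum_i \sum_j H u i j * (\sum_m (row m (hessJ u j i) *m N) 0 m)
     + \sum_i \sum_j H u i j * inner_section (nablaJ i) (nablaJ j) u)).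
  rewrite -big_split/= mulr_sumr; apply: eq_bigr => i _.
  rewrite -big_split/= mulr_sumr; apply: eq_bigr => j _.
  rewrite DDE (_ : \sum_l _ = 2 * \sum_l G j u i l * inner_section (nablaJ l) J u);
    last first.
    by rewrite mulr_sumr; apply: eq_bigr => l _; rewrite DE mulrCA.
  suff -> : \sum_m (row m (hessJ u j i) *m N) 0 m =
      inner_section (nab j (nablaJ i)) J u - \sum_l G j u i l * inner_section (nablaJ l)
        J u by ring.
  rewrite inE; under [X in _ - X]eq_bigr do rewrite inE mulr_sumr.
  rewrite [X in _ - X]exchange_big -sumrB/=; apply: eq_bigr => m _.
  have -> : \sum_l G j u i l * (row m (nablaJ l u) *m N) 0 m =
      (row m (\sum_l G j u i l *: nablaJ l u) *m N) 0 m.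
    rewrite linear_sum mulmx_suml summxE; apply: eq_bigr => l _.
    by rewrite linearZ/= -scalemxAl [RHS]mxE.
  rewrite /hessJ; move: (nab _ _ _) (\sum_l _) => M S.
  by rewrite linearB/= mulmxBl [LHS]mxE [X in _ + X]mxE.
congr (2 * (_ + _)).
(* By [hessJ_sym] the direction index becomes a row index, so that the contraction with [H] is a
   matrix product. *)
transitivity (\sum_m \sum_j (row j (H u *m hessJ u j m) *m N) 0 m).
  under eq_bigr do under eq_bigr do rewrite mulr_sumr.
  under eq_bigr do rewrite exchange_big/=.
  rewrite exchange_big/=; apply: eq_bigr => m _; rewrite exchange_big/=;
    apply: eq_bigr => j _.
  have -> : row j (H u *m hessJ u j m) = \sum_i H u i j *: row m (hessJ u j i).
    rewrite row_mul mulmx_sum_row; apply: eq_bigr => i _; rewrite hessJ_sym// mxE.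
    by have /matrixP/(_ i j) := H_sym Uu; rewrite mxE => ->.
  rewrite mulmx_suml summxE; apply: eq_bigr => i _.
  by rewrite -scalemxAl [RHS]mxE.
rewrite [RHS]exchange_big/=; apply: eq_bigr => m _.
(* Exchanging the derivatives [j] and [m] produces the curvature; what remains is the trace killed
   by [hessJ_trace]. *)
transitivity ((\sum_j row j (H u *m hessJ u m j) *m N) 0 m +
  \sum_j (row j (H u *m (J u *m curv_tgt u j m - curv_src u j m *m J u)) *m N) 0 m).
  rewrite summxE -big_split/=; apply: eq_bigr => j _.
  rewrite hessJ_comm//; move: (hessJ u m j) (J u *m _ - _) => X K.
  by rewrite mulmxDr linearD/= mulmxDl [LHS]mxE.
rewrite -mulmx_suml hessJ_trace// mul0mx mxE add0r; apply: eq_bigr => j _.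
by rewrite -row_mul mxE /N !mulmxA.
Qed.

End Bochner.

(** * The strong maximum principle *)

Lemma exists_small (R : realFieldType) (a b : R) : 0 < a -> 0 < b ->
  exists c, [/\ 0 < c, c <= a & c < b].
Proof.
move=> a0 b0; exists (Num.min a (b / 2)); split.
- by rewrite lt_min a0 divr_gt0.
- by rewrite ge_min lexx.
- by rewrite gt_min; apply/orP; right; rewrite ltr_pdivrMr// ltr_pMr// ltr1n.
Qed.

(** * First and second derivative tests at an interior maximum *)

Section MaximumTest.
Variables (R : realType) (V : normedModType R) (U : set V) (f : V -> R) (u : V).
Hypotheses (oU : open U) (Uu : U u) (df : forall x, U x -> differentiable f x).
Hypothesis u_max : forall x, U x -> f x <= f u.

Lemma open_line_in v : exists2 t : R, 0 < t &
  forall s, `|s| <= t -> U (u + s *: v).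
Proof.
have /nbhs_ballP[r /= r0 rU] : nbhs u U by exact: open_nbhs_nbhs.
have v1 : 0 < `|v| + 1 by rewrite ltr_wpDl.
exists (r / (2 * (`|v| + 1))); first by rewrite divr_gt0// mulr_gt0.
move=> s st; apply: rU; rewrite -ball_normE /ball_/= opprD addNKr normrN normrZ.
apply: (@le_lt_trans _ _ (`|s| * (`|v| + 1))); first by rewrite ler_wpM2l// lerDl.
rewrite -ltr_pdivlMr// (le_lt_trans st)// ltr_pM2l// ltf_pV2 ?posrE ?mulr_gt0//.
by rewrite ltr_pMl// ltr1n.
Qed.

Lemma derive_at_max v : 'D_v f u = 0.
Proof.
have [t t0 tU] := open_line_in v.
have lineU s : s \in `]- t, t[ -> U (u + s *: v).
  by rewrite in_itv/= => /andP[s1 s2]; apply: tU; rewrite ler_norml !ltW.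
have D0 : is_derive (0 : R) 1 (fun s => f (u + s *: v)) 0.
  apply: (@derive1_at_max _ _ (- t) t).
  - by rewrite ge0_cp// ltW.
  - by move=> s /lineU Us; have [] := is_derive_line (df Us).
  - by rewrite in_itv/= oppr_lt0 t0.
  - by move=> s /lineU Us; rewrite scale0r addr0; exact: u_max.
have := @is_derive_line _ _ _ f u v 0; rewrite scale0r addr0 => /(_ (df Uu)) [_ <-].
by have [_ ->] := D0.
Qed.

Lemma derive_pos_right (g : R -> R) (s : R) : 0 < s -> g 0 = 0 ->
  is_derive (0 : R) 1 g s -> exists2 d : R, 0 < d & forall a, 0 < a < d -> 0 < g a.
Proof.
move=> s0 g0 [dg Dg].
have /cvgr_gt/(_ _ s0) : (h^-1 *: (g (h *: 1 + 0) - g 0)) @[h --> (0 : R)^'] --> s.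
  by rewrite -Dg; exact: dg.
rewrite g0 => /nbhs_ballP[d /= d0 dpos]; clear dg Dg; exists d => // a /andP[a0 ad].
have aball : ball (0 : R) d a by rewrite -ball_normE /ball_/= sub0r normrN gtr0_norm.
have := dpos a aball (lt0r_neq0 a0).
rewrite subr0 addr0 -[a *: 1]/(a * 1) mulr1 -[X in 0 < X -> _]/(a^-1 * g a).
by rewrite pmulr_rgt0 ?invr_gt0.
Qed.

(** A positive second derivative would make D_v f positive just beyond [u], since it vanishes at
    [u]; the mean value theorem would then give a value of [f] above the maximum. *)
Lemma derive2_at_max v : differentiable (fun x => 'D_v f x) u ->
  'D_v (fun x => 'D_v f x) u <= 0.
Proof.
move=> ddf; rewrite leNgt; apply/negP => s0.
set s := 'D_v (fun x => 'D_v f x) u in s0.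
have [t t0 tU] := open_line_in v.
have [d d0 dpos] : exists2 d : R, 0 < d & forall a, 0 < a < d -> 0 < 'D_v f (u + a *: v).
  apply: (@derive_pos_right (fun a => 'D_v f (u + a *: v)) s s0).
    by rewrite scale0r addr0 derive_at_max.
  have := @is_derive_line _ _ _ (fun x => 'D_v f x) u v 0.
  by rewrite scale0r addr0 => /(_ ddf).
have [t' [t'0 t't t'd]] : exists t' : R, [/\ 0 < t', t' <= t & t' < d].
  exact: exists_small t0 d0.
have inU b : 0 <= b -> b <= t' -> U (u + b *: v).
  by move=> b0 b1; apply: tU; rewrite ger0_norm// (le_trans b1).
have [a /andP[a0 a1]|a /andP[a0 a1] E] := @MVT_line _ _ f u v t' t'0.
  by apply: df; exact: inU.
have Dpos : 0 < 'D_v f (u + a *: v) by apply: dpos; rewrite a0 (lt_trans a1).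
have := u_max (inU t' (ltW t'0) (lexx _)); rewrite -subr_le0 E leNgt => /negP; apply.
exact: mulr_gt0.
Qed.

(** Writing the coefficients as [E^T *m E] turns the operator into a sum of pure second derivatives
    along the vectors \sum_i E a i *: eps i. *)
Lemma hessian_at_max n (E : 'M[R]_n) (eps : 'I_n -> V) :
  (forall i, differentiable (fun x => 'D_(eps i) f x) u) ->
  \sum_i \sum_j (E^T *m E) i j * 'D_(eps j) (fun x => 'D_(eps i) f x) u <= 0.
Proof.
move=> ddf.
have DE a x : U x -> 'D_(\sum_i E a i *: eps i) f x = \sum_i E a i *: 'D_(eps i) f x.
  by move=> Ux; rewrite derive_sum_dir//; exact: df.
have dDE a : is_derive u (\sum_i E a i *: eps i) (fun x => \sum_i E a i *: 'D_(eps i) f x)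
    (\sum_i E a i *: \sum_j E a j *: 'D_(eps j) (fun x => 'D_(eps i) f x) u).
  apply: is_derive_bigsum => i; apply: is_derive_scal.
  by rewrite -derive_sum_dir//; exact: is_derive_diff.
have -> : \sum_i \sum_j (E^T *m E) i j * 'D_(eps j) (fun x => 'D_(eps i) f x) u =
   \sum_a 'D_(\sum_i E a i *: eps i) (fun x => 'D_(\sum_i E a i *: eps i) f x) u.
  transitivity (\sum_i \sum_j \sum_a E a i * (E a j * 'D_(eps j) (fun x => 'D_(eps i) f
    x) u)).
    apply: eq_bigr => i _; apply: eq_bigr => j _; rewrite mxE mulr_suml.
    by apply: eq_bigr => a _; rewrite mxE mulrA.
  under eq_bigr do rewrite exchange_big/=; rewrite exchange_big/=; apply: eq_bigr => a _.
  rewrite (derive_near _ oU Uu (DE a)); have [_ ->] := dDE a.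
  by apply: eq_bigr => i _; rewrite -mulr_sumr.
apply: sumr_le0 => a _; apply: derive2_at_max.
apply: near_eq_differentiable oU Uu (DE a) _.
by apply: differentiable_bigsum => i; exact: differentiableZ.
Qed.

End MaximumTest.

(** * Second-order operators and quadratic barriers *)

Section StrongMaximum.
Variables (R : realType) (n : nat).
Notation vec := 'rV[R]_n.
Implicit Types (U : set vec) (f g : vec -> R) (x y z v w : vec).

(** The norm of row vectors is the sup norm, whose balls have corners; Hopf's argument needs round
    balls. The two are compared by [norm_le_dot] and [dot_le_norm]. *)
Definition dot x y : R := (x *m y^T) 0 0.

Lemma dotE x y : dot x y = \sum_i x 0 i * y 0 i.
Proof. by rewrite /dot mxE; apply: eq_bigr => i _; rewrite mxE. Qed.

Lemma dotC x y : dot x y = dot y x.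
Proof. by rewrite !dotE; apply: eq_bigr => i _; rewrite mulrC. Qed.

Lemma dotDr x y z : dot x (y + z) = dot x y + dot x z.
Proof. by rewrite /dot linearD mulmxDr mxE. Qed.

Lemma dot_ge0 x : 0 <= dot x x. Proof. exact: sqnorm_ge0. Qed.

Lemma dot_eq0 x : dot x x = 0 -> x = 0. Proof. exact: sqnorm_eq0. Qed.

Lemma norm_le_dot x : `|x| ^+ 2 <= dot x x.
Proof.
have [->|x0] := eqVneq x 0; first by rewrite normr0 expr0n/= dot_ge0.
have /mx_norm_neq0[[i j]] : mx_norm x != 0 by apply: contra x0 => /eqP/mx_norm_eq0->.
rewrite -[mx_norm x]/`|x| => -> /=; rewrite ord1 dotE (bigD1 j)//=.
by rewrite -expr2 real_normK ?num_real// lerDl sumr_ge0// => k _; rewrite -expr2 sqr_ge0.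
Qed.

Lemma is_derive_dot z y x v : is_derive x v (fun x => dot z (x - y)) (dot z v).
Proof.
rewrite /dot; apply: is_derive_entry.
have Dl : is_derive x v (fun x => (x - y)^T) v^T.
  apply: is_derive_mx => i j; rewrite mxE; under eq_fun do rewrite mxE.
  apply: is_derive_entry; rewrite -[X in is_derive _ _ _ X]subr0.
  exact: (is_derive_sub (is_derive_id x v) (is_derive_const y x v)).
have := is_derive_mulmx (is_derive_const z x v) Dl; by rewrite mul0mx add0r.
Qed.

Lemma differentiable_dot z y x : differentiable (fun x => dot z (x - y)) x.
Proof.
have -> : (fun x => dot z (x - y)) = fun x => \sum_i z 0 i * (x - y) 0 i.
  by apply/funext => t; rewrite dotE.
apply: differentiable_bigsum => i; apply: differentiableM; first exact: differentiable_cst.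
by apply: differentiable_entry; apply: differentiableD; [|exact: differentiable_cst].
Qed.

Lemma dot_delta i x : dot (delta_mx 0 i) x = x 0 i.
Proof. by rewrite /dot -rowE !mxE. Qed.

Lemma dot_sqE y x : dot (x - y) (x - y) = \sum_i dot (delta_mx 0 i) (x - y) ^+ 2.
Proof.
rewrite dotE; apply: eq_bigr => i _; rewrite -expr2; congr (_ ^+ 2).
by rewrite dot_delta.
Qed.

Lemma is_derive_dot_sq y x v :
  is_derive x v (fun x => dot (x - y) (x - y)) (2 * dot v (x - y)).
Proof.
rewrite (_ : (fun x => _) = fun x => \sum_i dot (delta_mx 0 i) (x - y) * dot (delta_mx 0
  i) (x - y)); last first.
  by apply/funext => t; rewrite dot_sqE; apply: eq_bigr => i _; rewrite expr2.
rewrite dotE mulr_sumr; apply: is_derive_bigsum => i.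
have := is_derive_prod (is_derive_dot (delta_mx 0 i) y x v) (is_derive_dot (delta_mx 0 i)
  y x v).
by congr is_derive; rewrite !dot_delta; ring.
Qed.

Lemma differentiable_dot_sq y x : differentiable (fun x => dot (x - y) (x - y)) x.
Proof.
rewrite (_ : (fun x => _) = fun x => \sum_i dot (delta_mx 0 i) (x - y) * dot (delta_mx 0
  i) (x - y)); last first.
  by apply/funext => t; rewrite dot_sqE; apply: eq_bigr => i _; rewrite expr2.
apply: differentiable_bigsum => i.
by apply: differentiableM; exact: differentiable_dot.
Qed.

Lemma continuous_dot z y : continuous (fun x => dot z (x - y)).
Proof. by move=> x; exact/differentiable_continuous/differentiable_dot. Qed.

(* A quadratic barrier at a contact point y: with z pointing from the centre x0
   to y, it is negative near y outside the open Euclidean ball around x0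
   through y (barrier_geometry), while for K large the second-order operator
   is positive on it at y (barrier_positive). *)
Definition barrier z y (K : R) x : R :=
  4 * K * (dot z (x - y) * dot z (x - y)) - 2 * dot z (x - y) - 2 * dot (x - y) (x - y).

Lemma is_derive_barrier z y K x v : is_derive x v (barrier z y K)
  (8 * K * dot z v * dot z (x - y) - 2 * dot z v - 4 * dot v (x - y)).
Proof.
have D1 := is_derive_dot z y x v; have D2 := is_derive_dot_sq y x v.
have := is_derive_sub (is_derive_sub (is_derive_scal (4 * K) (is_derive_prod D1 D1))
  (is_derive_scal 2 D1)) (is_derive_scal 2 D2).
by congr is_derive; rewrite /GRing.scale/=; ring.
Qed.

Lemma differentiable_barrier z y K x : differentiable (barrier z y K) x.
Proof.
have d1 := differentiable_dot z y x.
have d2 := differentiable_dot_sq y x.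
have c1 (c : R) : differentiable (fun _ : vec => c) x := differentiable_cst c x.
apply: differentiableB; first apply: differentiableB.
- by apply: differentiableM => //; apply: differentiableM.
- by apply: differentiableM.
- by apply: differentiableM.
Qed.

Lemma derive_barrier z y K v : (fun x => 'D_v (barrier z y K) x) =
  fun x => 8 * K * dot z v * dot z (x - y) - 2 * dot z v - 4 * dot v (x - y).
Proof. by apply/funext => x; have [_ ->] := is_derive_barrier z y K x v. Qed.

Lemma is_derive2_barrier z y K x v w :
  is_derive x w (fun x => 'D_v (barrier z y K) x)
    (8 * K * dot z v * dot z w - 4 * dot v w).
Proof.
rewrite derive_barrier.
have := is_derive_sub (is_derive_sub (is_derive_scal (8 * K * dot z v) (is_derive_dot z y
  x w))
  (is_derive_const (2 * dot z v) x w)) (is_derive_scal 4 (is_derive_dot v y x w)).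
by congr is_derive; rewrite /GRing.scale/= subr0.
Qed.

Lemma differentiable_derive_barrier z y K x v :
  differentiable (fun x => 'D_v (barrier z y K) x) x.
Proof.
rewrite derive_barrier.
have c1 (c : R) : differentiable (fun _ : vec => c) x := differentiable_cst c x.
have d1 z' := differentiable_dot z' y x.
apply: differentiableB; last by apply: differentiableM.
apply: differentiableB; last exact: c1.
by apply: differentiableM; [exact: c1|exact: d1].
Qed.

Definition twice_diff U f : Prop :=
  (forall x, U x -> differentiable f x) /\
  (forall v x, U x -> differentiable (fun y => 'D_v f y) x).

Variables (a : vec -> 'M[R]_n) (b : vec -> vec).

Definition second_order f x : R :=
  \sum_i \sum_j a x i j * 'D_(delta_mx 0 j) (fun y => 'D_(delta_mx 0 i) f y) x
  + \sum_i b x 0 i * 'D_(delta_mx 0 i) f x.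

Lemma twice_diff_perturb U f g (e : R) : open U -> twice_diff U f -> twice_diff U g ->
  twice_diff U (fun x => f x + e * g x) /\
  forall x, U x -> second_order (fun x => f x + e * g x) x =
    second_order f x + e * second_order g x.
Proof.
move=> oU [df ddf] [dg ddg].
have D v x : U x -> 'D_v (fun x => f x + e * g x) x = 'D_v f x + e * 'D_v g x.
  move=> Ux; have Df := is_derive_diff v (df x Ux); have Dg := is_derive_diff v (dg x Ux).
  by have [_ ->] := is_derive_add Df (is_derive_scal e Dg).
split; first split.
- move=> x Ux; apply: differentiableD; first exact: df.
  by apply: differentiableM; [exact: differentiable_cst|exact: dg].
- move=> v x Ux; apply: (near_eq_differentiable oU Ux (D v)).
  apply: differentiableD; first exact: (ddf v x Ux).
  by apply: differentiableM; [exact: differentiable_cst|exact: (ddg v x Ux)].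
move=> x Ux; rewrite /second_order mulrDr addrACA; congr (_ + _).
  rewrite mulr_sumr -big_split/=; apply: eq_bigr => i _.
  rewrite mulr_sumr -big_split/=; apply: eq_bigr => j _.
  rewrite (derive_near _ oU Ux (D (delta_mx 0 i))).
  have Df := is_derive_diff (delta_mx 0 j) (ddf (delta_mx 0 i) x Ux).
  have Dg := is_derive_diff (delta_mx 0 j) (ddg (delta_mx 0 i) x Ux).
  have [_ ->] := is_derive_add Df (is_derive_scal e Dg).
  by rewrite mulrDr mulrCA.
rewrite mulr_sumr -big_split/=; apply: eq_bigr => i _.
by rewrite D// mulrDr mulrCA.
Qed.

Lemma second_order_at_max U f x : open U -> U x -> posdef (a x) -> twice_diff U f ->
  (forall y, U y -> f y <= f x) -> second_order f x <= 0.
Proof.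
move=> oU Ux pa [df ddf] fmax.
have [E E1] := cholesky_pt pa; have [Ea aE] := frame_inv pa.1 E1.
rewrite /second_order [X in _ + X]big1 ?addr0; last first.
  by move=> i _; rewrite (derive_at_max oU Ux df fmax) mulr0.
(* [hessian_at_max] wants a factorisation of [a x], while Cholesky provides one of its inverse, E^T
   E; multiplying by [a x] on both sides converts it. *)
have -> : a x = (E *m a x)^T *m (E *m a x).
  by rewrite trmx_mul pa.1 mulmxA -(mulmxA (a x)) aE mul1mx.
by apply: (hessian_at_max oU Ux df fmax) => i; exact: ddf.
Qed.

End StrongMaximum.

(** * Hopf's argument and the strong maximum principle *)

Section StrongMaximumPrinciple.
Variables (R : realType) (n : nat).
Notation vec := 'rV[R]_n.

Lemma closed_ball_compact (c : vec) (s : R) : compact [set x : vec | `|x - c| <= s].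
Proof.
apply: bounded_closed_compact.
  exists (s + `|c|); split; first exact: num_real.
  move=> M sM x /= xs; rewrite (le_trans _ (ltW sM))//.
  by rewrite -[x in leLHS](subrK c) (le_trans (ler_normD _ _))// lerD2r.
apply: (@preimage_closed _ _ (fun x : vec => `|x - c|) [set t | t <= s]);
  last exact: closed_le.
move=> x _; apply: continuous_comp; last exact: norm_continuous.
by apply: continuousB; [exact: cvg_id|exact: cst_continuous].
Qed.

Lemma open_norm_ball (c : vec) (s : R) : open [set x : vec | `|x - c| < s].
Proof.
have -> : [set x : vec | `|x - c| < s] = ball c s.
  by apply/seteqP; split=> x; rewrite -ball_normE /ball_/= distrC.
exact: ball_open.
Qed.

Lemma nbhs_norm_ball (c : vec) (A : set vec) : nbhs c A ->
  exists2 s : R, 0 < s & forall x, `|x - c| <= s -> A x.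
Proof.
move=> /nbhs_ballP[r /= r0 rA]; exists (r / 2); first by rewrite divr_gt0.
move=> x xr; apply: rA; rewrite -ball_normE /ball_/= distrC (le_lt_trans xr)//.
by rewrite ltr_pdivrMr// ltr_pMr// ltr1n.
Qed.

Lemma continuous_for_sum (T : topologicalType) k (F : 'I_k -> T -> R) (x : T) :
  (forall i, {for x, continuous (F i)}) -> {for x, continuous (fun y => \sum_i F i y)}.
Proof.
move=> cF; rewrite (_ : (fun y => _) = \sum_i F i); last first.
  by apply/funext => y; rewrite fct_sumE.
elim/big_ind: _ => [|g h cg ch|i _]; [exact: cst_continuous|exact: continuousD|exact: cF].
Qed.

Lemma dot_le_norm (x : vec) : dot x x <= n%:R * `|x| ^+ 2.
Proof.
rewrite dotE -[n in n%:R]card_ord -sum1_card natr_sum mulr_suml; apply: ler_sum => i _.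
rewrite mul1r -expr2 -[leLHS]real_normK ?num_real// ler_pXn2r ?nnegrE//.
rewrite [leRHS]/Num.Def.normr/= mx_normrE.
exact: (le_bigmax _ (fun ij : 'I_1 * 'I_n => `|x ij.1 ij.2|) (0, i)).
Qed.

Lemma dot_addsq (x y : vec) : dot (x + y) (x + y) = dot x x + 2 * dot x y + dot y y.
Proof. by rewrite dotDr !(dotC (x + y) _) !dotDr (dotC y x); ring. Qed.

(** Put w = x - y0, t = <z, w>, N = |w|^2, so that the barrier is 4 K t^2 - 2 t - 2 N with |4 K t| <
    1. If t >= 0 it is at most -t - 2 N < 0. Hence t < 0, and then N <= (3/2) |t|, so |z + w|^2 =
    |z|^2 + 2 t + N < |z|^2. *)
Lemma barrier_geometry (x x0 y0 : vec) (K : R) (z := y0 - x0) : x != y0 ->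
  `|4 * K * dot z (x - y0)| < 1 -> 0 <= barrier z y0 K x ->
  dot (x - x0) (x - x0) < dot z z.
Proof.
move=> xy0; rewrite /barrier; set w := x - y0.
have -> : x - x0 = z + w by rewrite /z /w [RHS]addrC subrKA.
have N0 : 0 < dot w w.
  rewrite lt_neqAle dot_ge0 andbT eq_sym; apply: contra xy0 => /eqP/dot_eq0/eqP.
  by rewrite subr_eq0.
rewrite dot_addsq.
set t := dot z w; set N := dot w w in N0 *; set zz := dot z z.
rewrite ltr_norml => /andP[Kt1 Kt2] bar0.
have tneg : t < 0.
  rewrite ltNge; apply/negP => t0.
  have : t * (4 * K * t) <= t * 1 by rewrite ler_wpM2l// ltW.
  lra.
have : (- t) * (- (4 * K * t)) <= (- t) * 1 by rewrite ler_wpM2l//; lra.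
lra.
Qed.

Variables (U : set vec) (f : vec -> R) (m : R) (a : vec -> 'M[R]_n) (b : vec -> vec).
Hypotheses (oU : open U) (tdf : twice_diff U f).
Hypotheses (pos_a : forall x, U x -> posdef (a x)).
Hypotheses (cont_a : forall x, U x -> {for x, continuous a}).
Hypotheses (cont_b : forall x, U x -> {for x, continuous b}).
Hypotheses (f_sub : forall x, U x -> 0 <= second_order a b f x).
Hypotheses (f_le : forall x, U x -> f x <= m).

Lemma second_order_barrier z y0 K x : second_order a b (barrier z y0 K) x =
  \sum_i \sum_j a x i j * (8 * K * z 0 i * z 0 j - 4 * (i == j)%:R)
  + \sum_i b x 0 i * (8 * K * z 0 i * dot z (x - y0) - 2 * z 0 i - 4 * (x - y0) 0 i).
Proof.
rewrite /second_order; congr (_ + _).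
  apply: eq_bigr => i _; apply: eq_bigr => j _; congr (_ * _).
  have [_ ->] := is_derive2_barrier z y0 K x (delta_mx 0 i) (delta_mx 0 j).
  by rewrite !(dotC z) !dot_delta mxE eqxx/= eq_sym.
apply: eq_bigr => i _; congr (_ * _).
have [_ ->] := is_derive_barrier z y0 K x (delta_mx 0 i).
by rewrite (dotC z (delta_mx _ _)) !dot_delta.
Qed.

Lemma barrier_positive z y0 : U y0 -> z != 0 ->
  exists2 K : R, 0 < K & \forall x \near y0, 0 < second_order a b (barrier z y0 K) x.
Proof.
move=> Uy0 z0; pose zaz := (z *m a y0 *m z^T) 0 0.
have zaz0 : 0 < zaz by exact: (pos_a Uy0).2.
pose c := 4 * \tr (a y0) + 2 * dot (b y0) z.
(* At [y0] the operator takes the value 8 K zaz - c on the barrier, and this [K] makes 8 K zaz equal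
   to |c| + 1. Continuity of the coefficients then gives a neighbourhood. *)
exists ((`|c| + 1) / (8 * zaz)); first by rewrite divr_gt0// ?mulr_gt0// ltr_wpDl.
set K := _ / _.
have SE : second_order a b (barrier z y0 K) y0 = 8 * K * zaz - c.
  rewrite second_order_barrier subrr.
  have -> : \sum_i \sum_j a y0 i j * (8 * K * z 0 i * z 0 j - 4 * (i == j)%:R)
      = 8 * K * zaz - 4 * \tr (a y0).
    rewrite /zaz /mxtrace !mulr_sumr [in X in X - _]mxE.
    have -> : 8 * K * (\sum_j (z *m a y0) 0 j * z^T j 0) = \sum_i \sum_j a y0 i j * (8 *
      K * z 0 i * z 0 j).
      rewrite exchange_big mulr_sumr/=; apply: eq_bigr => j _.
      rewrite !mxE mulr_suml mulr_sumr; apply: eq_bigr => i _; ring.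
    rewrite -sumrB; apply: eq_bigr => i _.
    under eq_bigr do rewrite mulrBr.
    rewrite sumrB; congr (_ - _); rewrite (bigD1 i)//= eqxx mulr1 big1 ?addr0 1?mulrC//.
    by move=> j ji; rewrite eq_sym (negbTE ji) !mulr0.
  have -> : \sum_i b y0 0 i * (8 * K * z 0 i * dot z 0 - 2 * z 0 i - 4 * (0 : vec) 0 i) =
    - (2 * dot (b y0) z).
    rewrite (dotE (b y0)) mulr_sumr -sumrN; apply: eq_bigr => i _.
    by rewrite /dot trmx0 mulmx0 !mxE; ring.
  by rewrite /c; ring.
have S0 : 0 < second_order a b (barrier z y0 K) y0.
  rewrite SE.
  have -> : 8 * K * zaz = `|c| + 1 by rewrite /K; field; rewrite gt_eqF.
  by rewrite subr_gt0 (le_lt_trans (ler_norm c))// ltrDl.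
have cS : {for y0, continuous (second_order a b (barrier z y0 K))}.
  rewrite (_ : second_order a b (barrier z y0 K) = fun x =>
    \sum_i \sum_j a x i j * (8 * K * z 0 i * z 0 j - 4 * (i == j)%:R)
    + \sum_i b x 0 i * (8 * K * z 0 i * dot z (x - y0) - 2 * z 0 i - 4 * (x - y0) 0 i));
      last first.
    by apply/funext => x; rewrite second_order_barrier.
  have cent p q (M : vec -> 'M[R]_(p, q)) i j : {for y0, continuous M} ->
      {for y0, continuous (fun x => M x i j)}.
    move=> cM; apply: (@continuous_comp _ _ _ M (fun N : 'M[R]_(p, q) => N i j)) => //.
    exact: coord_continuous.
  have ccst (k : R) : {for y0, continuous (fun _ : vec => k)} by exact: cst_continuous.
  apply: continuousD.
    apply: continuous_for_sum => i; apply: continuous_for_sum => j.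
    by apply: continuousM; [exact/cent/cont_a|exact: ccst].
  apply: continuous_for_sum => i; apply: continuousM; first exact/cent/cont_b.
  apply: continuousB; first apply: continuousB.
  - by apply: continuousM; [exact: ccst|exact: continuous_dot].
  - exact: ccst.
  - apply: continuousM; first exact: ccst.
    by apply: cent; apply: continuousB; [exact: cvg_id|exact: cst_continuous].
exact: (cvgr_gt _ cS).
Qed.

(* Hopf's argument localised at a contact point y0: if f < m on the open
   Euclidean ball around x0 through y0, then perturbing f by a small multiple
   of the barrier produces an interior maximum contradicting f_sub. *)
Lemma no_contact_ball (x0 y0 : vec) : U y0 -> f y0 = m -> y0 - x0 != 0 ->
  (forall x, dot (x - x0) (x - x0) < dot (y0 - x0) (y0 - x0) -> f x < m) -> False.
Proof.
move=> Uy0 fy0 z0 inside; set z := y0 - x0 in z0.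
have [K K0 nS] := barrier_positive Uy0 z0.
have nU : \forall x \near y0, U x by exact: open_nbhs_nbhs.
have nK : \forall x \near y0, `|4 * K * dot z (x - y0)| < 1.
  have cK : {for y0, continuous (fun x : vec => `|4 * K * dot z (x - y0)|)}.
    apply: continuous_comp; last exact: norm_continuous.
    by apply: continuousM; [exact: cst_continuous|exact: continuous_dot].
  apply: (cvgr_lt _ cK); by rewrite subrr /dot trmx0 mulmx0 mxE mulr0 normr0 ltr01.
have [s s0 sP] := nbhs_norm_ball (filterI nU (filterI nS nK)).
pose Bs := [set x : vec | `|x - y0| <= s].
have Bs0 : Bs !=set0 by exists y0; rewrite /Bs/= subrr normr0 ltW.
have cBs : compact Bs := @closed_ball_compact y0 s.
have cbar x : {for x, continuous (barrier z y0 K)}.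
  exact/differentiable_continuous/differentiable_barrier.
have cf x : U x -> {for x, continuous f} by move=> Ux;
  exact/differentiable_continuous/tdf.1.
have [e [e0 eS]] : exists e : R, 0 < e /\ forall x,
  `|x - y0| = s -> f x + e * barrier z y0 K x < m.
  (* Only the part of the sphere where the barrier is nonnegative matters: there [barrier_geometry]
     places [x] inside the round ball, so f < m, with a gap by compactness. Elsewhere any positive
     [e] works. *)
  pose T := [set x : vec | `|x - y0| = s /\ 0 <= barrier z y0 K x].
  have TB x : T x -> Bs x by move=> [xs _]; rewrite /Bs/= xs.
  have Tlt x : T x -> f x < m.
    move=> Tx; have [_ [_ Kx]] := sP x (TB x Tx).
    apply: inside; apply: barrier_geometry Kx Tx.2.
    by apply/eqP => xy; move: Tx.1; rewrite xy subrr normr0 => s00; rewrite -s00 ltxx in s0.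
  have off x (e : R) : 0 < e -> `|x - y0| = s -> ~ T x -> f x + e * barrier z y0 K x < m.
    move=> e0 xs nT; have xle : `|x - y0| <= s by rewrite xs.
    have [Ux _] := sP x xle.
    have : barrier z y0 K x < 0 by rewrite ltNge; apply/negP => b0; exact: nT.
    move=> bneg; rewrite -[m]addr0 ler_ltD ?f_le// pmulr_rlt0//.
  have [T0|/set0P T0] := eqVneq T set0.
    exists 1; split=> // x xs; apply: off => //; by rewrite T0.
  have cT : compact T.
    apply: (@subclosed_compact _ T Bs) => //.
    have -> : T = (fun x : vec => `|x - y0|) @^-1` [set s] `&` (barrier z y0 K) @^-1`
      [set t | 0 <= t].
      by apply/seteqP; split.
    apply: closedI; apply: preimage_closed.
    - move=> x _; apply: continuous_comp; last exact: norm_continuous.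
      by apply: continuousB; [exact: cvg_id|exact: cst_continuous].
    - exact: closed_eq.
    - by move=> x _; exact: cbar.
    - exact: closed_ge.
  have [xm Txm xmP] : exists2 c, c \in T & forall t, t \in T -> f t <= f c.
    apply: compact_EVT_max => //; apply: continuous_in_subspaceT => x /set_mem Tx.
    by apply: cf; have [] := sP x (TB x Tx).
  have [xb Bxb xbP] : exists2 c, c \in Bs & forall t,
    t \in Bs -> barrier z y0 K t <= barrier z y0 K c.
    by apply: compact_EVT_max => //; apply: continuous_in_subspaceT => x _; exact: cbar.
  have fm : f xm < m by apply: Tlt; exact: set_mem.
  set vb := barrier z y0 K xb in xbP.
  have vb0 : 0 <= vb.
    have /xbP : xm \in Bs by apply/mem_set/TB/set_mem.
    by apply: le_trans; have [] := set_mem Txm.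
  have vb1 : 0 < vb + 1 by rewrite ltr_wpDl.
  (* The gap below [m] is m - f xm and [vb] bounds the barrier, so this [e] adds strictly less than
     the gap; the summand 1 keeps the quotient meaningful when vb = 0. *)
  have e0 : 0 < (m - f xm) / (vb + 1) by rewrite divr_gt0// subr_gt0.
  exists ((m - f xm) / (vb + 1)); split=> // x xs.
  have [Tx|nT] := pselect (T x); last exact: off.
  have h1 : f x <= f xm by apply: xmP; exact: mem_set.
  have h2 : barrier z y0 K x <= vb by apply/xbP/mem_set/TB.
  have h3 : (m - f xm) / (vb + 1) * barrier z y0 K x <= (m - f xm) / (vb + 1) * vb.
    by rewrite ler_wpM2l// ltW.
  have h4 : (m - f xm) / (vb + 1) * (vb + 1) = m - f xm by rewrite divfK// gt_eqF.
  rewrite mulrDr mulr1 in h4.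
  apply: le_lt_trans (lerD h1 h3) _; lra.
have U0 : [set x : vec | `|x - y0| < s] `<=` U by move=> x /ltW /sP[].
have oW := @open_norm_ball y0 s.
set W := [set x : vec | `|x - y0| < s] in U0 oW.
have tW : twice_diff W f by split=> [x /U0|v x /U0]; [exact: tdf.1|exact: tdf.2].
have tb : twice_diff W (barrier z y0 K).
  by split=> [x _|v x _]; [exact: differentiable_barrier|exact:
    differentiable_derive_barrier].
have [tg Lg] := @twice_diff_perturb _ _ a b W f (barrier z y0 K) e oW tW tb.
have [xs Bxs xsP] : exists2 c, c \in Bs & forall t, t \in Bs ->
    f t + e * barrier z y0 K t <= f c + e * barrier z y0 K c.
  apply: (@compact_EVT_max _ _ (fun x => f x + e * barrier z y0 K x)) => //.
  apply: continuous_in_subspaceT => x /set_mem Bx.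
  have cfx : {for x, continuous f} by apply: cf; have [] := sP x Bx.
  have cbx : {for x, continuous (fun x => e * barrier z y0 K x)}.
    by apply: continuousM; [exact: cst_continuous|exact: cbar].
  exact: (continuousD cfx cbx).
have b0 : barrier z y0 K y0 = 0.
  by rewrite /barrier subrr /dot trmx0 !mulmx0 mxE; ring.
have gm : m <= f xs + e * barrier z y0 K xs.
  have -> : m = f y0 + e * barrier z y0 K y0 by rewrite b0 mulr0 addr0 fy0.
  by apply/xsP/mem_set; rewrite /Bs/= subrr normr0 ltW.
have Wxs : W xs.
  rewrite /W/= lt_neqAle (set_mem Bxs) andbT; apply/eqP => xss.
  by have := lt_le_trans (eS _ xss) gm; rewrite ltxx.
have [Ux [Sx _]] := sP xs (ltW Wxs).
have : second_order a b (fun x => f x + e * barrier z y0 K x) xs <= 0.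
  apply: (@second_order_at_max _ _ a b W _ xs oW Wxs (pos_a Ux) tg) => x Wx.
  by apply/xsP/mem_set; exact: ltW.
by rewrite leNgt Lg// ltr_wpDl ?f_sub// mulr_gt0.
Qed.

(** Otherwise some [x0] very close to [y] has value different from [m]. A point [y0] of the level
    set nearest to [x0] in the Euclidean distance is then a contact point of a ball on which f < m,
    which [no_contact_ball] excludes. *)
Theorem strong_maximum y : U y -> f y = m -> \forall x \near y, f x = m.
Proof.
move=> Uy fy; apply: contrapT => nfm.
have [r r0 rU] : exists2 r : R, 0 < r & forall x, `|x - y| <= r -> U x.
  by apply: nbhs_norm_ball; exact: open_nbhs_nbhs.
have cf x : U x -> {for x, continuous f} by move=> Ux;
  exact/differentiable_continuous/tdf.1.
have nn : 0 <= n%:R :> R by exact: ler0n.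
have n1 : 0 < n%:R + 1 :> R by rewrite ltr_wpDl.
(* A sup distance below [d] gives a squared Euclidean distance at most n d^2 < (r / 2)^2, so the
   round ball around [x0] reaching [y] stays within sup distance [r] of [y], hence in [U]. *)
pose d := r / (2 * (n%:R + 1)).
have d0 : 0 < d by rewrite divr_gt0// mulr_gt0.
have [x0 x0d fx0] : exists2 x0, `|y - x0| < d & f x0 <> m.
  apply: contrapT => h; apply: nfm; apply/nbhs_ballP; exists d => // x xd.
  apply: contrapT => fx; apply: h; exists x => //.
  by move: xd; rewrite -ball_normE.
have dE : d * (2 * (n%:R + 1)) = r by rewrite /d divfK// gt_eqF// mulr_gt0.
have dr : d <= r / 2.
  by rewrite ler_pdivlMr// -[leRHS]dE ler_pM2l//; lra.
have Nyx : dot (y - x0) (y - x0) < (r / 2) ^+ 2.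
  apply: le_lt_trans (dot_le_norm _) _.
  have h : `|y - x0| ^+ 2 <= d ^+ 2 by rewrite ler_pXn2r ?nnegrE// ltW.
  apply: le_lt_trans (ler_wpM2l nn h) _.
  have -> : r / 2 = d * (n%:R + 1) by rewrite -dE; field.
  rewrite -subr_gt0 (_ : _ - _ = d ^+ 2 * (n%:R * n%:R + n%:R + 1)); last by ring.
  by rewrite mulr_gt0// ?exprn_gt0// ltr_wpDl// addr_ge0// mulr_ge0.
pose K := [set x : vec | `|x - y| <= r /\ f x = m].
have cK : compact K.
  apply: (@subclosed_compact _ K [set x | `|x - y| <= r]); last by move=> x [].
    move=> x clx; have xr : `|x - y| <= r.
      have cB : closed [set x : vec | `|x - y| <= r].
        apply: (@preimage_closed _ _ (fun x : vec => `|x - y|) [set t | t <= r]);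
          last exact: closed_le.
        move=> t _; apply: continuous_comp; last exact: norm_continuous.
        by apply: continuousB; [exact: cvg_id|exact: cst_continuous].
      by apply: cB; apply: closureS clx => t [].
    split=> //; apply: contrapT => fx.
    have : nbhs x [set t | f t <> m].
      have fxm : f x < m by rewrite lt_neqAle f_le ?andbT; [exact/eqP|exact: rU].
      apply: filterS (cvgr_lt _ (cf x (rU x xr)) _ fxm) => t ft fm.
      by rewrite fm ltxx in ft.
    by move=> /clx[t [[_ ft] nft]]; exact: nft.
  exact: closed_ball_compact.
have K0 : K !=set0 by exists y; split=> //; rewrite subrr normr0 ltW.
have [y0 /set_mem[y0r fy0] y0P] : exists2 c, c \in K & forall t, t \in K ->
    dot (c - x0) (c - x0) <= dot (t - x0) (t - x0).
  apply: (@compact_EVT_min vec R (fun x : vec => dot (x - x0) (x - x0)) K K0 cK).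
  apply: continuous_in_subspaceT => x _.
  exact/differentiable_continuous/differentiable_dot_sq.
have y0y : dot (y0 - x0) (y0 - x0) <= dot (y - x0) (y - x0).
  by apply/y0P/mem_set; split=> //; rewrite subrr normr0 ltW.
apply: (@no_contact_ball x0 y0) => //; first exact: rU.
  by apply/eqP => /eqP; rewrite subr_eq0 => /eqP yx; apply: fx0; rewrite -yx.
move=> x xin; have xr : `|x - y| <= r.
  have x2 : `|x - x0| ^+ 2 < (r / 2) ^+ 2.
    apply: le_lt_trans (norm_le_dot _) _; apply: lt_trans xin _.
    exact: le_lt_trans y0y Nyx.
  rewrite -(subrKA x0) (le_trans (ler_normD _ _))// [leRHS]splitr lerD//.
    by apply/ltW; move: x2; rewrite ltr_pXn2r ?nnegrE// divr_ge0// ltW.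
  by rewrite distrC ltW// (lt_le_trans x0d).
rewrite lt_neqAle f_le ?andbT; last exact: rU.
apply/eqP => fx; have /y0P : x \in K by exact: mem_set.
by rewrite leNgt xin.
Qed.

End StrongMaximumPrinciple.

(** * The transverse metric and connection of a foliated chart *)

Section SmoothOn.
Variables (R : realType) (V : normedModType R) (U : set V).
Hypothesis oU : open U.

Lemma smooth_differentiable (W : normedModType R) (f : V -> W) u :
  smooth_on U f -> U u -> differentiable f u.
Proof. by move=> sf; have [+ _] := sf 1%N; apply. Qed.

Lemma smooth_derive (W : normedModType R) (f : V -> W) v :
  smooth_on U f -> smooth_on U (fun x => 'D_v f x).
Proof. by move=> sf k; have [_] := sf k.+1; apply. Qed.

Lemma smooth_is_derive (W : normedModType R) (f : V -> W) u v :
  smooth_on U f -> U u -> is_derive u v f ('D_v f u).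
Proof. by move=> sf Uu; apply: is_derive_diff; exact: smooth_differentiable. Qed.

Lemma smooth_mxP m n (f : V -> 'M[R]_(m, n)) :
  smooth_on U f <-> forall i j, smooth_on U (fun u => f u i j).
Proof.
split=> [sf i j k|sf k]; first exact: (Ck_on_mxP k f oU).1.
by apply/(Ck_on_mxP k f oU) => i j; exact: sf.
Qed.

Lemma smooth_mulmx m n l (f : V -> 'M[R]_(m, n)) (g : V -> 'M[R]_(n, l)) :
  smooth_on U f -> smooth_on U g -> smooth_on U (fun u => f u *m g u).
Proof. by move=> sf sg k; exact: Ck_on_mulmx. Qed.

Lemma smooth_add (W : normedModType R) (f g : V -> W) :
  smooth_on U f -> smooth_on U g -> smooth_on U (fun u => f u + g u).
Proof. by move=> sf sg k; exact: Ck_onD. Qed.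

Lemma smooth_scale (W : normedModType R) (c : R) (f : V -> W) :
  smooth_on U f -> smooth_on U (fun u => c *: f u).
Proof. by move=> sf k; exact: Ck_onZ. Qed.

Lemma smooth_opp (W : normedModType R) (f : V -> W) :
  smooth_on U f -> smooth_on U (fun u => - f u).
Proof. by move=> sf; under eq_fun do rewrite -scaleN1r; exact: smooth_scale. Qed.

Lemma smooth_cst (W : normedModType R) (w : W) : smooth_on U (fun _ : V => w).
Proof. by move=> k; exact: Ck_on_cst. Qed.

Lemma smooth_eq (W : normedModType R) (f g : V -> W) :
  (forall u, U u -> f u = g u) -> smooth_on U g -> smooth_on U f.
Proof. by move=> fg sg k; exact: Ck_on_eq fg (sg k). Qed.

Lemma smooth_trmx m n (f : V -> 'M[R]_(m, n)) :
  smooth_on U f -> smooth_on U (fun u => (f u)^T).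
Proof.
move=> /smooth_mxP sf; apply/smooth_mxP => i j.
by under eq_fun do rewrite mxE; exact: sf.
Qed.

Lemma smooth_row_mx m n1 n2 (f : V -> 'M[R]_(m, n1)) (g : V -> 'M[R]_(m, n2)) :
  smooth_on U f -> smooth_on U g -> smooth_on U (fun u => row_mx (f u) (g u)).
Proof.
move=> /smooth_mxP sf /smooth_mxP sg; apply/smooth_mxP => i j.
case: (split_ordP j) => j' ->.
  by under eq_fun do rewrite row_mxEl; exact: sf.
by under eq_fun do rewrite row_mxEr; exact: sg.
Qed.

Lemma smooth_sum (W : normedModType R) n (f : 'I_n -> V -> W) :
  (forall i, smooth_on U (f i)) -> smooth_on U (fun u => \sum_i f i u).
Proof. by move=> sf k; apply: Ck_on_bigsum => // i; exact: sf. Qed.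

Lemma posdef_unit n (A : 'M[R]_n) : posdef A -> A \in unitmx.
Proof.
move=> pA; have [E E1] := cholesky_pt pA; have [_ /mulmx1_unit[]//] := frame_inv pA.1 E1.
Qed.

Lemma frame_invmx n (A E : 'M[R]_n) : posdef A -> E *m A *m E^T = 1%:M ->
  invmx A = E^T *m E.
Proof.
move=> pA E1; have [EA _] := frame_inv pA.1 E1.
by rewrite -[RHS](mulmxK (posdef_unit pA)) EA mul1mx.
Qed.

(** Smoothness is inherited from the Cholesky factor through A^-1 = E^T E, without determinants. *)
Lemma smooth_invmx n (A : V -> 'M[R]_n) : smooth_on U A ->
  (forall u, U u -> posdef (A u)) -> smooth_on U (fun u => invmx (A u)).
Proof.
move=> sA pA; have [E [sE E1 _]] := cholesky oU sA pA.
apply: (@smooth_eq _ _ (fun u => (E u)^T *m E u)).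
  by move=> u Uu; apply: frame_invmx; [exact: pA|exact: E1].
by apply: smooth_mulmx => //; exact: smooth_trmx.
Qed.

Lemma is_derive_trmx m n (f : V -> 'M[R]_(m, n)) df u v :
  is_derive u v f df -> is_derive u v (fun x => (f x)^T) df^T.
Proof.
move=> Df; apply: is_derive_mx => i j; rewrite mxE; under eq_fun do rewrite mxE.
exact: is_derive_entry.
Qed.

Lemma derive_invmx n (A : V -> 'M[R]_n) u v : smooth_on U A ->
  (forall u, U u -> posdef (A u)) -> U u ->
  'D_v (fun u => invmx (A u)) u = - (invmx (A u) *m 'D_v A u *m invmx (A u)).
Proof.
move=> sA pA Uu; have DA := smooth_is_derive v sA Uu.
have DI := smooth_is_derive v (smooth_invmx sA pA) Uu.
have [_] := is_derive_mulmx DI DA.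
rewrite (derive_near (g := fun=> 1%:M) v oU Uu); last first.
  by move=> x Ux; rewrite mulVmx// posdef_unit//; exact: pA.
rewrite derive_cst => /eqP; rewrite eq_sym addr_eq0 => /eqP E.
by rewrite -[LHS](mulmxK (posdef_unit (pA u Uu))) E mulNmx.
Qed.

End SmoothOn.

(** * Koszul's formula and the Christoffel matrices of a basic metric *)

Lemma koszul_compat (F : fieldType) q (D : 'I_q -> 'M[F]_q) (i : 'I_q) :
  2 != 0 :> F -> (forall k i j, D k i j = D k j i) ->
  2^-1 *: (\matrix_(j, k) (D i j k + D j i k - D k i j)) +
  (2^-1 *: (\matrix_(j, k) (D i j k + D j i k - D k i j)))^T = D i.
Proof.
move=> two0 symD; apply/matrixP => j k; rewrite !mxE (symD i k j).
by rewrite -mulrDr; field.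
Qed.

Lemma koszul_sym (F : fieldType) q (D : 'I_q -> 'M[F]_q) (i j : 'I_q) :
  (forall k i j, D k i j = D k j i) ->
  row j (\matrix_(j, k) (D i j k + D j i k - D k i j)) =
  row i (\matrix_(i, k) (D j i k + D i j k - D k j i)).
Proof.
move=> symD; apply/rowP => k; rewrite !mxE (symD k i j).
by congr (_ - _); exact: addrC.
Qed.

Section TransverseConnection.
Variables (R : realType) (p q : nat).
Notation vec := ('rV[R]_(p + q)).
Variables (U : set vec) (h : vec -> 'M[R]_q).
Hypotheses (oU : open U) (sh : smooth_on U h) (ph : forall u, U u -> posdef (h u)).
Hypothesis h_basic : forall u l, U u -> tangL l -> 'D_l h u = 0.

Definition eps (i : 'I_q) : vec := delta_mx 0 (rshift p i).

Definition koszul (i : 'I_q) u : 'M[R]_q := \matrix_(j, k)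
  ('D_(eps i) h u j k + 'D_(eps j) h u i k - 'D_(eps k) h u i j).

(** Row [j] holds the components of the covariant derivative of the j-th coordinate vector along the
    i-th one; [koszul] is twice the Christoffel symbol with lowered index. *)
Definition gam (i : 'I_q) u : 'M[R]_q := 2^-1 *: (koszul i u *m invmx (h u)).

Lemma posdef_field_sym u : U u -> (h u)^T = h u. Proof. by move/ph => []. Qed.

Lemma Dh_sym u v i j : U u -> 'D_v h u i j = 'D_v h u j i.
Proof.
move=> Uu; have D := is_derive_trmx (smooth_is_derive v sh Uu).
have : 'D_v h u = ('D_v h u)^T.
  by have [_ <-] := D; apply: (derive_near _ oU Uu) => x Ux; rewrite posdef_field_sym.
by move/matrixP/(_ i j); rewrite [RHS]mxE.
Qed.

Lemma gam_h u i : U u -> gam i u *m h u = 2^-1 *: koszul i u.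
Proof. by move=> Uu; rewrite -scalemxAl mulmxKV// posdef_unit//; exact: ph. Qed.

Lemma gam_compat u i : U u ->
  'D_(eps i) h u = gam i u *m h u + h u *m (gam i u)^T.
Proof.
move=> Uu; have -> : h u *m (gam i u)^T = (gam i u *m h u)^T by rewrite trmx_mul
  posdef_field_sym.
rewrite gam_h//; apply/esym; apply: (@koszul_compat _ _ (fun i => 'D_(eps i) h u)).
  by rewrite pnatr_eq0.
by move=> k a b; exact: Dh_sym.
Qed.

Lemma gam_sym u i j : U u -> row j (gam i u) = row i (gam j u).
Proof.
move=> Uu; rewrite /gam !linearZ/= !row_mul; congr (_ *: (_ *m _)).
by apply: (@koszul_sym _ _ (fun i => 'D_(eps i) h u)) => k a b; exact: Dh_sym.
Qed.

Lemma derive_invh u i : U u -> is_derive u (eps i) (fun x => invmx (h x))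
  (- (invmx (h u) *m gam i u + (gam i u)^T *m invmx (h u))).
Proof.
move=> Uu; have := smooth_is_derive (eps i) (smooth_invmx oU sh ph) Uu.
congr is_derive; rewrite (derive_invmx oU _ sh ph Uu) (gam_compat i Uu).
have uh := posdef_unit (ph Uu).
by rewrite mulmxDr mulmxDl !mulmxA mulmxK// mulVmx// mul1mx.
Qed.

Lemma smooth_koszul i : smooth_on U (koszul i).
Proof.
have sD v a b : smooth_on U (fun u => 'D_v h u a b).
  by have /(smooth_mxP oU) := smooth_derive v sh; apply.
apply/(smooth_mxP oU) => j k; under eq_fun do rewrite mxE.
by apply: smooth_add => //; [exact: smooth_add|exact: smooth_opp].
Qed.

Lemma smooth_gam i : smooth_on U (gam i).
Proof.
apply: smooth_scale => //; apply: smooth_mulmx => //; first exact: smooth_koszul.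
exact: smooth_invmx.
Qed.

(** By Schwarz a leafwise derivative passes through the transverse derivatives in [koszul] and
    reaches [h], where it vanishes. *)
Lemma gam_basic u l i : U u -> tangL l -> 'D_l (gam i) u = 0.
Proof.
move=> Uu Ll; have DDh v : is_derive u l (fun x => 'D_v h x) 0.
  have := smooth_is_derive l (smooth_derive v sh) Uu; congr is_derive.
  rewrite (derive_comm _ _ oU Uu (sh 2)).
  rewrite (derive_near (g := fun=> 0) v oU Uu); last by move=> x Ux; exact: h_basic.
  exact: derive_cst.
have DK : is_derive u l (koszul i) 0.
  apply: is_derive_mx => j k; under eq_fun do rewrite mxE;
    rewrite mxE -[X in is_derive _ _ _ X]subr0 -{1}[0]addr0.
  have De v a b : is_derive u l (fun x => 'D_v h x a b) 0.
    by have := is_derive_entry a b (DDh v); rewrite mxE.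
  exact: is_derive_sub (is_derive_add (De _ _ _) (De _ _ _)) (De _ _ _).
have Di : is_derive u l (fun x => invmx (h x)) 0.
  have := smooth_is_derive l (smooth_invmx oU sh ph) Uu; congr is_derive.
  by rewrite (derive_invmx oU _ sh ph Uu) h_basic// mulmx0 mul0mx oppr0.
have [_ ->] := is_derive_scal 2^-1 (is_derive_mulmx DK Di).
by rewrite mul0mx mulmx0 addr0 scaler0.
Qed.

End TransverseConnection.

(** Matches the vector form of Koszul's formula, as in [christoffel], with the matrix form of
    [koszul]. *)
Lemma koszul_row (F : fieldType) q (D : 'I_q -> 'M[F]_q) (a b : 'rV[F]_q) :
  b *m (\sum_i a 0 i *: D i) + a *m (\sum_i b 0 i *: D i) - \row_k (a *m D k *m b^T) 0 0
  = \sum_i a 0 i *: (b *m \matrix_(j, k) (D i j k + D j i k - D k i j)).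
Proof.
have E1 : \sum_i a 0 i *: (b *m D i) = b *m (\sum_i a 0 i *: D i).
  by rewrite mulmx_sumr; apply: eq_bigr => i _; rewrite scalemxAr.
have E2 : \sum_i a 0 i *: (b *m \matrix_(j, k) D j i k) = a *m (\sum_i b 0 i *: D i).
  apply/rowP => k; rewrite summxE mxE; apply: eq_bigr => i _; rewrite !mxE summxE;
    congr (_ * _).
  by apply: eq_bigr => j _; rewrite !mxE.
have E3 : \sum_i a 0 i *: (b *m \matrix_(j, k) D k i j) = \row_k (a *m D k *m b^T) 0 0.
  apply/rowP => k; rewrite summxE !mxE.
  under [RHS]eq_bigr do rewrite !mxE mulr_suml; rewrite exchange_big/=;
    apply: eq_bigr => i _.
  rewrite !mxE mulr_sumr; apply: eq_bigr => j _; rewrite !mxE; ring.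
rewrite -E1 -E2 -E3 -big_split/= -sumrB; apply: eq_bigr => i _.
rewrite -scalerDr -scalerBr -mulmxDr -mulmxBr; congr (_ *: (_ *m _)).
by apply/matrixP => j k; rewrite !mxE.
Qed.

Lemma differentiable_mulmx (R : realType) (V : normedModType R) m n l
    (f : V -> 'M[R]_(m, n)) (g : V -> 'M[R]_(n, l)) u :
  differentiable f u -> differentiable g u -> differentiable (fun x => f x *m g x) u.
Proof.
move=> df dg; apply: differentiable_mx => i j.
rewrite (_ : (fun x => _) = fun x => \sum_k f x i k * g x k j); last first.
  by apply/funext => x; rewrite mxE.
apply: differentiable_bigsum => k.
by apply: differentiableM; exact: differentiable_entry.
Qed.

Lemma smooth_scalemx (R : realType) (V : normedModType R) (U : set V) m n
    (c : V -> R) (f : V -> 'M[R]_(m, n)) : open U ->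
  smooth_on U c -> smooth_on U f -> smooth_on U (fun u => c u *: f u).
Proof.
move=> oU sc /(smooth_mxP oU) sf; apply/(smooth_mxP oU) => i j k.
by under eq_fun do rewrite mxE; apply: Ck_onM => //; exact: sf.
Qed.

Lemma smooth_bracket (R : realType) p q (V : set 'rV[R]_(p + q))
    (X Y : 'rV[R]_(p + q) -> 'rV[R]_(p + q)) : open V ->
  smooth_on V X -> smooth_on V Y -> smooth_on V (bracket X Y).
Proof.
move=> oV; have sD (A B : 'rV[R]_(p + q) -> 'rV[R]_(p + q)) : smooth_on V A -> smooth_on
  V B -> smooth_on V (fun x => 'D_(A x) B x).
  move=> sA sB; apply: (smooth_eq oV (g := fun x => \sum_k A x 0 k *: 'D_(delta_mx 0 k) B
    x)).
    move=> x Vx; rewrite {1}[A x]row_sum_delta derive_sum_dir//.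
    exact: smooth_differentiable sB Vx.
  apply: smooth_sum => // k.
  exact: (smooth_scalemx oV ((smooth_mxP oV A).1 sA 0 k) (smooth_derive (delta_mx 0 k) sB)).
move=> sX sY; apply: smooth_add => //; first exact: sD.
by apply: smooth_opp => //; exact: sD.
Qed.

Lemma is_derive_rsubmx (R : realType) (V : normedModType R) p q
    (f : V -> 'rV[R]_(p + q)) df (u v : V) :
  is_derive u v f df -> is_derive u v (fun x => rsubmx (f x)) (rsubmx df).
Proof.
move=> Df; apply: is_derive_mx => i j; rewrite mxE; under eq_fun do rewrite mxE.
exact: is_derive_entry.
Qed.

(** [v] differs from its transverse coordinate part by a vector tangent to L, which [f] does not
    see. *)
Lemma derive_basic_dir (R : realType) p q (W : normedModType R)
    (f : 'rV[R]_(p + q) -> W) u v :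
  differentiable f u -> (forall l, tangL l -> 'D_l f u = 0) ->
  'D_v f u = \sum_i rsubmx v 0 i *: 'D_(eps R p i) f u.
Proof.
move=> df fl; rewrite -derive_sum_dir//.
apply/eqP; rewrite -subr_eq0 -deriveB_dir//; apply/eqP/fl.
rewrite /tangL linearB/= linear_sum/= [X in X - _]row_sum_delta -sumrB big1// => i _.
rewrite linearZ/= (_ : rsubmx (eps R p i) = delta_mx 0 i) ?subrr//.
by apply/rowP => j; rewrite !mxE eq_rshift.
Qed.

(** The expansion of curvQ X Y s: [c] is the second derivative of [s] common to both orders, [sx]
    and [sy] its first derivatives. All of them cancel, as do the terms from derivatives of X and Y
    against the bracket, so that the curvature is tensorial. *)
Lemma curvature_algebra (F : comRingType) q (s sx sy a1 a2 c : 'rV[F]_q)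
    (Gx Gy g1 g2 K1 K2 : 'M[F]_q) :
  a1 + c + (sx *m Gy + s *m (g1 + K1)) + (sy + s *m Gy) *m Gx
  - (a2 + c + (sy *m Gx + s *m (g2 + K2)) + (sx + s *m Gx) *m Gy)
  - (a1 - a2 + s *m (g1 - g2)) = s *m (K1 - K2 + Gy *m Gx - Gx *m Gy).
Proof.
rewrite !(mulmxDl, mulmxDr, mulmxN) !mulmxA.
move: (sx *m Gy) (sy *m Gx) (s *m Gy *m Gx) (s *m Gx *m Gy) => b1 b2 b3 b4.
move: (s *m g1) (s *m g2) (s *m K1) (s *m K2) => b5 b6 b7 b8.
by apply/rowP => i; rewrite !mxE; ring.
Qed.

Lemma bil2_curvature (F : realType) q (D : 'I_q -> 'I_q -> 'M[F]_q) (g : 'I_q -> 'M[F]_q)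
    (x y : 'rV[F]_q) :
  \sum_i \sum_j (x 0 j * y 0 i) *: D j i - \sum_i \sum_j (y 0 j * x 0 i) *: D j i
  + (\sum_j y 0 j *: g j) *m (\sum_i x 0 i *: g i)
  - (\sum_i x 0 i *: g i) *m (\sum_j y 0 j *: g j)
  = bil2 (fun i j => D i j - D j i + g j *m g i - g i *m g j) x y.
Proof.
have GG a b : (\sum_j b 0 j *: g j) *m (\sum_i a 0 i *: g i) =
    \sum_i \sum_j (a 0 i * b 0 j) *: (g j *m g i).
  rewrite mulmx_suml exchange_big/=; apply: eq_bigr => j _.
  rewrite mulmx_sumr; apply: eq_bigr => i _.
  by rewrite -scalemxAl -scalemxAr scalerA mulrC.
rewrite !GG exchange_big/= [X in _ - X]exchange_big/= /bil2.
rewrite -sumrB -big_split -sumrB; apply: eq_bigr => i _.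
rewrite -sumrB -big_split -sumrB; apply: eq_bigr => j _ /=.
by rewrite [y 0 j * _]mulrC -!scalerBr -scalerDr -scalerBr.
Qed.

(** * The transverse metric, connection and curvature in one chart *)

Section FoliatedChart.
Variables (R : realType) (p q : nat).
Notation vec := ('rV[R]_(p + q)).
Variables (U : set vec) (G : vec -> 'M[R]_(p + q)).
Hypotheses (oU : open U) (riemG : riemannian_on U G) (blG : bundle_like_on U G).

Definition sigma_mx u : 'M[R]_(q, p + q) :=
  row_mx (- (dlsubmx (G u) *m invmx (ulsubmx (G u)))) 1%:M.

(** The Gram matrix of g_Q in the coordinate frame of Q, that is, the Schur complement of the
    leafwise block of [G u]. *)
Definition tmetric u : 'M[R]_q := sigma_mx u *m G u *m (sigma_mx u)^T.

Lemma sigmaE u a : sigma G u a = a *m sigma_mx u.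
Proof. by rewrite /sigma /sigma_mx mul_mx_row mulmxN mulmxA mulmx1. Qed.

Lemma inner_sigmaE u a b : inner G u (sigma G u a) (sigma G u b) = (a *m tmetric u *m
  b^T) 0 0.
Proof. by rewrite /inner !sigmaE trmx_mul !mulmxA. Qed.

Lemma gQE u a b : gQ G u a b = (a *m tmetric u *m b^T) 0 0.
Proof. exact: inner_sigmaE. Qed.

Lemma posdef_G u : U u -> posdef (G u).
Proof. by case: riemG => _ sG pG Uu; split=> [|x x0]; [exact: sG|exact: pG]. Qed.

Lemma posdef_GLL u : U u -> posdef (ulsubmx (G u)).
Proof.
move=> Uu; have [sG pG] := posdef_G Uu; split=> [|x x0].
  by rewrite trmx_ulsub sG.
have := pG (row_mx x 0); rewrite -{1}[G u]submxK tr_row_mx mul_row_block mul_row_col.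
rewrite !mul0mx !trmx0 !mulmx0 !addr0; apply.
by apply: contra x0 => /eqP; rewrite -row_mx0 => /eq_row_mx[-> _].
Qed.

Lemma unit_GLL u : U u -> ulsubmx (G u) \in unitmx.
Proof. by move/posdef_GLL/posdef_unit. Qed.

Lemma smooth_G : smooth_on U G. Proof. by case: riemG. Qed.

Lemma smooth_sigma_mx : smooth_on U sigma_mx.
Proof.
have sG := (smooth_mxP oU G).1 smooth_G.
apply: smooth_row_mx => //; last exact: smooth_cst.
apply: smooth_opp => //; apply: smooth_mulmx => //.
  apply/(smooth_mxP oU) => i j; under eq_fun do rewrite !mxE; exact: sG.
apply: smooth_invmx => //; last by move=> u; exact: posdef_GLL.
apply/(smooth_mxP oU) => i j; under eq_fun do rewrite !mxE; exact: sG.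
Qed.

Lemma smooth_tmetric : smooth_on U tmetric.
Proof.
apply: smooth_mulmx => //; last by apply: smooth_trmx => //; exact: smooth_sigma_mx.
by apply: smooth_mulmx => //; [exact: smooth_sigma_mx|exact: smooth_G].
Qed.

Lemma sigma_eq0 u a : sigma G u a = 0 -> a = 0.
Proof. by rewrite /sigma -row_mx0 => /eq_row_mx[]. Qed.

(** The image of sigma is orthogonal to L, so the leafwise block vanishes. Pairing with [sigma_mx]
    thus discards leafwise components, which is how it is used below. *)
Lemma G_sigma u : U u -> G u *m (sigma_mx u)^T = col_mx 0 (tmetric u).
Proof.
move=> Uu; have [sG _] := posdef_G Uu.
have E : sigma_mx u *m G u = row_mx 0 (dlsubmx (G u) *m - (invmx (ulsubmx (G u)) *m
  ursubmx (G u)) + drsubmx (G u)).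
  rewrite /sigma_mx; move: (unit_GLL Uu) (esym (submxK (G u))).
  move: (ulsubmx (G u)) (ursubmx (G u)) (dlsubmx (G u)) (drsubmx (G u)) => A B C D uA ->.
  by rewrite mul_row_block !mul1mx !mulNmx mulmxKV// addNr mulmxN mulmxA.
have -> : tmetric u = dlsubmx (G u) *m - (invmx (ulsubmx (G u)) *m ursubmx (G u)) +
  drsubmx (G u).
  by rewrite /tmetric E tr_row_mx mul_row_col mul0mx add0r trmx1 mulmx1.
rewrite -[LHS]trmxK trmx_mul trmxK sG E tr_row_mx trmx0; congr col_mx.
rewrite linearD/= trmx_mul linearN/= trmx_mul trmx_ursub trmx_drsub trmx_dlsub sG.
by rewrite trmx_inv trmx_ulsub sG mulNmx mulmxN mulmxA.
Qed.

Lemma posdef_tmetric u : U u -> posdef (tmetric u).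
Proof.
move=> Uu; have [sG pG] := posdef_G Uu; split=> [|x x0].
  by rewrite /tmetric !trmx_mul trmxK sG mulmxA.
rewrite -inner_sigmaE; apply: pG; apply: contra x0 => /eqP/sigma_eq0 ->//.
Qed.

Lemma smooth_sigma_sec V s : open V -> V `<=` U -> smooth_on V s -> smooth_on V
  (sigma_sec G s).
Proof.
move=> oV VU ss; rewrite (_ : sigma_sec G s = fun u => s u *m sigma_mx u).
  by apply: smooth_mulmx => // k; apply: Ck_on_sub VU _; exact: smooth_sigma_mx.
by apply/funext => u; rewrite /sigma_sec sigmaE.
Qed.

Lemma tangL_derive V (f : vec -> vec) u v w : open V -> V u ->
  (forall x, V x -> rsubmx (f x) = w) -> differentiable f u -> tangL ('D_v f u).
Proof.
move=> oV Vu fw df; have [_] := is_derive_rsubmx (is_derive_diff v df).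
by rewrite (derive_near (g := fun=> w) v oV Vu fw) derive_cst /tangL => <-.
Qed.

(** For [Z] tangent to L the term D_Y Z of the bracket remains tangent, so its transverse part is
    -D_Z of the last coordinates of [Y]. *)
Lemma basic_fieldI V (Y : vec -> vec) : open V -> smooth_on V Y ->
  (forall u l, V u -> tangL l -> 'D_l (fun x => rsubmx (Y x)) u = 0) -> basic_field V Y.
Proof.
move=> oV sY bY; split=> // Z sZ tZ u Vu; rewrite /bracket /tangL linearB/=.
have dZ := smooth_differentiable sZ Vu; have dY := smooth_differentiable sY Vu.
rewrite (tangL_derive (Y u) oV Vu tZ dZ) sub0r; apply/eqP; rewrite oppr_eq0; apply/eqP.
have [_ <-] := is_derive_rsubmx (is_derive_diff (Z u) dY).
by apply: bY => //; exact: tZ.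
Qed.

(** The bundle-like condition is applied to the horizontal lifts of constant sections: they are
    orthogonal to L, and basic because their transverse coordinates are constant. *)
Lemma tmetric_basic u l : U u -> tangL l -> 'D_l tmetric u = 0.
Proof.
move=> Uu Ll; have Ys a : basic_field U (sigma_sec G (fun=> a)).
  apply: basic_fieldI => //.
    by apply: smooth_sigma_sec => //; exact: smooth_cst.
  move=> x v _ _; under eq_fun do rewrite rsubmx_sigma; exact: derive_cst.
have perp a x v : U x -> tangL v -> inner G x (sigma_sec G (fun=> a) x) v = 0.
  by move=> Ux; apply: sigma_orthogonal; exact: unit_GLL.
have D := smooth_is_derive l smooth_tmetric Uu; apply/matrixP => i j; rewrite [RHS]mxE.
have [_ <-] := is_derive_entry i j D.
have E : (fun x => tmetric x i j) =
    fun x => inner G x (sigma_sec G (fun=> delta_mx 0 i) x) (sigma_sec G (fun=> delta_mx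
      0 j) x).
  by apply/funext => x; rewrite inner_sigmaE trmx_delta -rowE -colE !mxE.
by rewrite E; exact: (blG oU (@subset_refl _ U) (Ys _) (Ys _) (perp _) (perp _) Uu Ll).
Qed.

(** The Q block of [sigma_mx] is the identity, so its derivative lies in L, which is orthogonal to
    the image of sigma; both product-rule terms that differentiate sigma vanish. *)
Lemma derive_tmetric u v : U u -> 'D_v tmetric u = sigma_mx u *m 'D_v G u *m (sigma_mx u)^T.
Proof.
move=> Uu; have DG := smooth_is_derive v smooth_G Uu.
have DS := smooth_is_derive v smooth_sigma_mx Uu.
have [_ ->] := is_derive_mulmx (is_derive_mulmx DS DG) (is_derive_trmx DS).
have DS0 : 'D_v sigma_mx u = row_mx (lsubmx ('D_v sigma_mx u)) 0.
  rewrite -[LHS]hsubmxK; congr row_mx; apply/matrixP => i j; rewrite !mxE.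
  have [_ <-] := is_derive_entry i (rshift p j) DS.
  rewrite (_ : (fun x => _) = fun=> (1%:M : 'M[R]_q) i j); first exact: derive_cst.
  by apply/funext => x; rewrite row_mxEr.
have perp : 'D_v sigma_mx u *m G u *m (sigma_mx u)^T = 0.
  by rewrite DS0 -mulmxA (G_sigma Uu) mul_row_col mulmx0 mul0mx addr0.
have perp' : sigma_mx u *m G u *m ('D_v sigma_mx u)^T = 0.
  by apply: trmx_inj; rewrite !trmx_mul trmxK (posdef_G Uu).1 trmx0 mulmxA.
by rewrite mulmxDl perp add0r perp' addr0.
Qed.



Notation Gam := (gam tmetric).

(** As for a Riemannian submersion: on horizontal vectors the transverse part of the ambient
    Christoffel term is that of the quotient metric. Multiplying by the invertible [tmetric u]
    reduces it to the ambient Koszul formula paired with horizontal lifts, whose derivatives of [G]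
    are derivatives of [tmetric] by [derive_tmetric]. *)
Lemma christoffel_sigma u a b : U u ->
  rsubmx (christoffel G u (sigma G u a) (sigma G u b)) = \sum_i a 0 i *: (b *m Gam i u).
Proof.
move=> Uu; set c := christoffel _ _ _ _.
have ut := posdef_unit (posdef_tmetric Uu).
apply: (can_inj (mulmxK ut)).
have -> : rsubmx c *m tmetric u = c *m G u *m (sigma_mx u)^T.
  by rewrite -mulmxA G_sigma// -{2}[c]hsubmxK mul_row_col mulmx0 add0r.
have cG : c *m G u = 2^-1 *: (sigma G u b *m 'D_(sigma G u a) G u + sigma G u a *m
  'D_(sigma G u b) G u
    - \row_i inner ('D_(delta_mx 0 i) G) u (sigma G u a) (sigma G u b)).
  by rewrite /c /christoffel -scalemxAl mulmxKV// posdef_unit//; exact: posdef_G.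
have dt := smooth_differentiable smooth_tmetric Uu.
have bas l : tangL l -> 'D_l tmetric u = 0 by move=> Ll; exact: tmetric_basic.
have Dt v : sigma_mx u *m 'D_v G u *m (sigma_mx u)^T = \sum_i rsubmx v 0 i *: 'D_(eps R p
  i) tmetric u.
  by rewrite -derive_tmetric// (derive_basic_dir _ dt bas).
have rS k : rsubmx (row k (sigma_mx u)) = delta_mx 0 k.
  by apply/rowP => j; rewrite mxE /sigma_mx [LHS]mxE row_mxEr !mxE eq_sym.
(* Multiplication by [(sigma_mx u)^T] replaces the coordinate directions by the horizontal lifts of
   the transverse ones. *)
have part3 : (\row_i inner ('D_(delta_mx 0 i) G) u (sigma G u a) (sigma G u b)) *m
  (sigma_mx u)^T
    = \row_k (a *m 'D_(eps R p k) tmetric u *m b^T) 0 0.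
  apply/rowP => k; rewrite [RHS]mxE.
  have -> : 'D_(eps R p k) tmetric u = sigma_mx u *m 'D_(row k (sigma_mx u)) G u *m
    (sigma_mx u)^T.
    rewrite Dt rS (bigD1 k)//= big1 ?addr0 ?mxE ?eqxx ?scale1r// => i ik.
    by rewrite mxE (negbTE ik) andbF scale0r.
  have -> : 'D_(row k (sigma_mx u)) G u = \sum_i sigma_mx u k i *: 'D_(delta_mx 0 i) G u.
    rewrite {1}[row k _]row_sum_delta derive_sum_dir;
      last exact: smooth_differentiable smooth_G Uu.
    by apply: eq_bigr => i _; rewrite mxE.
  rewrite [LHS]mxE mulmx_sumr mulmx_suml mulmx_sumr mulmx_suml summxE;
    apply: eq_bigr => i _.
  rewrite [X in X * _]mxE [X in _ * X]mxE -scalemxAr -scalemxAl -scalemxAr -scalemxAl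
    [RHS]mxE.
  rewrite mulrC; congr (_ * _).
  by rewrite /inner !sigmaE trmx_mul !mulmxA.
have SDS x y : sigma G u x *m 'D_(sigma G u y) G u *m (sigma_mx u)^T =
    x *m \sum_i y 0 i *: 'D_(eps R p i) tmetric u.
  by have := Dt (sigma G u y); rewrite rsubmx_sigma => <-; rewrite sigmaE !mulmxA.
have comb (r : R) (T1 T2 T3 : vec) (N : 'M[R]_(p + q, q)) X1 X2 X3 :
    T1 *m N = X1 -> T2 *m N = X2 -> T3 *m N = X3 ->
    (r *: (T1 + T2 - T3)) *m N = r *: (X1 + X2 - X3).
  by move=> <- <- <-; rewrite -scalemxAl mulmxBl mulmxDl.
rewrite cG; apply: etrans (comb _ _ _ _ _ _ _ _ (SDS b a) (SDS a b) part3) _.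
rewrite (@koszul_row _ _ (fun i => 'D_(eps R p i) tmetric u)).
rewrite mulmx_suml scaler_sumr; apply: eq_bigr => i _.
rewrite -scalemxAl scalerA mulrC -scalerA; congr (_ *: _).
by rewrite -mulmxA (gam_h posdef_tmetric)// scalemxAr.
Qed.

Definition gam_dir (x : 'rV[R]_q) u : 'M[R]_q := \sum_i x 0 i *: Gam i u.

Lemma differentiable_sigma_sec s u : U u -> differentiable s u ->
  differentiable (sigma_sec G s) u.
Proof.
move=> Uu ds; rewrite (_ : sigma_sec G s = fun u => s u *m sigma_mx u).
  by apply: differentiable_mulmx => //; exact: smooth_differentiable smooth_sigma_mx Uu.
by apply/funext => x; rewrite /sigma_sec sigmaE.
Qed.

(** The derivatives along the leaf part, from the bracket, and along the orthogonal part, from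
    [nablaM], add up to D_X s. The other half of the bracket differentiates a field tangent to L and
    disappears in Q. *)
Lemma nablaQ_formula X s u : U u -> differentiable X u -> differentiable s u ->
  nablaQ G X s u = 'D_(X u) s u + s u *m gam_dir (rsubmx (X u)) u.
Proof.
move=> Uu dX ds; have dsig := differentiable_sigma_sec Uu ds.
have drX : differentiable (fun x => rsubmx (X x)) u.
  exact: (differentiable_comp dX (differentiable_rsubmx _)).
have dleaf : differentiable (leaf_part G X) u.
  by apply: differentiableB => //; exact: (differentiable_sigma_sec Uu drX).
have Dsig v : rsubmx ('D_v (sigma_sec G s) u) = 'D_v s u.
  have [_ <-] := is_derive_rsubmx (is_derive_diff v dsig).
  have -> : (fun x => rsubmx (sigma_sec G s x)) = s by apply/funext => x;
    exact: rsubmx_sigma.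
  by [].
have tleaf v : rsubmx ('D_v (leaf_part G X) u) = 0.
  apply: (tangL_derive v openT I _ dleaf (w := 0)) => x _.
  by rewrite /leaf_part /perp_part linearB/= rsubmx_sigma subrr.
have comb (w1 w2 w3 w4 : vec) (a1 a3 a4 : 'rV[R]_q) : rsubmx w1 = a1 -> rsubmx w2 = 0 ->
    rsubmx w3 = a3 -> rsubmx w4 = a4 -> rsubmx (w1 - w2) + rsubmx (w3 + w4) = a1 + a3 + a4.
  by move=> <- w20 <- <-; rewrite linearB linearD/= w20 subr0 addrA.
have ch := christoffel_sigma (rsubmx (X u)) (s u) Uu.
apply: etrans (comb _ _ _ _ _ _ _ (Dsig _) (tleaf _) (Dsig _) ch) _.
apply: f_equal2; last first.
  by rewrite /gam_dir mulmx_sumr; apply: eq_bigr => i _; rewrite scalemxAr.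
rewrite -(deriveD_dir _ _ ds); congr ('D_ _ _ _).
by rewrite /leaf_part subrK.
Qed.

(** Since endomorphisms act on rows from the right, the quadratic terms occur in the reverse of the
    usual order. *)
Definition curvature_mx (i j : 'I_q) u : 'M[R]_q :=
  'D_(eps R p i) (Gam j) u - 'D_(eps R p j) (Gam i) u + Gam j u *m Gam i u - Gam i u *m
    Gam j u.

Lemma smooth_gamma i : smooth_on U (Gam i).
Proof. exact: (smooth_gam oU smooth_tmetric posdef_tmetric). Qed.

Lemma derive_gamma u v j : U u -> 'D_v (Gam j) u = \sum_i rsubmx v 0 i *: 'D_(eps R p i)
  (Gam j) u.
Proof.
move=> Uu; apply: derive_basic_dir; first exact: smooth_differentiable (smooth_gamma j) Uu.
by move=> l Ll; exact: (gam_basic oU smooth_tmetric posdef_tmetric tmetric_basic j Uu Ll).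
Qed.

Section Curvature.
Variables (V : set vec) (s : vec -> 'rV[R]_q).
Hypotheses (oV : open V) (VU : V `<=` U) (ss : smooth_on V s).

Lemma deriveE_field (X : vec -> vec) x : V x ->
  'D_(X x) s x = \sum_k X x 0 k *: 'D_(delta_mx 0 k) s x.
Proof.
move=> Vx; rewrite {1}[X x]row_sum_delta derive_sum_dir//.
exact: smooth_differentiable ss Vx.
Qed.

Lemma smooth_nablaQ X : smooth_on V X -> smooth_on V (nablaQ G X s).
Proof.
move=> sX; have sXi := (smooth_mxP oV X).1 sX 0.
apply: (@smooth_eq _ _ _ oV _ _ (fun x => \sum_k X x 0 k *: 'D_(delta_mx 0 k) s x
  + s x *m \sum_i X x 0 (rshift p i) *: Gam i x)).
  move=> x Vx; rewrite nablaQ_formula ?deriveE_field//; last 3 first.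
  - exact: VU.
  - exact: smooth_differentiable sX Vx.
  - exact: smooth_differentiable ss Vx.
  by congr (_ + _ *m _); apply: eq_bigr => i _; rewrite mxE.
have sGV i : smooth_on V (Gam i) by move=> k; apply: Ck_on_sub VU _; exact: smooth_gamma.
apply: smooth_add => //.
  apply: smooth_sum => // k.
  exact: (smooth_scalemx oV (sXi k) (smooth_derive (delta_mx 0 k) ss)).
apply: smooth_mulmx => //; apply: smooth_sum => // i.
exact: (smooth_scalemx oV (sXi _) (sGV i)).
Qed.

(** ['D_(X x) s x] depends on [x] also through the direction; expanding [X] in coordinates separates
    the two contributions. *)
Lemma derive_nablaQ X v u : V u -> smooth_on V X ->
  'D_v (nablaQ G X s) u = 'D_('D_v X u) s u + 'D_v (fun x => 'D_(X u) s x) u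
   + ('D_v s u *m gam_dir (rsubmx (X u)) u + s u *m (gam_dir (rsubmx ('D_v X u)) u
      + \sum_i \sum_j (rsubmx v 0 j * rsubmx (X u) 0 i) *: 'D_(eps R p j) (Gam i) u)).
Proof.
move=> Vu sX; have Uu := VU Vu.
have GE w : gam_dir (rsubmx w) u = \sum_i w 0 (rshift p i) *: Gam i u.
  by apply: eq_bigr => i _; rewrite mxE.
have sE x w : V x -> 'D_w s x = \sum_k w 0 k *: 'D_(delta_mx 0 k) s x.
  move=> Vx; rewrite {1}[w]row_sum_delta derive_sum_dir//.
  exact: smooth_differentiable ss Vx.
rewrite (derive_near (g := fun x => \sum_k X x 0 k *: 'D_(delta_mx 0 k) s x
  + s x *m \sum_i X x 0 (rshift p i) *: Gam i x) v oV Vu); last first.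
  move=> x Vx; rewrite nablaQ_formula ?deriveE_field//; last 3 first.
  - exact: VU.
  - exact: smooth_differentiable sX Vx.
  - exact: smooth_differentiable ss Vx.
  by congr (_ + _ *m _); apply: eq_bigr => i _; rewrite mxE.
have DX := smooth_is_derive v sX Vu.
have Ds := smooth_is_derive v ss Vu.
have DDs k := smooth_is_derive v (smooth_derive (delta_mx 0 k) ss) Vu.
have DG i := smooth_is_derive v (smooth_gamma i) Uu.
have D1 := is_derive_bigsum (fun k => is_derive_scalemx (is_derive_entry 0 k DX) (DDs k)).
have D2 := is_derive_bigsum (fun i => is_derive_scalemx (is_derive_entry 0 (rshift p i)
  DX) (DG i)).
have [_ ->] := is_derive_add D1 (is_derive_mulmx Ds D2).
have E2 : 'D_v (fun x => 'D_(X u) s x) u = \sum_k X u 0 k *: 'D_v (fun x => 'D_(delta_mx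
  0 k) s x) u.
  rewrite (derive_near v oV Vu (fun x Vx => sE x (X u) Vx)).
  by have [_ ->] := is_derive_bigsum (fun k => is_derive_scal (X u 0 k) (DDs k)).
rewrite !big_split/=; apply: f_equal2; apply: f_equal2.
- exact/esym/sE.
- exact/esym/E2.
- by rewrite GE.
- congr (_ *m _); apply: f_equal2; first by rewrite GE.
  apply: eq_bigr => i _; rewrite derive_gamma// scaler_sumr; apply: eq_bigr => j _.
  by rewrite scalerA mulrC [rsubmx (X u) _ _]mxE.
Qed.

Theorem curvQ_formula X Y u : V u -> smooth_on V X -> smooth_on V Y ->
  curvQ G X Y s u = s u *m bil2 (fun i j => curvature_mx i j u) (rsubmx (X u)) (rsubmx (Y
    u)).
Proof.
move=> Vu sX sY; have Uu := VU Vu.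
have dX := smooth_differentiable sX Vu; have dY := smooth_differentiable sY Vu.
have ds := smooth_differentiable ss Vu.
have NN Z W : smooth_on V Z -> smooth_on V W ->
    nablaQ G W (nablaQ G Z s) u = 'D_(W u) (nablaQ G Z s) u
      + ('D_(Z u) s u + s u *m gam_dir (rsubmx (Z u)) u) *m gam_dir (rsubmx (W u)) u.
  move=> sZ sW; rewrite (nablaQ_formula Uu (smooth_differentiable sW Vu)); last first.
    exact: smooth_differentiable (smooth_nablaQ sZ) Vu.
  by rewrite (nablaQ_formula Uu (smooth_differentiable sZ Vu) ds).
have N1 := NN _ _ sY sX; have N2 := NN _ _ sX sY.
rewrite (derive_nablaQ (X u) Vu sY) in N1; rewrite (derive_nablaQ (Y u) Vu sX) in N2.
have dB : differentiable (bracket X Y) u.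
  by apply: (smooth_differentiable (U := V)) => //; apply: smooth_bracket.
have N3 := nablaQ_formula Uu dB ds.
have comm := derive_comm (X u) (Y u) oV Vu (ss 2).
have D3 : 'D_(bracket X Y u) s u = 'D_('D_(X u) Y u) s u - 'D_('D_(Y u) X u) s u.
  exact: deriveB_dir.
have G3 : gam_dir (rsubmx (bracket X Y u)) u =
    gam_dir (rsubmx ('D_(X u) Y u)) u - gam_dir (rsubmx ('D_(Y u) X u)) u.
  by rewrite /gam_dir -sumrB; apply: eq_bigr => i _; rewrite -scalerBl !mxE.
apply: etrans (f_equal2 (fun a b => a - b) (f_equal2 (fun a b => a - b) N1 N2) N3) _.
rewrite D3 G3 comm; apply: etrans (curvature_algebra _ _ _ _ _ _ _ _ _ _ _ _) _.
apply: f_equal; exact: (bil2_curvature (fun i j => 'D_(eps R p i) (Gam j) u)).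
Qed.

End Curvature.

End FoliatedChart.

(** * Foliated maps in charts *)

Lemma row_eq_entry (T : Type) m m' n (A : 'M[T]_(m, n)) (B : 'M[T]_(m', n)) i j a :
  row i A = row j B -> A i a = B j a.
Proof. by move/rowP/(_ a); rewrite !mxE. Qed.

Lemma trace_formE (R : comRingType) m n (Y : 'M[R]_(m, n)) (k : 'M[R]_n) :
  \tr (Y *m k *m Y^T) = \sum_i (row i Y *m k *m (row i Y)^T) 0 0.
Proof. by apply: eq_bigr => i _; rewrite -row_mul !mxE; apply: eq_bigr => j _;
  rewrite !mxE. Qed.

Lemma trace_form_ge0 (R : realType) m n (Y : 'M[R]_(m, n)) (k : 'M[R]_n) : posdef k ->
  0 <= \tr (Y *m k *m Y^T).
Proof. by move=> pk; rewrite trace_formE; apply: sumr_ge0 => i _; exact: posdef_ge0. Qed.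

Lemma trace_form_eq0 (R : realType) m n (Y : 'M[R]_(m, n)) (k : 'M[R]_n) : posdef k ->
  \tr (Y *m k *m Y^T) = 0 -> Y = 0.
Proof.
move=> pk /eqP; rewrite trace_formE psumr_eq0; last by move=> i _; exact: posdef_ge0.
move=> /allP Y0; apply/row_matrixP => i; rewrite row0.
have /= /eqP := Y0 i (mem_index_enum _); exact: posdef_eq0.
Qed.

Lemma row_dependent (F : fieldType) n (x y : 'rV[F]_n) : ~~ row_free (col_mx x y) ->
  (exists c, x = c *: y) \/ (exists c, y = c *: x).
Proof.
rewrite -kermx_eq0 => /rowV0Pn[v /sub_kermxP]; rewrite -[v]hsubmxK.
rewrite [lsubmx v]mx11_scalar [rsubmx v]mx11_scalar mul_row_col !mul_scalar_mx.
set a := lsubmx v 0 0; set b := rsubmx v 0 0 => ab v0.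
have [a0|a0] := eqVneq a 0; last first.
  left; exists (- (b / a)); apply: (scalerI a0); move/eqP: ab; rewrite addr_eq0 => /eqP ->.
  by rewrite scalerA mulrN mulrCA divff// mulr1 scaleNr.
have b0 : b != 0.
  apply: contra v0 => /eqP b0; rewrite a0 b0; apply/eqP.
  by rewrite -[RHS]row_mx0; congr row_mx; apply/matrixP => i j; rewrite !mxE mul0rn.
right; exists 0; apply: (scalerI b0); move: ab; rewrite a0 !scale0r add0r => ->.
by rewrite scaler0.
Qed.

(** * The transverse differential of a foliated map in a pair of charts *)

Section FoliatedMapChart.
Variables (R : realType) (p q p' q' : nat).
Notation vec := ('rV[R]_(p + q)).
Notation vec' := ('rV[R]_(p' + q')).
Variables (U : set vec) (G : vec -> 'M[R]_(p + q)).
Variables (U' : set vec') (G' : vec' -> 'M[R]_(p' + q')).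
Hypotheses (oU : open U) (riemG : riemannian_on U G) (blG : bundle_like_on U G).
Hypotheses (oU' : open U') (riemG' : riemannian_on U' G') (blG' : bundle_like_on U' G').
Variables (W : set vec) (f : vec -> vec').
Hypotheses (oW : open W) (WU : W `<=` U) (WU' : forall u, W u -> U' (f u)).
Hypothesis fol_f : foliated_on W f.

Notation D i := (eps R p i).

Definition transverse_rep u : 'rV[R]_q' := rsubmx (f u).

Definition jac u : 'M[R]_(q, q') := \matrix_(i, j) 'D_(D i) transverse_rep u 0 j.

Lemma smooth_transverse_rep : smooth_on W transverse_rep.
Proof.
have /(smooth_mxP oW) sf := fol_f.1; apply/(smooth_mxP oW) => i j.
by rewrite /transverse_rep; under eq_fun do rewrite mxE; exact: sf.
Qed.

Lemma derive_transverse_rep u v : W u -> 'D_v transverse_rep u = rsubmx ('d f u v).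
Proof.
move=> Wu; have df := smooth_differentiable fol_f.1 Wu.
have [_ ->] := is_derive_rsubmx (is_derive_diff v df).
by rewrite deriveE.
Qed.

Lemma transverse_rep_basic u l : W u -> tangL l -> 'D_l transverse_rep u = 0.
Proof. by move=> Wu Ll; rewrite derive_transverse_rep//; exact: fol_f.2. Qed.

Lemma row_jac u i : row i (jac u) = 'D_(D i) transverse_rep u.
Proof. by apply/rowP => j; rewrite !mxE. Qed.

Lemma rsubmx_diff u v : W u -> rsubmx ('d f u v) = rsubmx v *m jac u.
Proof.
move=> Wu; rewrite -derive_transverse_rep// (derive_basic_dir v (smooth_differentiable
  smooth_transverse_rep Wu)); last first.
  by move=> l; exact: transverse_rep_basic.
by rewrite mulmx_sum_row; apply: eq_bigr => i _; rewrite row_jac.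
Qed.

Lemma dTE u a : W u -> dT G f u a = a *m jac u.
Proof. by move=> Wu; rewrite /dT rsubmx_diff// rsubmx_sigma. Qed.

Lemma smooth_jac : smooth_on W jac.
Proof.
apply/(smooth_mxP oW) => i j; rewrite /jac; under eq_fun do rewrite mxE.
by have /(smooth_mxP oW) := smooth_derive (D i) smooth_transverse_rep; apply.
Qed.

Lemma derive_row_jac u v i : W u -> row i ('D_v jac u) = 'D_v (fun x => 'D_(D i)
  transverse_rep x) u.
Proof.
move=> Wu; have [_ <-] := is_derive_linear_mx (@row R q q' i) (smooth_is_derive v
  smooth_jac Wu).
by apply: (derive_near v oW Wu) => x Wx; exact: row_jac.
Qed.

Lemma derive_jac_sym u i j : W u -> row j ('D_(D i) jac u) = row i ('D_(D j) jac u).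
Proof.
move=> Wu; apply: etrans (derive_row_jac (D i) j Wu) _.
apply: etrans _ (esym (derive_row_jac (D j) i Wu)).
exact: (derive_comm (D j) (D i) oW Wu (smooth_transverse_rep 2)).
Qed.

Lemma jac_basic u l : W u -> tangL l -> 'D_l jac u = 0.
Proof.
move=> Wu Ll; apply/row_matrixP => i; rewrite row0.
apply: etrans (derive_row_jac l i Wu) _.
apply: etrans (derive_comm (D i) l oW Wu (smooth_transverse_rep 2)) _.
rewrite (derive_near (g := fun=> 0) _ oW Wu); first exact: derive_cst.
by move=> x Wx; exact: transverse_rep_basic.
Qed.

Definition tmetric_inv u := invmx (tmetric G u).
Definition pullback_metric u := tmetric G' (f u).
Definition gam_src (i : 'I_q) u : 'M[R]_q := gam (tmetric G) i u.
(** The connection matrix of the pull-back of Q' along the i-th transverse coordinate of the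
    source. *)
Definition gam_tgt (i : 'I_q) u : 'M[R]_q' := \sum_a jac u i a *: gam (tmetric G') a (f u).
Definition cov_jac := nablaJ (fun i => D i) gam_src gam_tgt jac.

(** A basic [g] sees only the transverse part of the differential of [f], so the chain rule involves
    [jac] alone. *)
Lemma derive_comp_basic (X : normedModType R) (g : vec' -> X) u v : W u ->
  differentiable g (f u) -> (forall l, tangL l -> 'D_l g (f u) = 0) ->
  is_derive u v (fun x => g (f x)) (\sum_a (rsubmx v *m jac u) 0 a *: 'D_(eps R p' a) g
    (f u)).
Proof.
move=> Wu dg gb; have := derive_comp v (smooth_differentiable fol_f.1 Wu) dg.
by rewrite (derive_basic_dir _ dg gb) rsubmx_diff.
Qed.

Lemma rsubmx_eps i : rsubmx (D i) = delta_mx 0 i :> 'rV[R]_q.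
Proof. by apply/rowP => j; rewrite !mxE eq_rshift. Qed.

Lemma pullback_metric_der u v : W u -> is_derive u v pullback_metric
  (\sum_a (rsubmx v *m jac u) 0 a *: 'D_(eps R p' a) (tmetric G') (f u)).
Proof.
move=> Wu; have Uf := WU' Wu; apply: derive_comp_basic => //.
  exact: smooth_differentiable (smooth_tmetric oU' riemG') Uf.
by move=> l Ll; exact: (tmetric_basic oU' riemG' blG' Uf Ll).
Qed.

Lemma pullback_metric_der_eps u i : W u ->
  is_derive u (D i) pullback_metric (gam_tgt i u *m pullback_metric u + pullback_metric u
    *m (gam_tgt i u)^T).
Proof.
move=> Wu; have := pullback_metric_der (D i) Wu; congr is_derive.
rewrite rsubmx_eps -rowE /gam_tgt /pullback_metric mulmx_suml linear_sum/= mulmx_sumr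
  -big_split/=.
apply: eq_bigr => a _; rewrite mxE -scalemxAl.
have -> : (jac u i a *: gam (tmetric G') a (f u))^T = jac u i a *: (gam (tmetric G') a (f
  u))^T.
  by apply/matrixP => b c; rewrite !mxE.
rewrite -scalemxAr -scalerDr; congr (_ *: _).
exact: (gam_compat oU' (smooth_tmetric oU' riemG') (posdef_tmetric riemG') _ (WU' Wu)).
Qed.

Lemma gam_tgt_der u v i : W u -> is_derive u v (gam_tgt i)
  (\sum_a ('D_v jac u i a *: gam (tmetric G') a (f u)
    + jac u i a *: \sum_b (rsubmx v *m jac u) 0 b *: 'D_(eps R p' b) (gam (tmetric G') a)
      (f u))).
Proof.
move=> Wu; have Uf := WU' Wu; apply: is_derive_bigsum => a.
apply: is_derive_scalemx.
  exact: (is_derive_entry i a (smooth_is_derive v smooth_jac Wu)).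
apply: derive_comp_basic => //.
  exact: (smooth_differentiable (smooth_gamma oU' riemG' a) Uf).
by move=> l Ll; exact: (gam_basic oU' (smooth_tmetric oU' riemG') (posdef_tmetric riemG')
  (tmetric_basic oU' riemG' blG') a Uf Ll).
Qed.

Lemma differentiable_gam_tgt u i : W u -> differentiable (gam_tgt i) u.
Proof.
move=> Wu; have Uf := WU' Wu; apply: differentiable_bigsum => a.
have dj := differentiable_entry i a (smooth_differentiable smooth_jac Wu).
have dg : differentiable (fun x => gam (tmetric G') a (f x)) u.
  apply: (differentiable_comp (smooth_differentiable fol_f.1 Wu)).
  exact: (smooth_differentiable (smooth_gamma oU' riemG' a) Uf).
apply: differentiable_mx => b c.
rewrite (_ : (fun x => _) = fun x => jac x i a * gam (tmetric G') a (f x) b c); last first.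
  by apply/funext => x; rewrite mxE.
by apply: differentiableM => //; exact: differentiable_entry.
Qed.

(** The curvature of the pull-back is the pull-back of the curvature: the second derivatives of the
    map, which also enter the derivatives of [gam_tgt], cancel by symmetry. *)
Lemma curv_tgtE u i j : W u ->
  curv_tgt (fun i => D i) gam_tgt u j i =
  bil2 (fun a b => curvature_mx G' a b (f u)) (row j (jac u)) (row i (jac u)).
Proof.
move=> Wu; rewrite /curv_tgt.
have [_ ->] := gam_tgt_der (D j) i Wu; have [_ ->] := gam_tgt_der (D i) j Wu.
have JJ : forall a, 'D_(D j) jac u i a = 'D_(D i) jac u j a.
  by move=> a; exact: (row_eq_entry a (derive_jac_sym j i Wu)).
have S12 : \sum_a 'D_(D j) jac u i a *: gam (tmetric G') a (f u) =
    \sum_a 'D_(D i) jac u j a *: gam (tmetric G') a (f u).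
  by apply: eq_bigr => a _; congr (_ *: _); exact: JJ.
rewrite !rsubmx_eps -!rowE !big_split/=.
have E x y : \sum_a jac u x a *: (\sum_b row y (jac u) 0 b *: 'D_(eps R p' b) (gam
  (tmetric G') a) (f u))
   = \sum_a \sum_b (row y (jac u) 0 b * row x (jac u) 0 a) *: 'D_(eps R p' b) (gam
     (tmetric G') a) (f u).
  apply: eq_bigr => a _; rewrite scaler_sumr; apply: eq_bigr => b _.
  by rewrite scalerA mulrC [row x _ _ _]mxE.
have F x : gam_tgt x u = \sum_a row x (jac u) 0 a *: gam (tmetric G') a (f u).
  by rewrite /gam_tgt; apply: eq_bigr => a _; rewrite [row _ _ _ _]mxE.
rewrite !E !F; apply: etrans (_ : _ = _ - _ + _ - _) _; last first.
  exact: (bil2_curvature (fun b a => 'D_(eps R p' b) (gam (tmetric G') a) (f u))).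
have alg (S1 S2 T1 T2 P Q : 'M[R]_q') : S1 = S2 ->
    S1 + T1 - (S2 + T2) + P - Q = T1 - T2 + P - Q.
  by move=> ->; rewrite opprD addrACA subrr add0r.
exact: (alg _ _ _ _ _ _ S12).
Qed.

Lemma cov_jacE i u : cov_jac i u =
  'D_(D i) jac u + jac u *m gam_tgt i u - gam_src i u *m jac u.
Proof. by []. Qed.

Lemma gam_tgt_sym u i j : W u -> row j (jac u) *m gam_tgt i u = row i (jac u) *m gam_tgt
  j u.
Proof.
move=> Wu; have E x y : row y (jac u) *m gam_tgt x u =
    \sum_a \sum_b (jac u x a * jac u y b) *: row b (gam (tmetric G') a (f u)).
  rewrite /gam_tgt mulmx_sumr; apply: eq_bigr => a _.
  rewrite -scalemxAr mulmx_sum_row scaler_sumr; apply: eq_bigr => b _.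
  by rewrite scalerA; congr (_ * _ *: _); rewrite [row _ _ _ _]mxE.
rewrite !E exchange_big/=; apply: eq_bigr => a _; apply: eq_bigr => b _.
rewrite mulrC; congr (_ *: _).
exact: (gam_sym oU' (smooth_tmetric oU' riemG') (posdef_tmetric riemG') _ _ (WU' Wu)).
Qed.

Lemma cov_jac_sym u i j : W u -> row j (cov_jac i u) = row i (cov_jac j u).
Proof.
move=> Wu; rewrite !cov_jacE; have E1 := derive_jac_sym i j Wu.
have E2 := gam_tgt_sym i j Wu.
have E3 : row j (gam_src i u) = row i (gam_src j u).
  exact: (gam_sym oU (smooth_tmetric oU riemG) (posdef_tmetric riemG) _ _ (WU Wu)).
have alg (k l : 'I_q) (A A' : 'M[R]_(q, q')) (N N' : 'M[R]_q') (K K' : 'M[R]_q) :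
    row k A = row l A' -> row k (jac u) *m N = row l (jac u) *m N' -> row k K = row l K' ->
    row k (A + jac u *m N - K *m jac u) = row l (A' + jac u *m N' - K' *m jac u).
  move=> EA EN EK; rewrite !linearB !linearD/= !row_mul EA EK.
  by congr (_ + _ - _); exact: EN.
exact: alg E1 E2 E3.
Qed.

Lemma derive_jac_dir u v : W u -> 'D_v jac u = \sum_i rsubmx v 0 i *: 'D_(D i) jac u.
Proof.
move=> Wu; apply: derive_basic_dir; first exact: (smooth_differentiable smooth_jac Wu).
by move=> l; exact: jac_basic.
Qed.

Lemma gam_dir_jac u (x : 'rV[R]_q) :
  gam_dir G' (x *m jac u) (f u) = \sum_i x 0 i *: gam_tgt i u.
Proof.
rewrite /gam_dir /gam_tgt; under [RHS]eq_bigr do rewrite scaler_sumr.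
rewrite [RHS]exchange_big/=; apply: eq_bigr => a _.
by rewrite [X in X *: _]mxE scaler_suml; apply: eq_bigr => i _; rewrite scalerA.
Qed.

(** The derivatives of [t] in the pull-back connection and in [nablaQ] cancel, which identifies the
    second fundamental form with the tensor given by the matrices [cov_jac]. *)
Lemma nabla_dTE s t u : W u -> differentiable s u -> differentiable t u ->
  nabla_dT G G' f s t u = t u *m \sum_i s u 0 i *: cov_jac i u.
Proof.
move=> Wu ds dt; have Uu := WU Wu; have Uf := WU' Wu.
have dsig := differentiable_sigma_sec oU riemG Uu ds.
have N1 := nablaQ_formula oU riemG blG Uu dsig dt.
set X := sigma_sec G s in dsig N1 *.
have rX : rsubmx (X u) = s u by exact: rsubmx_sigma.
have N2 : nablaQ G' (cst ('d f u (X u))) (cst (dT G f u (t u))) (f u) =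
    (t u *m jac u) *m \sum_i s u 0 i *: gam_tgt i u.
  rewrite (nablaQ_formula oU' riemG' blG' Uf);
    [|exact: differentiable_cst|exact: differentiable_cst].
  by rewrite derive_cst add0r rsubmx_diff// rX gam_dir_jac dTE.
have N3 : 'D_(X u) (fun x => dT G f x (t x)) u = 'D_(X u) t u *m jac u
    + t u *m \sum_i s u 0 i *: 'D_(D i) jac u.
  rewrite (derive_near (g := fun x => t x *m jac x) _ oW Wu); last first.
    by move=> x Wx; exact: dTE.
  have Dj := smooth_is_derive (X u) smooth_jac Wu.
  have [_ ->] := is_derive_mulmx (is_derive_diff (X u) dt) Dj.
  by rewrite derive_jac_dir// rX.
have N4 : dT G f u (nablaQ G X t u) = 'D_(X u) t u *m jac u
    + t u *m \sum_i s u 0 i *: (gam_src i u *m jac u).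
  apply: etrans (dTE _ Wu) _; apply: etrans (congr1 (fun z => z *m jac u) N1) _.
  rewrite rX mulmxDl -mulmxA; congr (_ + _ *m _).
  by rewrite /gam_dir mulmx_suml; apply: eq_bigr => i _; rewrite scalemxAl.
rewrite /nabla_dT /nabla_phi -/X.
apply: etrans (f_equal2 (fun a b => a - b) (f_equal2 (fun a b => a + b) N3 N2) N4) _.
have E : \sum_i s u 0 i *: cov_jac i u = \sum_i s u 0 i *: 'D_(D i) jac u
    + jac u *m (\sum_i s u 0 i *: gam_tgt i u) - \sum_i s u 0 i *: (gam_src i u *m jac u).
  rewrite mulmx_sumr -big_split/= -sumrB; apply: eq_bigr => i _.
  by rewrite cov_jacE scalerBr scalerDr scalemxAr.
rewrite E mulmxBr mulmxDr !mulmxA opprD addrA; congr (_ - _).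
by rewrite addrAC [X in X - _]addrC addrK.
Qed.

(** The rows of a Cholesky factor of [tmetric] are orthonormal. They are basic because the factor
    has zero derivative wherever the metric does, in particular along the leaves. *)
Lemma orthonormal_frame : exists E : vec -> 'M[R]_q,
  [/\ forall V, open V -> V `<=` U -> basic_frame G V (fun a u => row a (E u)),
      smooth_on U E,
      forall u, U u -> E u *m tmetric G u *m (E u)^T = 1%:M &
      forall u, U u -> tmetric_inv u = (E u)^T *m E u].
Proof.
have st := smooth_tmetric oU riemG; have pt := posdef_tmetric riemG.
have [E [sE E1 DE]] := cholesky oU st pt; exists E; split => //; last first.
  by move=> u Uu; apply: frame_invmx; [exact: pt|exact: E1].
move=> V oV VU; split=> [u Vu a b|a].
  have := E1 u (VU _ Vu) => /matrixP/(_ a b); rewrite mx11_row_mul trmxK row_mul gQE => ->.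
  by rewrite mxE.
have sV : smooth_on V E by move=> k; apply: Ck_on_sub VU _; exact: sE.
have srow : smooth_on V (fun u => row a (E u)).
  apply/(smooth_mxP oV) => i j; under eq_fun do rewrite mxE.
  exact: (smooth_mxP oV E).1.
exists (fun u => row_mx 0 (row a (E u))); last by move=> u _; rewrite row_mxKr.
apply: (basic_fieldI oV); first by apply: smooth_row_mx => //; exact: smooth_cst.
move=> u l Vu Ll; under eq_fun do rewrite row_mxKr.
have DE0 : 'D_l E u = 0.
  by apply: DE; [exact: VU|apply: (tmetric_basic oU riemG blG (VU _ Vu) Ll)].
have [_ ->] := is_derive_linear_mx (@row R q q a) (smooth_is_derive l sV Vu).
by rewrite DE0 linear0.
Qed.

(** * The energy of the map and its Bochner formula *)

Definition energy_map := energy tmetric_inv pullback_metric jac.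

Lemma tmetric_inv_basic u l : W u -> tangL l -> is_derive u l tmetric_inv 0.
Proof.
move=> Wu Ll; have Uu := WU Wu; have st := smooth_tmetric oU riemG;
  have pt := posdef_tmetric riemG.
have := smooth_is_derive l (smooth_invmx oU st pt) Uu; congr is_derive.
rewrite (derive_invmx oU l st pt Uu) (_ : 'D_l _ u = 0) ?mulmx0 ?mul0mx ?oppr0//.
exact: (tmetric_basic oU riemG blG Uu Ll).
Qed.

Lemma energy_map_basic u l : W u -> tangL l -> 'D_l energy_map u = 0.
Proof.
move=> Wu Ll; have DH := tmetric_inv_basic Wu Ll.
have Dk : is_derive u l pullback_metric 0.
  have := pullback_metric_der l Wu; congr is_derive.
  by rewrite Ll mul0mx big1// => a _; rewrite mxE scale0r.
have DJ : is_derive u l jac 0.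
  by rewrite -(jac_basic Wu Ll); exact: (smooth_is_derive l smooth_jac Wu).
have [_ ->] := is_derive_trace (is_derive_mulmx (is_derive_mulmx (is_derive_mulmx DH DJ)
  Dk) (is_derive_trmx DJ)).
by rewrite trmx0 !(mul0mx, mulmx0, addr0) mxtrace0.
Qed.

Lemma differentiable_trmx m n (X : vec -> 'M[R]_(m, n)) u :
  differentiable X u -> differentiable (fun x => (X x)^T) u.
Proof.
move=> dX; apply: differentiable_mx => i j; under eq_fun do rewrite mxE.
exact: differentiable_entry.
Qed.

Lemma differentiable_inner_section (X Y : vec -> 'M[R]_(q, q')) u : W u ->
  differentiable X u -> differentiable Y u ->
  differentiable (inner_section tmetric_inv pullback_metric X Y) u.
Proof.
move=> Wu dX dY; have Uu := WU Wu; apply: differentiable_bigsum => i.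
apply: differentiable_entry.
apply: differentiable_mulmx; last exact: differentiable_trmx.
apply: differentiable_mulmx; last first.
  apply: (differentiable_comp (smooth_differentiable fol_f.1 Wu)).
  exact: (smooth_differentiable (smooth_tmetric oU' riemG') (WU' Wu)).
apply: differentiable_mulmx => //.
exact: (smooth_differentiable (smooth_invmx oU (smooth_tmetric oU riemG) (posdef_tmetric
  riemG)) Uu).
Qed.

Lemma differentiable_cov_jac u i : W u -> differentiable (cov_jac i) u.
Proof.
move=> Wu; apply: differentiableB; first apply: differentiableD.
- exact: (smooth_differentiable (smooth_derive (D i) smooth_jac) Wu).
- apply: differentiable_mulmx; last exact: differentiable_gam_tgt.
  exact: (smooth_differentiable smooth_jac Wu).
- apply: differentiable_mulmx; last exact: (smooth_differentiable smooth_jac Wu).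
  exact: (smooth_differentiable (smooth_gamma oU riemG i) (WU Wu)).
Qed.

Lemma energy_map_der u i : W u ->
  is_derive u (D i) energy_map (2 * inner_section tmetric_inv pullback_metric (cov_jac i)
    jac u).
Proof.
move=> Wu; apply: (@is_derive_energy _ _ W q q' (fun i => D i) tmetric_inv
  pullback_metric gam_src gam_tgt) => //.
- move=> x Wx; have [] := posdef_tmetric riemG (WU Wx) => hs _.
  by rewrite /tmetric_inv trmx_inv hs.
- by move=> x Wx; have [] := posdef_tmetric riemG' (WU' Wx).
- move=> x j Wx; exact: (derive_invh oU (smooth_tmetric oU riemG) (posdef_tmetric riemG)
  j (WU Wx)).
- by move=> x j Wx; exact: pullback_metric_der_eps.
- move=> x j Wx; exact/diff_derivable/(smooth_differentiable smooth_jac Wx).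
Qed.

(** First derivatives of the energy reduce, by basicness, to the inner products in [energy_map_der],
    and these are again differentiable. *)
Lemma twice_diff_energy_map : twice_diff W energy_map.
Proof.
have d1 x : W x -> differentiable energy_map x.
  by move=> Wx; apply: differentiable_inner_section => //;
    exact: (smooth_differentiable smooth_jac Wx).
split=> // v x Wx.
have E y : W y -> 'D_v energy_map y =
    \sum_i rsubmx v 0 i *: (2 * inner_section tmetric_inv pullback_metric (cov_jac i) jac
      y).
  move=> Wy; rewrite (derive_basic_dir v (d1 y Wy)); last by move=> l;
    exact: energy_map_basic.
  by apply: eq_bigr => i _; have [_ ->] := energy_map_der i Wy.
apply: (near_eq_differentiable oW Wx E); apply: differentiable_bigsum => i.
apply: differentiableZ; apply: differentiableM; first exact: differentiable_cst.
apply: differentiable_inner_section => //; first exact: differentiable_cov_jac.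
exact: (smooth_differentiable smooth_jac Wx).
Qed.

(** Harmonicity is tested on the frame of rows of [E], and E^T E = [tmetric_inv] turns the frame
    trace into the coordinate trace needed by [bochner]. *)
Lemma tension_frame : (forall V, open V -> V `<=` W -> forall E, basic_frame G V E ->
    forall u, V u -> tension G G' f E u = 0) ->
  forall u, W u -> \sum_i row i (tmetric_inv u *m cov_jac i u) = 0.
Proof.
move=> tens u Wu; have [E [bE sE E1 HE]] := orthonormal_frame; have Uu := WU Wu.
have dE a : differentiable (fun x => row a (E x)) u.
  apply: differentiable_mx => i j; under eq_fun do rewrite mxE.
  exact/differentiable_entry/(smooth_differentiable sE Uu).
rewrite -[RHS](tens W oW (@subset_refl _ W) _ (bE W oW WU) u Wu) /tension.
have -> : \sum_a nabla_dT G G' f (fun x => row a (E x)) (fun x => row a (E x)) u =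
    \sum_a \sum_i E u a i *: (row a (E u) *m cov_jac i u).
  apply: eq_bigr => a _; apply: etrans (nabla_dTE Wu (dE a) (dE a)) _.
  rewrite mulmx_sumr; apply: eq_bigr => i _.
  by rewrite -scalemxAr; congr (_ *: _); rewrite [row _ _ _ _]mxE.
rewrite exchange_big/=; apply: eq_bigr => i _.
rewrite HE// -mulmxA row_mul mulmx_sum_row; apply: eq_bigr => a _.
by rewrite row_mul; congr (_ *: _); rewrite [row _ _ _ _]mxE [_^T _ _]mxE.
Qed.

Definition hess_term u :=
  \sum_i \sum_j tmetric_inv u i j * inner_section tmetric_inv pullback_metric (cov_jac i)
    (cov_jac j) u.

Lemma energy_bochner : (forall u, W u -> \sum_i row i (tmetric_inv u *m cov_jac i u) = 0) ->
  forall u, W u ->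
  \sum_i \sum_j tmetric_inv u i j * ('D_(D j) (fun x => 'D_(D i) energy_map x) u
    - \sum_l gam_src j u i l * 'D_(D l) energy_map u) =
  2 * (\sum_j \sum_m (tmetric_inv u *m (jac u *m bil2 (fun a b => curvature_mx G' a b (f
    u)) (row j (jac u)) (row m (jac u))
        - curvature_mx G j m u *m jac u) *m pullback_metric u *m (jac u)^T *m tmetric_inv
          u) j m + hess_term u).
Proof.
move=> tens u Wu.
have := @bochner _ _ W q q' (fun i => D i) tmetric_inv pullback_metric gam_src gam_tgt oW
  _ _ _ _ jac
  _ _ _ _ _ _ cov_jac_sym tens u Wu.
rewrite /hess_term => bo; apply: etrans (bo _ _ _ _ _ _ _ _ _ _) _; last first.
- apply: (congr1 (fun a => 2 * (a + hess_term u))).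
  apply: eq_bigr => j _; apply: eq_bigr => m _.
  have Ec := curv_tgtE m j Wu.
  exact: (congr1 (fun K => (tmetric_inv u *m (jac u *m K - _) *m pullback_metric u *m
    (jac u)^T *m tmetric_inv u) j m) Ec).
- move=> x i j Wx.
  exact: (gam_sym oU (smooth_tmetric oU riemG) (posdef_tmetric riemG) _ _ (WU Wx)).
- by move=> x i j Wx; exact: (derive_comm (D j) (D i) oW Wx (smooth_jac 2)).
- by move=> x i j Wx; exact/diff_derivable/differentiable_gam_tgt.
- move=> x i j Wx; exact/diff_derivable/(smooth_differentiable (smooth_gamma oU riemG i)
  (WU Wx)).
- move=> x i j Wx; exact/diff_derivable/(smooth_differentiable (smooth_derive (D i)
  smooth_jac) Wx).
- move=> x i Wx; exact/diff_derivable/(smooth_differentiable smooth_jac Wx).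
- by move=> x j Wx; exact: pullback_metric_der_eps.
- move=> x j Wx; exact: (derive_invh oU (smooth_tmetric oU riemG) (posdef_tmetric riemG)
  j (WU Wx)).
- by move=> x Wx; have [] := posdef_tmetric riemG' (WU' Wx).
- move=> x Wx; have [] := posdef_tmetric riemG (WU Wx) => hs _.
  by rewrite /tmetric_inv trmx_inv hs.
Qed.

Definition leafwise_identity u : 'M[R]_(p + q) := block_mx 1%:M 0 0 (tmetric_inv u).
Definition drift u : vec :=
  row_mx 0 (- \row_l \sum_i \sum_j tmetric_inv u i j * gam_src j u i l).

(* The leafwise Laplacian annihilates the basic function [energy_map]; adding
   it to the transverse operator makes the latter elliptic on the chart. *)
Lemma second_order_energy u : W u ->
  second_order leafwise_identity drift energy_map u =
  \sum_i \sum_j tmetric_inv u i j * ('D_(D j) (fun x => 'D_(D i) energy_map x) u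
    - \sum_l gam_src j u i l * 'D_(D l) energy_map u).
Proof.
move=> Wu; rewrite /second_order.
have leaf i : tangL (delta_mx 0 (lshift q i) : vec).
  by apply/rowP => j; rewrite !mxE eq_rlshift.
have DDl i w : 'D_w (fun x => 'D_(delta_mx 0 (lshift q i)) energy_map x) u = 0.
  rewrite (derive_near (g := fun=> 0) w oW Wu); first exact: derive_cst.
  by move=> x Wx; exact: energy_map_basic.
rewrite big_split_ord/= big1 ?add0r; last first.
  by move=> i _; apply: big1 => j _; rewrite DDl mulr0.
rewrite [X in _ + X]big_split_ord/= [X in _ + (X + _)]big1 ?add0r; last first.
  by move=> i _; rewrite energy_map_basic ?mulr0.
have -> : \sum_(i < q) drift u 0 (rshift p i) * 'D_(delta_mx 0 (rshift p i)) energy_map u =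
    - \sum_i \sum_j tmetric_inv u i j * \sum_l gam_src j u i l * 'D_(D l) energy_map u.
  transitivity (- \sum_l (\sum_i \sum_j tmetric_inv u i j * gam_src j u i l) * 'D_(D l)
    energy_map u).
    rewrite -sumrN; apply: eq_bigr => l _; rewrite /drift row_mxEr mxE mxE mulNr.
    by [].
  congr (- _); under [RHS]eq_bigr do under eq_bigr do rewrite mulr_sumr.
  under [RHS]eq_bigr do rewrite exchange_big/=.
  rewrite [RHS]exchange_big/=; apply: eq_bigr => l _.
  rewrite mulr_suml; apply: eq_bigr => i _; rewrite mulr_suml; apply: eq_bigr => j _.
  by rewrite mulrA.
rewrite -sumrB; apply: eq_bigr => i _.
rewrite big_split_ord/= big1 ?add0r; last first.
  by move=> j _; rewrite /leafwise_identity block_mxEdl mxE mul0r.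
rewrite -sumrB; apply: eq_bigr => j _.
by rewrite /leafwise_identity block_mxEdr mulrBr.
Qed.

(** In an orthonormal frame both contractions with the inverse metric become sums of squares, so
    nonnegativity and the case of vanishing can be read off. *)
Lemma hess_term_frame (E : 'M[R]_q) u : tmetric_inv u = E^T *m E ->
  hess_term u = \sum_a \tr ((E *m \sum_i E a i *: cov_jac i u) *m pullback_metric u
    *m (E *m \sum_i E a i *: cov_jac i u)^T).
Proof.
move=> HE; have inE (X Y : vec -> 'M[R]_(q, q')) :
    inner_section tmetric_inv pullback_metric X Y u = \tr ((E *m X u) *m pullback_metric
      u *m (E *m Y u)^T).
  by rewrite /inner_section HE trmx_mul -!mulmxA mxtrace_mulC !mulmxA.
transitivity (\sum_i \sum_j \sum_a E a i * (E a j * \tr ((E *m cov_jac i u) *m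
  pullback_metric u *m (E *m cov_jac j u)^T))).
  apply: eq_bigr => i _; apply: eq_bigr => j _; rewrite inE HE mxE mulr_suml.
  by apply: eq_bigr => a _; rewrite mxE mulrA.
under eq_bigr do rewrite exchange_big/=; rewrite exchange_big/=; apply: eq_bigr => a _.
rewrite !mulmx_sumr !mulmx_suml raddf_sum/=; apply: eq_bigr => i _.
rewrite (raddf_sum trmx) mulmx_sumr raddf_sum/=; apply: eq_bigr => j _.
move: (cov_jac i u) (cov_jac j u) => X Y.
have -> : (E *m (E a j *: Y))^T = E a j *: (E *m Y)^T.
  by rewrite -scalemxAr; apply/matrixP => b c; rewrite !mxE.
by rewrite -!scalemxAr -!scalemxAl !mxtraceZ mulrCA.
Qed.

Lemma hess_term_ge0 u : W u -> 0 <= hess_term u.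
Proof.
move=> Wu; have [E [_ _ _ HE]] := orthonormal_frame.
rewrite (hess_term_frame (HE _ (WU Wu))); apply: sumr_ge0 => a _.
exact/trace_form_ge0/(posdef_tmetric riemG' (WU' Wu)).
Qed.

Lemma hess_term_eq0 u : W u -> hess_term u = 0 -> forall i, cov_jac i u = 0.
Proof.
move=> Wu; have [E [_ _ E1 HE]] := orthonormal_frame; have Uu := WU Wu.
have pk := posdef_tmetric riemG' (WU' Wu).
rewrite (hess_term_frame (HE _ Uu)) => /eqP; rewrite psumr_eq0; last first.
  by move=> a _; exact: trace_form_ge0.
move=> /allP h0.
have NE : (tmetric G u *m (E u)^T) *m E u = 1%:M.
  by apply: mulmx1C; rewrite mulmxA E1.
have EN : E u *m (tmetric G u *m (E u)^T) = 1%:M by rewrite mulmxA E1.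
have C0 a : \sum_i E u a i *: cov_jac i u = 0.
  have /= /eqP/(trace_form_eq0 pk) C1 := h0 a (mem_index_enum _).
  by rewrite -[LHS]mul1mx -NE -mulmxA C1 mulmx0.
(* The inverse of the frame matrix, used to return from frame directions to coordinate
   directions. *)
set N := tmetric G u *m (E u)^T in NE.
move=> j; transitivity (\sum_a N j a *: \sum_i E u a i *: cov_jac i u); last first.
  by apply: big1 => a _; rewrite C0 scaler0.
under eq_bigr do rewrite scaler_sumr; rewrite exchange_big/=.
transitivity (\sum_i (N *m E u) j i *: cov_jac i u).
  rewrite NE (bigD1 j)//= mxE eqxx scale1r big1 ?addr0// => i ij.
  by rewrite mxE eq_sym (negbTE ij) scale0r.
apply: eq_bigr => i _; rewrite [(N *m _) _ _]mxE scaler_suml.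
by apply: eq_bigr => a _; rewrite scalerA.
Qed.

Lemma energy_mapE (E : 'M[R]_q) u : tmetric_inv u = E^T *m E ->
  energy_map u = \tr ((E *m jac u) *m pullback_metric u *m (E *m jac u)^T).
Proof.
by move=> HE; rewrite /energy_map /energy /inner_section HE trmx_mul -!mulmxA
  mxtrace_mulC !mulmxA.
Qed.

Lemma energy_map_ge0 u : W u -> 0 <= energy_map u.
Proof.
move=> Wu; have [E [_ _ _ HE]] := orthonormal_frame.
rewrite (energy_mapE (HE _ (WU Wu))).
exact/trace_form_ge0/(posdef_tmetric riemG' (WU' Wu)).
Qed.

Lemma energy_map_eq0 u : W u -> energy_map u = 0 -> jac u = 0.
Proof.
move=> Wu; have [E [_ _ E1 HE]] := orthonormal_frame; have Uu := WU Wu.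
rewrite (energy_mapE (HE _ Uu)) => /(trace_form_eq0 (posdef_tmetric riemG' (WU' Wu))) EJ.
have NE : (tmetric G u *m (E u)^T) *m E u = 1%:M.
  by apply: mulmx1C; rewrite mulmxA E1.
by rewrite -[LHS]mul1mx -NE -mulmxA EJ mulmx0.
Qed.

Lemma energy_map_le (b : R) : (forall u, W u -> forall e, orthonormalQ G u e ->
    dT_norm2 G G' f u e <= b) -> forall u, W u -> energy_map u <= b.
Proof.
move=> le_b u Wu; have [E [bE _ _ HE]] := orthonormal_frame; have Uu := WU Wu.
apply: le_trans (le_b u Wu _ ((bE W oW WU).1 u Wu));
  rewrite (energy_mapE (HE _ Uu)) trace_formE.
by apply: ler_sum => a _; rewrite gQE dTE// row_mul.
Qed.

Lemma rank_jac u : W u -> rankT G f u = \rank (jac u).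
Proof.
move=> Wu; rewrite /rankT; congr (\rank _); apply/matrixP => i j.
by rewrite [LHS]mxE dTE// -rowE [LHS]mxE.
Qed.

(** The Ricci bound is tested on sections with constant coordinates; [curvQ_formula] shows that only
    their value at [u] matters. *)
Lemma ric_lower (lambda : R) :
  (forall V, open V -> V `<=` U -> forall E s, basic_frame G V E -> smooth_on V s ->
    forall u, V u -> lambda * gQ G u (s u) (s u) <= gQ G u (RicQ G E s u) (s u)) ->
  forall (E : vec -> 'M[R]_q), basic_frame G U (fun a u => row a (E u)) -> smooth_on U E ->
  forall u, U u -> forall x, lambda * (x *m tmetric G u *m x^T) 0 0 <=
    (frame_ricci (E u) (fun i j => curvature_mx G i j u) x *m tmetric G u *m x^T) 0 0.
Proof.
move=> Ric E bE sE u Uu x.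
have sc : smooth_on U (fun _ : vec => x) := smooth_cst U x.
have srow a : smooth_on U (fun u => row a (E u)).
  apply/(smooth_mxP oU) => i j; under eq_fun do rewrite mxE.
  exact: (smooth_mxP oU E).1.
have := Ric U oU (@subset_refl _ U) _ _ bE sc u Uu; rewrite !gQE;
  congr (_ <= (_ *m _ *m _) 0 0).
rewrite /RicQ /frame_ricci; apply: eq_bigr => a _.
have ssec s : smooth_on U s -> smooth_on U (sigma_sec G s).
  by apply: (smooth_sigma_sec oU riemG oU).
apply: etrans (curvQ_formula oU riemG blG oU (@subset_refl _ U) (srow a) Uu (ssec _ sc)
  (ssec _ (srow a))) _.
by rewrite !rsubmx_sigma.
Qed.

(** Cleared of its denominator the bound extends to dependent pairs, where both sides vanish. This
    is needed because the images of distinct frame vectors may be dependent. *)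
Lemma sec_upper (mu : R) :
  (forall V, open V -> V `<=` U' -> forall s t, smooth_on V s -> smooth_on V t ->
    forall u, V u -> row_free (col_mx (s u) (t u)) -> sectionalQ G' s t u <= mu) ->
  forall v, U' v -> forall x y, (y *m bil2 (fun a b => curvature_mx G' a b v) x y *m
    tmetric G' v *m x^T) 0 0 <=
    mu * ((x *m tmetric G' v *m x^T) 0 0 * (y *m tmetric G' v *m y^T) 0 0
          - (x *m tmetric G' v *m y^T) 0 0 ^+ 2).
Proof.
move=> Sec v Uv x y; have pk := posdef_tmetric riemG' Uv.
have R_anti a b : curvature_mx G' a b v = - curvature_mx G' b a v.
  have alg (m1 m2 m3 m4 : 'M[R]_q') : m1 - m2 + m3 - m4 = - (m2 - m1 + m4 - m3).
    by apply/matrixP => c d; rewrite !mxE; ring.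
  exact: alg.
have [fxy|nfxy] := boolP (row_free (col_mx x y)).
  have sx : smooth_on U' (fun _ : vec' => x) := smooth_cst U' x.
  have sy : smooth_on U' (fun _ : vec' => y) := smooth_cst U' y.
  have := Sec U' oU' (@subset_refl _ U') _ _ sx sy v Uv fxy.
  rewrite /sectionalQ !gQE ler_pdivrMr ?posdef_cauchy_schwarz//; congr (_ <= _).
  have ssec s : smooth_on U' s -> smooth_on U' (sigma_sec G' s).
    by apply: (smooth_sigma_sec oU' riemG' oU').
  have := curvQ_formula oU' riemG' blG' oU' (@subset_refl _ U') sy Uv (ssec _ sx) (ssec _
    sy).
  by rewrite !rsubmx_sigma => ->.
have self z : bil2 (fun a b => curvature_mx G' a b v) z z = 0.
  have /eqP := bil2_anti z z R_anti; rewrite -subr_eq0 opprK -mulr2n -scaler_nat scaler_eq0.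
  by rewrite pnatr_eq0 => /eqP.
have [[c ->]|[c ->]] := row_dependent nfxy.
- have -> : bil2 (fun a b => curvature_mx G' a b v) (c *: y) y = 0.
    have -> : c *: y = c%:M *m y by rewrite mul_scalar_mx.
    rewrite bil2_mull big_ord1 mxE eqxx mulr1n.
    by rewrite (_ : row 0 y = y) ?self ?scaler0//; apply/rowP => j; rewrite mxE.
  rewrite mulmx0 !mul0mx mxE.
  have -> : (c *: y)^T = c *: y^T by apply/matrixP => a b; rewrite !mxE.
  rewrite -!scalemxAl -!scalemxAr; move: (y *m _ *m _) => N; rewrite !mxE.
  by rewrite (_ : _ - _ = 0) ?mulr0//; ring.
- have -> : bil2 (fun a b => curvature_mx G' a b v) x (c *: x) = 0.
    have -> : c *: x = c%:M *m x by rewrite mul_scalar_mx.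
    rewrite bil2_mulr big_ord1 mxE eqxx mulr1n.
    by rewrite (_ : row 0 x = x) ?self ?scaler0//; apply/rowP => j; rewrite mxE.
  rewrite mulmx0 !mul0mx mxE.
  have -> : (c *: x)^T = c *: x^T by apply/matrixP => a b; rewrite !mxE.
  rewrite -!scalemxAl -!scalemxAr; move: (x *m _ *m _) => N; rewrite !mxE.
  by rewrite (_ : _ - _ = 0) ?mulr0//; ring.
Qed.

(** * The elliptic differential inequality for the energy *)

Section LocalInequality.
Variables (lambda mu C : R).
Hypotheses (mu_gt0 : 0 < mu) (C_gt0 : 0 < C).
Hypothesis Ric : forall V, open V -> V `<=` U -> forall E s, basic_frame G V E ->
  smooth_on V s -> forall u, V u ->
  lambda * gQ G u (s u) (s u) <= gQ G u (RicQ G E s u) (s u).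
Hypothesis Sec : forall V, open V -> V `<=` U' -> forall s t, smooth_on V s ->
  smooth_on V t -> forall u, V u -> row_free (col_mx (s u) (t u)) ->
  sectionalQ G' s t u <= mu.
Hypothesis tens : forall V, open V -> V `<=` W -> forall E, basic_frame G V E ->
  forall u, V u -> tension G G' f E u = 0.
Hypothesis rank_le : forall u, W u -> (rankT G f u)%:R <= C.

Lemma energy_inequality u : W u ->
  2 * (lambda * energy_map u - mu * (1 - C^-1) * energy_map u ^+ 2 + hess_term u)
  <= second_order leafwise_identity drift energy_map u.
Proof.
move=> Wu; rewrite second_order_energy// (energy_bochner (tension_frame tens) Wu).
rewrite ler_pM2l// lerD2r.
have [E [bE sE E1 HE]] := orthonormal_frame; have Uu := WU Wu.
have alg n (m1 m2 m3 m4 : 'M[R]_n) : m1 - m2 + m3 - m4 = - (m2 - m1 + m4 - m3).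
  by apply/matrixP => c d; rewrite !mxE; ring.
apply: (@curvature_estimate R q q' (tmetric G u) (E u) (pullback_metric u) (jac u)
  (fun i j => curvature_mx G i j u) (fun a b => curvature_mx G' a b (f u)) lambda mu C)
    => //.
- by have [] := posdef_tmetric riemG Uu.
- exact: E1.
- exact: (posdef_tmetric riemG' (WU' Wu)).
- by move=> i j; exact: alg.
- by move=> i j; exact: alg.
- by rewrite -rank_jac//; exact: rank_le.
- exact: (ric_lower Ric (bE U oU (@subset_refl _ U)) sE Uu).
- exact: (sec_upper Sec (WU' Wu)).
- exact: HE.
Qed.

Lemma posdef_leafwise_identity u : W u -> posdef (leafwise_identity u).
Proof.
move=> Wu; have [E [_ _ E1 HE]] := orthonormal_frame; have Uu := WU Wu.
have HT : (tmetric_inv u)^T = tmetric_inv u by rewrite HE// trmx_mul trmxK.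
split=> [|x x0]; first by rewrite /leafwise_identity tr_block_mx !trmx0 trmx1 HT.
rewrite -[x in X in _ < X]hsubmxK /leafwise_identity mul_row_block tr_row_mx mul_row_col.
rewrite !mulmx0 mulmx1 addr0 add0r mxE HE//.
have -> : rsubmx x *m ((E u)^T *m E u) *m (rsubmx x)^T =
    (rsubmx x *m (E u)^T) *m (rsubmx x *m (E u)^T)^T by rewrite trmx_mul trmxK !mulmxA.
have [l0|l0] := eqVneq (lsubmx x) 0; last first.
  rewrite ltr_pwDl ?sqnorm_ge0// lt_neqAle sqnorm_ge0 andbT eq_sym.
  by apply: contra l0 => /eqP/sqnorm_eq0 ->.
rewrite ltr_wpDl ?sqnorm_ge0// lt_neqAle sqnorm_ge0 andbT eq_sym.
apply: contra x0 => /eqP/sqnorm_eq0 xE.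
have [EH _] := frame_inv (posdef_field_sym (posdef_tmetric riemG) Uu) (E1 u Uu).
have r0 : rsubmx x = 0 by rewrite -[LHS]mulmx1 -EH !mulmxA xE !mul0mx.
by rewrite -[x]hsubmxK l0 r0 row_mx0.
Qed.

Lemma smooth_tmetric_inv : smooth_on W tmetric_inv.
Proof.
move=> k; apply: Ck_on_sub WU _.
exact: (smooth_invmx oU (smooth_tmetric oU riemG) (posdef_tmetric riemG)).
Qed.

Lemma continuous_leafwise_identity u : W u -> {for u, continuous leafwise_identity}.
Proof.
move=> Wu; apply: (@Ck_on_continuous _ _ _ 0 W) Wu.
by apply: Ck_on_block => //; [exact: Ck_on_cst|exact: Ck_on_cst|exact: Ck_on_cst|exact:
  smooth_tmetric_inv].
Qed.

Lemma continuous_drift u : W u -> {for u, continuous drift}.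
Proof.
move=> Wu; suff sd : smooth_on W drift by apply: (Ck_on_continuous (sd 0%N)).
apply: smooth_row_mx => //; first exact: smooth_cst.
apply: smooth_opp => //; apply/(smooth_mxP oW) => i l; under eq_fun do rewrite mxE.
apply: smooth_sum => // a; apply: smooth_sum => // b k; apply: Ck_onM => //.
  exact: (smooth_mxP oW tmetric_inv).1 smooth_tmetric_inv _ _ _.
have sg : smooth_on W (gam_src b).
  by move=> k'; apply: Ck_on_sub WU _; exact: (smooth_gamma oU riemG b).
exact: (smooth_mxP oW _).1 sg _ _ _.
Qed.

End LocalInequality.

End FoliatedMapChart.

(** * Independence of the charts and conclusion *)

Section Charts.
Variables (R : realType) (M M' : topologicalType) (n n' : nat).
Variables (c : chart R M n) (d : chart R M' n') (phi : M -> M').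

Lemma cimg_cinv u : cimg c u -> cdom c (cinv c u) /\ cmap c (cinv c u) = u.
Proof. by move=> [x cx <-]; rewrite cmapK. Qed.

Lemma rep_dom_cmap x : cdom c x -> cdom d (phi x) -> rep_dom c d phi (cmap c x).
Proof. by move=> cx dx; split; [exists x|rewrite cmapK]. Qed.

Lemma rep_cmap x : cdom c x -> rep c d phi (cmap c x) = cmap d (phi x).
Proof. by move=> cx; rewrite /rep cmapK. Qed.

Lemma rep_dom_sub : rep_dom c d phi `<=` cimg c.
Proof. by move=> u []. Qed.

Lemma rep_cimg u : rep_dom c d phi u -> cimg d (rep c d phi u).
Proof. by move=> [_ dx]; exists (phi (cinv c u)). Qed.

Lemma rep_dom_open : continuous phi -> open (rep_dom c d phi).
Proof.
move=> cphi; rewrite openE => u [cu du].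
have n1 : nbhs u (cimg c) by apply: open_nbhs_nbhs; split=> //; exact: cimg_open.
have n2 : nbhs u [set v | cdom d (phi (cinv c v))].
  have : nbhs (phi (cinv c u)) (cdom d) by apply: open_nbhs_nbhs; split=> //;
    exact: cdom_open.
  by move=> /cphi; exact: (cinv_continuous cu).
exact: filterI n1 n2.
Qed.

End Charts.

Lemma transition_inverse (R : realType) p q (M : topologicalType)
    (F : foliatedManifold R p q M) (c c' : chart R M (p + q)) x v :
  atlas F c -> atlas F c' -> cdom c x -> cdom c' x ->
  'd (rep c' c id) (cmap c' x) ('d (rep c c' id) (cmap c x) v) = v.
Proof.
move=> ac ac' cx c'x.
have oW : open (rep_dom c c' (@id M)) by apply: rep_dom_open => y; exact: cvg_id.
have oW' : open (rep_dom c' c (@id M)) by apply: rep_dom_open => y; exact: cvg_id.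
have Wu : rep_dom c c' id (cmap c x) by exact: rep_dom_cmap.
have Wu' : rep_dom c' c id (cmap c' x) by exact: rep_dom_cmap.
have d1 := smooth_differentiable (atlas_compat ac ac').1 Wu.
have d2 := smooth_differentiable (atlas_compat ac' ac).1 Wu'.
have rE : rep c c' id (cmap c x) = cmap c' x by exact: rep_cmap.
rewrite -deriveE//; rewrite -rE in d2 *.
have [_ <-] := derive_comp v d1 d2.
rewrite (derive_near (g := id) v oW Wu); first exact: derive_id.
move=> w [cw c'w]; rewrite /rep cmapK//=.
by have [] := cimg_cinv cw.
Qed.

(** The difference between [w] and the horizontal lift of its class is both tangent and orthogonal
    to L, hence zero. *)
Lemma orthogonal_sigma (R : realType) p q U (G : 'rV[R]_(p + q) -> 'M[R]_(p + q)) u w :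
  riemannian_on U G -> U u -> (forall l, tangL l -> inner G u w l = 0) ->
  w = sigma G u (rsubmx w).
Proof.
move=> rG Uu wL; apply/eqP; rewrite -subr_eq0; apply/eqP.
apply: (posdef_eq0 (posdef_G rG Uu)).
set w0 := w - _; have Lw : tangL w0 by rewrite /tangL /w0 linearB/= rsubmx_sigma subrr.
rewrite {1}/w0 !mulmxBl mxE [X in _ + X]mxE.
have := wL w0 Lw; rewrite /inner => ->.
have := sigma_orthogonal (rsubmx w) (unit_GLL rG Uu) Lw; rewrite /inner => ->.
by rewrite subrr.
Qed.

Section ChartChange.
Variables (R : realType) (p q : nat) (M : topologicalType).
Variable F : foliatedRiemannian R p q M.
Variables (c c' : chart R M (p + q)) (x : M).
Hypotheses (ac : atlas F c) (ac' : atlas F c') (cx : cdom c x) (c'x : cdom c' x).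

Definition trans_mx := jac (rep c c' id) (cmap c x).

Lemma rsubmx_trans v : rsubmx ('d (rep c c' id) (cmap c x) v) = rsubmx v *m trans_mx.
Proof.
apply: (@rsubmx_diff _ _ _ _ _ (rep_dom c c' id)).
- by apply: rep_dom_open => y; exact: cvg_id.
- exact: (atlas_compat ac ac').
- exact: rep_dom_cmap.
Qed.

End ChartChange.

(** * Change of charts for the transverse metric *)

Section MetricChange.
Variables (R : realType) (p q : nat) (M : topologicalType).
Variable F : foliatedRiemannian R p q M.
Variables (c c' : chart R M (p + q)) (x : M).
Hypotheses (ac : atlas F c) (ac' : atlas F c') (cx : cdom c x) (c'x : cdom c' x).
Notation T := (trans_mx c c' x).

Lemma trans_mxK : T *m trans_mx c' c x = 1%:M.
Proof.
apply/row_matrixP => i; rewrite !rowE mulmxA mulmx1.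
have := congr1 rsubmx (transition_inverse (eps R p i) ac ac' cx c'x).
by rewrite (rsubmx_trans ac' ac c'x cx) (rsubmx_trans ac ac' cx c'x) rsubmx_eps.
Qed.

Lemma tmetric_change : tmetric (metric F c) (cmap c x) =
  T *m tmetric (metric F c') (cmap c' x) *m T^T.
Proof.
have rG := metric_riemannian ac; have rG' := metric_riemannian ac'.
have cu : cimg c (cmap c x) by exists x.
have cu' : cimg c' (cmap c' x) by exists x.
have Wu : rep_dom c c' id (cmap c x) by exact: rep_dom_cmap.
have rE : rep c c' id (cmap c x) = cmap c' x by exact: rep_cmap.
have comp v w : inner (metric F c) (cmap c x) v w = inner (metric F c') (cmap c' x)
    ('d (rep c c' id) (cmap c x) v) ('d (rep c c' id) (cmap c x) w).
  by rewrite (metric_compat ac ac' Wu) rE.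
(* Transition maps are isometric and preserve L in both directions, so they carry horizontal lifts
   to horizontal lifts. *)
have dsig a : 'd (rep c c' id) (cmap c x) (sigma (metric F c) (cmap c x) a) =
    sigma (metric F c') (cmap c' x) (a *m T).
  rewrite [LHS](orthogonal_sigma rG' cu'); first by rewrite (rsubmx_trans ac ac' cx c'x)
    rsubmx_sigma.
  move=> l Ll; rewrite -[l](transition_inverse l ac' ac c'x cx) -comp.
  apply: sigma_orthogonal; first exact: (unit_GLL rG cu).
  by rewrite /tangL (rsubmx_trans ac' ac c'x cx) Ll mul0mx.
apply/matrixP => i j.
have E (K : 'M[R]_q) : K i j = ((delta_mx 0 i : 'rV_q) *m K *m (delta_mx 0 j : 'rV_q)^T)
  0 0.
  by rewrite -rowE trmx_delta -colE !mxE.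
rewrite [LHS]E -inner_sigmaE comp !dsig inner_sigmaE [RHS]E.
by rewrite trmx_mul !mulmxA.
Qed.

End MetricChange.

Section EnergyChange.
Variables (R : realType) (p q p' q' : nat) (M M' : topologicalType).
Variables (F : foliatedRiemannian R p q M) (F' : foliatedRiemannian R p' q' M').
Variables (phi : M -> M') (phi_fol : foliated_map F F' phi).

Notation en c d := (energy_map (metric F c) (metric F' d) (rep c d phi)).

Lemma rep_open (c : chart R M (p + q)) (d : chart R M' (p' + q')) : open (rep_dom c d phi).
Proof. by apply: rep_dom_open; exact: phi_fol.1. Qed.

Lemma jac_change c c' d d' x : atlas F c -> atlas F c' -> atlas F' d -> atlas F' d' ->
  cdom c x -> cdom c' x -> cdom d (phi x) -> cdom d' (phi x) ->
  trans_mx c c' x *m jac (rep c' d' phi) (cmap c' x) =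
  jac (rep c d phi) (cmap c x) *m trans_mx d d' (phi x).
Proof.
move=> ac ac' ad ad' cx c'x dx d'x; set u := cmap c x; set u' := cmap c' x.
have W1 : rep_dom c d phi u := rep_dom_cmap cx dx.
have W2 : rep_dom c' d' phi u' := rep_dom_cmap c'x d'x.
have W3 : rep_dom c c' id u := @rep_dom_cmap _ _ _ _ _ c c' id x cx c'x.
have W4 : rep_dom d d' id (cmap d (phi x)) := @rep_dom_cmap _ _ _ _ _ d d' id _ dx d'x.
have f1 := phi_fol.2 c d ac ad; have f2 := phi_fol.2 c' d' ac' ad'.
have E3 : rep c c' id u = u' by exact: rep_cmap.
have E1 : rep c d phi u = cmap d (phi x) by exact: rep_cmap.
have d1 := smooth_differentiable f1.1 W1.
have d2 := smooth_differentiable f2.1 W2.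
have d3 := smooth_differentiable (atlas_compat ac ac').1 W3.
have d4 := smooth_differentiable (atlas_compat ad ad').1 W4.
rewrite -E3 in d2; rewrite -E1 in d4.
have chain v : 'd (rep c' d' phi) u' ('d (rep c c' id) u v) =
    'd (rep d d' id) (cmap d (phi x)) ('d (rep c d phi) u v).
  have [_ H1] := derive_comp v d3 d2; have [_ H2] := derive_comp v d1 d4.
  rewrite (deriveE _ d2) E3 in H1; rewrite (deriveE _ d4) E1 in H2.
  apply: etrans (esym H1) _; apply: etrans _ H2.
  (* On this open set the two composites d' o phi and (d' o d^-1) o (d o phi), read in the chart
     [c], are literally equal, so their derivatives agree. *)
  have oW : open (rep_dom c d phi `&` (rep_dom c c' id `&` rep_dom c d' phi)).
    by apply: openI; [exact: rep_open|apply: openI; [apply: rep_dom_open => y;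
      exact: cvg_id|exact: rep_open]].
  apply: (derive_near v oW).
    by split=> //; split=> //; exact: rep_dom_cmap.
  move=> w [[cw dw] [[_ c'w] [_ d'w]]].
  by rewrite /rep !cmapK.
apply/row_matrixP => i; rewrite !rowE !mulmxA.
have := congr1 rsubmx (chain (eps R p i)).
rewrite (rsubmx_diff (@rep_open c' d') f2 _ W2) (rsubmx_trans ac ac' cx c'x).
by rewrite (rsubmx_trans ad ad' dx d'x) (rsubmx_diff (@rep_open c d) f1 _ W1) rsubmx_eps.
Qed.

(** The inverse metric of Q, the metric of Q' and the Jacobian transform by mutually inverse
    transition matrices, which cancel under the trace. *)
Lemma energy_change c c' d d' x : atlas F c -> atlas F c' -> atlas F' d -> atlas F' d' ->
  cdom c x -> cdom c' x -> cdom d (phi x) -> cdom d' (phi x) ->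
  en c d (cmap c x) = en c' d' (cmap c' x).
Proof.
move=> ac ac' ad ad' cx c'x dx d'x.
have Ek : pullback_metric (metric F' d) (rep c d phi) (cmap c x) = tmetric (metric F' d)
  (cmap d (phi x)).
  by rewrite /pullback_metric rep_cmap.
have Ek' : pullback_metric (metric F' d') (rep c' d' phi) (cmap c' x) = tmetric (metric
  F' d') (cmap d' (phi x)).
  by rewrite /pullback_metric rep_cmap.
rewrite /energy_map /energy /inner_section Ek Ek' /tmetric_inv.
have hE := tmetric_change ac ac' cx c'x; have kE := tmetric_change ad ad' dx d'x.
have JE := jac_change ac ac' ad ad' cx c'x dx d'x.
have TK := trans_mxK ac ac' cx c'x; have KT := trans_mxK ac' ac c'x cx.
have cu : cimg c (cmap c x) by exists x.
have cu' : cimg c' (cmap c' x) by exists x.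
have uh := posdef_unit (posdef_tmetric (metric_riemannian ac) cu).
have uh' := posdef_unit (posdef_tmetric (metric_riemannian ac') cu').
move: hE kE JE TK KT uh uh'.
move: (trans_mx c c' x) (trans_mx d d' (phi x)) (trans_mx c' c x) => T T' S.
move: (tmetric (metric F c) _) (tmetric (metric F c') _) (tmetric (metric F' d) _)
  (tmetric (metric F' d') _) (jac _ (cmap c x)) (jac _ (cmap c' x)) => h h' k k' J J'.
move=> hE -> JE TS ST uh uh'.
have iE : invmx h = S^T *m invmx h' *m S.
  have hS : h *m (S^T *m invmx h' *m S) = 1%:M.
    by rewrite hE -!mulmxA (mulmxA T^T) -trmx_mul ST trmx1 mul1mx (mulmxA h') mulmxV//
      mul1mx.
  by rewrite -[LHS]mulmx1 -hS (mulmxA (invmx h) h) mulVmx// mul1mx.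
have -> : invmx h *m J *m (T' *m k' *m T'^T) *m J^T =
    invmx h *m (J *m T') *m k' *m (J *m T')^T by rewrite trmx_mul !mulmxA.
rewrite -JE iE trmx_mul !mulmxA mxtrace_mulC.
rewrite -(mulmxA _ S T) ST mulmx1 !mulmxA -trmx_mul ST trmx1 mul1mx.
by [].
Qed.

End EnergyChange.

(** * Sign of the zeroth-order term *)

Section Reaction.
Variables (R : realFieldType) (lambda mu C m h : R).
Hypotheses (mu_gt0 : 0 < mu) (C_ge2 : 2 <= C) (m_ge0 : 0 <= m).

Lemma reaction_ge0 : m <= lambda * C / (mu * (C - 1)) ->
  0 <= lambda * m - mu * (1 - C^-1) * m ^+ 2.
Proof.
have C1 : 0 < C - 1 by move: C_ge2; lra.
have C0 : 0 < C by move: C_ge2; lra.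
rewrite ler_pdivlMr ?mulr_gt0// => mb.
have -> : lambda * m - mu * (1 - C^-1) * m ^+ 2 = m * ((lambda * C - m * (mu * (C - 1)))
  / C).
  by field; rewrite gt_eqF.
by rewrite mulr_ge0// divr_ge0 ?subr_ge0// ltW.
Qed.

(** If m > 0, the bound mu m <= lambda makes the quadratic term at most lambda (1 - 1/C) m, so at
    least lambda m / C > 0 would survive on the left. *)
Lemma reaction_le0 : 0 < lambda -> m <= lambda / mu -> 0 <= h ->
  lambda * m - mu * (1 - C^-1) * m ^+ 2 + h <= 0 -> m = 0.
Proof.
move=> lambda_gt0; rewrite ler_pdivlMr// => mmu h0 ineq.
apply/eqP; rewrite eq_le m_ge0 andbT leNgt; apply/negP => mpos.
have C0 : 0 < C by move: C_ge2; lra.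
have Ci0 : 0 < C^-1 by rewrite invr_gt0.
have Ci1 : C^-1 <= 1 by rewrite invf_le1//; move: C_ge2; lra.
have h1 : mu * (1 - C^-1) * m ^+ 2 <= lambda * ((1 - C^-1) * m).
  have -> : mu * (1 - C^-1) * m ^+ 2 = (m * mu) * ((1 - C^-1) * m) by ring.
  by rewrite ler_wpM2r// mulr_ge0// subr_ge0.
have h2 : 0 < lambda * (C^-1 * m) by rewrite !mulr_gt0.
lra.
Qed.

End Reaction.

(** * The energy density on M and the global argument *)

Section Conclusion.
Variables (R : realType) (p q p' q' : nat) (M M' : topologicalType).
Variables (F : foliatedRiemannian R p q M) (F' : foliatedRiemannian R p' q' M').
Hypothesis M_compact : compact [set: M].
Variables (lambda mu : R).
Hypotheses (lambda_gt0 : 0 < lambda) (mu_gt0 : 0 < mu).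
Hypotheses (RicQ_lambda : RicQ_ge F lambda) (KQ_mu : sectionalQ_le F' mu).
Variable phi : M -> M'.
Hypothesis phi_harmonic : transversally_harmonic F F' phi.
Variable C : R.
Hypotheses (C_ge2 : 2 <= C) (rank_phi : rankT_le F F' phi C).

Local Notation en c d := (energy_map (metric F c) (metric F' d) (rep c d phi)).
Local Notation L c := (second_order (leafwise_identity (metric F c)) (drift (metric F c))).

Let phi_fol : foliated_map F F' phi := phi_harmonic.1.

Definition src_chart (x : M) := s2val (cid2 (atlas_cover F x)).
Definition tgt_chart (y : M') := s2val (cid2 (atlas_cover F' y)).

(** The charts are picked by choice and vary arbitrarily with [x]; [energy_densityE] replaces them
    by any admissible pair, which is what makes continuity accessible. *)
Definition energy_density (x : M) : R :=
  en (src_chart x) (tgt_chart (phi x)) (cmap (src_chart x) x).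

Lemma energy_densityE c d x : atlas F c -> atlas F' d -> cdom c x -> cdom d (phi x) ->
  energy_density x = en c d (cmap c x).
Proof.
move=> ac ad cx dx; apply: energy_change => //; rewrite /src_chart /tgt_chart.
- by case: cid2.
- by case: cid2.
- by case: cid2.
- by case: cid2.
Qed.

Section InCharts.
Variables (c : chart R M (p + q)) (d : chart R M' (p' + q')).
Hypotheses (ac : atlas F c) (ad : atlas F' d).
Notation W := (rep_dom c d phi).

Let oW : open W := @rep_open _ _ _ _ _ _ _ _ _ _ phi_fol c d.
Let oU : open (cimg c) := @cimg_open _ _ _ c.
Let oU' : open (cimg d) := @cimg_open _ _ _ d.
Let rG := metric_riemannian ac.
Let rG' := metric_riemannian ad.
Let bG := metric_bundle_like ac.
Let bG' := metric_bundle_like ad.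
Let WU : W `<=` cimg c := @rep_dom_sub _ _ _ _ _ c d phi.
Let WU' : forall u, W u -> cimg d (rep c d phi u) := @rep_cimg _ _ _ _ _ c d phi.
Let fol_f : foliated_on W (rep c d phi) := phi_fol.2 c d ac ad.

Lemma energy_density_rep u : W u -> energy_density (cinv c u) = en c d u.
Proof.
move=> [cu du]; have [cx E] := cimg_cinv cu.
by rewrite (energy_densityE ac ad cx du) E.
Qed.

Lemma energy_rep_inequality u : W u ->
  2 * (lambda * en c d u - mu * (1 - C^-1) * en c d u ^+ 2
       + hess_term (metric F c) (metric F' d) (rep c d phi) u) <= L c (en c d) u.
Proof.
move=> Wu; apply: (energy_inequality oU rG bG oU' rG' bG' oW WU WU' fol_f mu_gt0) => //.
- exact: lt_le_trans C_ge2.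
- exact: RicQ_lambda.
- exact: KQ_mu.
- move=> V oV VW E bE; exact: (phi_harmonic.2 c d ac ad V oV VW E bE).
- move=> v Wv; exact: (rank_phi ac ad Wv).
Qed.

Lemma twice_diff_rep : twice_diff W (en c d).
Proof. exact: (twice_diff_energy_map oU rG bG oU' rG' bG' oW WU WU' fol_f). Qed.

Lemma posdef_rep u : W u -> posdef (leafwise_identity (metric F c) u).
Proof. exact: (posdef_leafwise_identity oU rG bG WU). Qed.

Lemma energy_rep_ge0 u : W u -> 0 <= en c d u.
Proof. exact: (energy_map_ge0 oU rG bG rG' WU WU'). Qed.

Lemma hess_rep_ge0 u : W u -> 0 <= hess_term (metric F c) (metric F' d) (rep c d phi) u.
Proof. exact: (hess_term_ge0 oU rG bG rG' WU WU'). Qed.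

Lemma energy_rep_at_max u : W u -> (forall v, W v -> en c d v <= en c d u) ->
  L c (en c d) u <= 0.
Proof.
move=> Wu umax; exact: (second_order_at_max _ oW Wu (posdef_rep Wu) twice_diff_rep umax).
Qed.

Lemma energy_rep_strong_max m u : (forall v, W v -> 0 <= L c (en c d) v) ->
  (forall v, W v -> en c d v <= m) -> W u -> en c d u = m ->
  \forall v \near u, en c d v = m.
Proof.
move=> Lge le_m Wu um.
apply: (strong_maximum oW twice_diff_rep posdef_rep _ _ Lge le_m Wu um) => v Wv.
  exact: (continuous_leafwise_identity oU rG oW WU Wv).
exact: (continuous_drift oU rG oW WU Wv).
Qed.

Lemma constant_rep u v : W u -> en c d u = 0 -> tangL ('d (rep c d phi) u v).
Proof.
move=> Wu e0; have J0 := energy_map_eq0 oU rG bG rG' WU WU' Wu e0.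
by rewrite /tangL (rsubmx_diff oW fol_f v Wu) J0 mulmx0.
Qed.

Lemma totally_geodesic_rep u V s t : W u ->
  hess_term (metric F c) (metric F' d) (rep c d phi) u = 0 ->
  V u -> smooth_on V s -> smooth_on V t ->
  nabla_dT (metric F c) (metric F' d) (rep c d phi) s t u = 0.
Proof.
move=> Wu h0 Vu ss st; have B0 := hess_term_eq0 oU rG bG rG' WU WU' Wu h0.
apply: etrans (nabla_dTE oU rG bG oU' rG' bG' oW WU WU' fol_f Wu
  (smooth_differentiable ss Vu) (smooth_differentiable st Vu)) _.
by rewrite big1 ?mulmx0// => i _; rewrite B0 scaler0.
Qed.

Lemma near_energy_density x : cdom c x -> cdom d (phi x) ->
  \forall y \near x, energy_density y = en c d (cmap c y).
Proof.
move=> cx dx; have n1 : nbhs x (cdom c) by apply: open_nbhs_nbhs; split=> //;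
  exact: cdom_open.
have n2 : nbhs x (phi @^-1` cdom d).
  by apply: phi_fol.1; apply: open_nbhs_nbhs; split=> //; exact: cdom_open.
by apply: filterS2 n1 n2 => y cy dy; exact: energy_densityE.
Qed.

End InCharts.

Lemma charts_at x : exists c d, [/\ atlas F c, atlas F' d, cdom c x & cdom d (phi x)].
Proof.
have [c ac cx] := atlas_cover F x; have [d ad dx] := atlas_cover F' (phi x).
by exists c, d.
Qed.

Lemma continuous_energy_density : continuous energy_density.
Proof.
move=> x; have [c [d [ac ad cx dx]]] := charts_at x.
have Wx := @rep_dom_cmap _ _ _ _ _ c d phi x cx dx.
have ce : {for cmap c x, continuous (en c d)}.
  by apply: differentiable_continuous; exact: (twice_diff_rep ac ad).1.
have ncd := near_energy_density ac ad cx dx.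
rewrite /continuous_at (nbhs_singleton ncd).
have cc : {for x, continuous (fun y => en c d (cmap c y))}.
  by apply: continuous_comp; [exact: cmap_continuous|exact: ce].
apply: cvg_trans cc; apply: near_eq_cvg.
by apply: filterS ncd => y ->.
Qed.

Lemma energy_density_max (x0 : M) : exists xm, forall x,
  energy_density x <= energy_density xm.
Proof.
have [||xm _ xmP] := @compact_EVT_max M R energy_density [set: M] _ M_compact.
- by exists x0.
- by apply: continuous_in_subspaceT => x _; exact: continuous_energy_density.
- by exists xm => x; apply: xmP; rewrite in_setT.
Qed.

Lemma energy_density_le (b : R) : dT_norm2_le F F' phi b -> forall x, energy_density x <= b.
Proof.
move=> le_b x; have [c [d [ac ad cx dx]]] := charts_at x.
rewrite (energy_densityE ac ad cx dx).
have Wx := @rep_dom_cmap _ _ _ _ _ c d phi x cx dx.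
apply: (energy_map_le (@cimg_open _ _ _ c) (metric_riemannian ac) (metric_bundle_like ac)
  (@rep_open _ _ _ _ _ _ _ _ _ _ phi_fol c d) (@rep_dom_sub _ _ _ _ _ c d phi) (phi_fol.2
    c d ac ad) _ Wx).
exact: le_b.
Qed.

(** A maximum over M is also one over the chart domain, so the second-derivative test bounds from
    above the operator that the Bochner inequality bounds from below. *)
Lemma rep_at_max c d xm : atlas F c -> atlas F' d -> cdom c xm -> cdom d (phi xm) ->
  (forall x, energy_density x <= energy_density xm) ->
  lambda * energy_density xm - mu * (1 - C^-1) * energy_density xm ^+ 2
  + hess_term (metric F c) (metric F' d) (rep c d phi) (cmap c xm) <= 0.
Proof.
move=> ac ad cx dx xmP; have Wx := @rep_dom_cmap _ _ _ _ _ c d phi xm cx dx.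
have E := energy_densityE ac ad cx dx.
have Lle : L c (en c d) (cmap c xm) <= 0.
  apply: (energy_rep_at_max ac ad Wx) => v Wv.
  by rewrite -E -(energy_density_rep ac ad Wv); exact: xmP.
have half (z : R) : 2 * z <= 0 -> z <= 0 by rewrite pmulr_rle0.
rewrite E; exact: half (le_trans (energy_rep_inequality ac ad Wx) Lle).
Qed.

Theorem constant_of_small_energy :
  dT_norm2_le F F' phi (lambda / mu) -> transversally_constant F F' phi.
Proof.
move=> le_b c d ac ad u v Wu; apply: constant_rep => //.
rewrite -(energy_density_rep ac ad Wu).
(* The point under consideration also supplies the nonemptiness of M that a maximum requires. *)
have [xm xmP] := energy_density_max (cinv c u).
have e0 : 0 <= energy_density (cinv c u).
  by rewrite (energy_density_rep ac ad Wu); exact: energy_rep_ge0.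
have [c1 [d1 [ac1 ad1 cx dx]]] := charts_at xm.
have W1 := @rep_dom_cmap _ _ _ _ _ c1 d1 phi xm cx dx.
have m0 := reaction_le0 mu_gt0 C_ge2 (le_trans e0 (xmP _)) lambda_gt0 (energy_density_le
  le_b xm)
  (hess_rep_ge0 ac1 ad1 W1) (rep_at_max ac1 ad1 cx dx xmP).
by apply/eqP; rewrite eq_le e0 andbT -m0; exact: xmP.
Qed.

Hypothesis M_connected : connected [set: M].

Theorem geodesic_of_bounded_energy :
  dT_norm2_le F F' phi (lambda * C / (mu * (C - 1))) ->
  transversally_totally_geodesic F F' phi.
Proof.
move=> le_b; have reaction x : 0 <= energy_density x ->
    0 <= lambda * energy_density x - mu * (1 - C^-1) * energy_density x ^+ 2.
  by move=> e0; exact: reaction_ge0 mu_gt0 C_ge2 e0 (energy_density_le le_b x).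
have ge0 x : 0 <= energy_density x.
  have [c [d [ac ad cx dx]]] := charts_at x; rewrite (energy_densityE ac ad cx dx).
  by apply: energy_rep_ge0 => //; exact: rep_dom_cmap.
have Lge c d : atlas F c -> atlas F' d -> forall v,
  rep_dom c d phi v -> 0 <= L c (en c d) v.
  move=> ac ad v Wv; apply: le_trans (energy_rep_inequality ac ad Wv).
  rewrite mulr_ge0// addr_ge0 ?hess_rep_ge0//.
  by rewrite -(energy_density_rep ac ad Wv); exact/reaction/ge0.
move=> c d ac ad V oV VW s t ss st u Vu; have Wu := VW _ Vu.
have [xm xmP] := energy_density_max (cinv c u).
pose S := [set x | energy_density x = energy_density xm].
(* The set of maximum points is nonempty by compactness, open by the strong maximum principle in
   charts and closed by continuity. *)
have ST : S = [set: M].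
  apply: M_connected.
  - by exists xm.
  - exists S; last by rewrite setTI.
    rewrite openE => x Sx; have [c1 [d1 [ac1 ad1 cx dx]]] := charts_at x.
    have Wx := @rep_dom_cmap _ _ _ _ _ c1 d1 phi x cx dx.
    have ex : en c1 d1 (cmap c1 x) = energy_density xm.
      by rewrite -(energy_densityE ac1 ad1 cx dx).
    have lem v : rep_dom c1 d1 phi v -> en c1 d1 v <= energy_density xm.
      by move=> Wv; rewrite -(energy_density_rep ac1 ad1 Wv); exact: xmP.
    have near1 := energy_rep_strong_max ac1 ad1 (Lge _ _ ac1 ad1) lem Wx ex.
    have near2 : \forall y \near x, en c1 d1 (cmap c1 y) = energy_density xm.
      exact: (cmap_continuous cx near1).
    by apply: filterS2 (near_energy_density ac1 ad1 cx dx) near2 => y ey ny;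
      exact: (etrans ey ny).
  - exists S; last by rewrite setTI.
    have -> : S = energy_density @^-1` [set energy_density xm] by [].
    apply: preimage_closed; last exact: closed_eq.
    by move=> x _; exact: continuous_energy_density.
have const x : energy_density x = energy_density xm by have : S x by rewrite ST.
have [cx E] := cimg_cinv Wu.1.
(* Once the energy is constant every point is a maximum point, so [rep_at_max] can be used at [u]
   itself; its nonnegative reaction term leaves the Hessian term no room to be positive. *)
have umax y : energy_density y <= energy_density (cinv c u) by rewrite (const (cinv c u)).
have := rep_at_max ac ad cx Wu.2 umax; rewrite E => hle.
have r0 := reaction _ (ge0 (cinv c u)).
have h0 := hess_rep_ge0 ac ad Wu.
apply: (totally_geodesic_rep ac ad Wu _ Vu ss st); apply/eqP; rewrite eq_le h0 andbT.
by apply: le_trans hle; rewrite lerDr.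
Qed.

End Conclusion.

Theorem theorem5p4 (R : realType) (p q p' q' : nat) (M M' : topologicalType)
    (F : foliatedRiemannian R p q M) (F' : foliatedRiemannian R p' q' M')
    (M_compact : compact [set: M]) (M_connected : connected [set: M])
    (lambda mu : R) (lambda_gt0 : 0 < lambda) (mu_gt0 : 0 < mu)
    (RicQ_lambda : RicQ_ge F lambda) (KQ_mu : sectionalQ_le F' mu)
    (phi : M -> M') (phi_harmonic : transversally_harmonic F F' phi)
    (C : R) (C_ge2 : 2 <= C) (rank_phi : rankT_le F F' phi C) :
  (dT_norm2_le F F' phi (lambda * C / (mu * (C - 1))) ->
     transversally_constant F F' phi \/
     transversally_totally_geodesic F F' phi) /\
  (dT_norm2_le F F' phi (lambda / mu) -> transversally_constant F F' phi).
Proof.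
split=> [le_b|le_b].
  (* The second alternative always holds: a transversally constant map is in particular
     transversally totally geodesic. *)
  right; exact: (geodesic_of_bounded_energy M_compact mu_gt0 RicQ_lambda KQ_mu
    phi_harmonic C_ge2 rank_phi M_connected le_b).
exact: (constant_of_small_energy M_compact lambda_gt0 mu_gt0 RicQ_lambda KQ_mu
  phi_harmonic C_ge2 rank_phi le_b).
Qed.
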